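(* Let $\widetilde{\mathcal M}_3$ be the space of closed $G_2$-structures $\varphi=\varphi^K-\sum_{i=1}^3(u_i-1)\,d\theta^i\wedge dx^{0i}$ on $\mathbb T^7$ in the class $[\varphi^K]$, equipped with the Dirichlet metric $\mathcal G$, and put $u=u_1u_2u_3$. Let $\chi$ be a non-negative concave function, $\mathrm{Vol}_\chi=\int\chi(u)$, $r=\chi_{uu}$ and $s=\chi_{uu}+\chi_uu^{-1}$. Along a canonical geodesic $(u_1(t),u_2(t),u_3(t))$, $f_i=\partial_tu_i$, with $a_i=f_i/u_i$, $b_i=u_i'/u_i$, $c_i=Q_i(f_i)/u_i$, $b_{ij}=b_ic_j$, one has $\partial_t^2\mathrm{Vol}_\chi=\int u^2\,\mathbf Q$, where \begin{align*} \mathbf Q=\;&r(a_1^2+a_2^2+a_3^2)+2s(a_1a_2+a_2a_3+a_1a_3)+(r-s)(b_{11}^2+b_{22}^2+b_{33}^2)\\ &+a_1[-2(r-s)b_{11}+sb_{12}+sb_{13}+(r-s)b_{21}+rb_{22}+sb_{23}+(r-s)b_{31}+sb_{32}+rb_{33}]\\ &+a_2[rb_{11}+(r-s)b_{12}+sb_{13}+sb_{21}-2(r-s)b_{22}+sb_{23}+sb_{31}+(r-s)b_{32}+rb_{33}]\\ &+a_3[rb_{11}+sb_{12}+(r-s)b_{13}+sb_{21}+rb_{22}+(r-s)b_{23}+sb_{31}+sb_{32}-2(r-s)b_{33}]\\ &+(r-s)[-b_{11}b_{21}-b_{12}b_{22}+b_{13}b_{23}-b_{11}b_{31}+b_{12}b_{32}-b_{13}b_{33}+b_{21}b_{31}-b_{22}b_{32}-b_{23}b_{33}].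 \end{align*} The matrix of $\mathbf Q$ (as a quadratic form in the twelve variables $a_i,b_{ij}$) is not negative semidefinite. In particular, no $\chi$ volume functional $\mathrm{Vol}_\chi$, including the volume functional $\mathrm{Vol}(\varphi)=\int(u_1u_2u_3)^{1/3}$, is concave along the canonical geodesics in $(\widetilde{\mathcal M}_3,\mathcal G)$: the volume functional fails to be concave along the canonical geodesics, and this non-concavity persists for all weighted volume functionals.
   Context: $\mathbb T^7=\mathbb T^3\times\mathbb T^4$ has coordinates $\theta^1,\theta^2,\theta^3$ and $x^0,\dots,x^3$. $\varphi^K=d\theta^{123}-\sum_id\theta^i\wedge\omega_i^K$ with $\omega_1^K=dx^{01}+dx^{23}$, $\omega_2^K=dx^{02}+dx^{31}$, $\omega_3^K=dx^{03}+dx^{12}$. The functions $u_i>0$ depend only on $x_0\in S^1$ and have the same mean as the constant function $1$. Tangent vectors are $-\sum_if_i\,d\theta^i\wedge dx^{0i}$ with $f_i\in C_0^\infty(S^1)$ (smooth, zero mean). A prime denotes $\partial_{x_0}$, and $\int$ is integration for the flat volume form $dx^{0123}\wedge d\theta^{123}$, which reduces to integration over $S^1$. Let $A_i=u/u_i^2$ and, for $g\in C_0^\infty(S^1)$ with $G(x)=\int_0^xg$, let $Q_i(g)=G-\big[\int_{S^1}A_iG\big]\big[\int_{S^1}A_i\big]^{-1}$. The Dirichlet metric on $\widetilde{\mathcal M}_3$ is $\mathcal G(f,h)=\sum_i\int_{S^1}A_iQ_i(f_i)Q_i(h_i)$. The canonical geodesics are the geodesics of its Levi-Civita connection, given by $(u_i)_t=f_i$,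 $(f_i)_t=\tilde U_i'$ with $$\tilde U_i=u_i\sum_j\epsilon_{ij}\Big[a_jc_i+a_jc_j+\tfrac12c_j^2\sum_{k\ne i}b_k-c_j^2b_j\Big],\qquad\epsilon_{ij}=1\ (i=j),\quad\epsilon_{ij}=-1\ (i\ne j).$$
   Formalization: χ is taken twice continuously differentiable; non-concavity is claimed only for non-constant χ and non-semidefiniteness of Q only at values u with χ_u(u) ≠ 0, since for constant χ (or where χ_u = 0) one has r = s = 0 and Q = 0. *)

(* Defs.v *)
From Stdlib Require Export Reals.
From Coquelicot Require Export Coquelicot.
Open Scope R_scope.

(** The circle is R/Z: functions on it are 1-periodic functions on R, and the
    integral over it is the integral over [0,1]. *)

Definition smooth_on_circle (g : R -> R) : Prop :=
  (forall x, g (x + 1) = g x) /\ (forall n x, ex_derive_n g n x).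

Inductive idx : Type := i1 | i2 | i3.

Definition sum3 (F : idx -> R) : R := F i1 + F i2 + F i3.

Definition triple : Type := idx -> R -> R.

Definition prod3 (u : triple) (x : R) : R := u i1 x * u i2 x * u i3 x.

(** The triple [u] stands for the 3-form
      phi^K - sum_i (u_i - 1) dtheta^i /\ dx^{0i}
    on T^3 x T^4, with [u_i] a function of [x^0].  Such a form is closed, it is
    a G2-structure exactly when each [u_i] is positive, and it is cohomologous
    to phi^K exactly when each [u_i] has the same mean as 1. *)
Definition in_M3 (u : triple) : Prop :=
  forall i, smooth_on_circle (u i) /\ (forall x, 0 < u i x)
            /\ RInt (u i) 0 1 = 1.

(** [f] stands for the tangent vector - sum_i f_i dtheta^i /\ dx^{0i}. *)
Definition tangent_M3 (f : triple) : Prop :=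
  forall i, smooth_on_circle (f i) /\ RInt (f i) 0 1 = 0.

(** ** The Dirichlet metric *)

Definition weightA (u : triple) (i : idx) (x : R) : R := prod3 u x / (u i x) ^ 2.

Definition primitive (g : R -> R) (x : R) : R := RInt g 0 x.

Definition opQ (u : triple) (i : idx) (g : R -> R) (x : R) : R :=
  primitive g x
  - RInt (fun y => weightA u i y * primitive g y) 0 1 * / RInt (weightA u i) 0 1.

Definition dirichlet (u f h : triple) : R :=
  sum3 (fun i => RInt (fun x => weightA u i x * opQ u i (f i) x * opQ u i (h i) x) 0 1).

(** Derivative of G(f,h) at [u] in the direction [w], where [f] and [h] are
    extended as constant vector fields on the affine space containing M3. *)
Definition d_dirichlet (w u f h : triple) : R :=
  Derive (fun s => dirichlet (fun i x => u i x + s * w i x) f h) 0.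

(** G(nabla_f h, k) at [u] for the Levi-Civita connection and constant vector
    fields [f], [h], [k].  This is Koszul's formula; its bracket terms vanish
    because constant fields commute. *)
Definition levi_civita (u f h k : triple) : R :=
  (d_dirichlet f u h k + d_dirichlet h u f k - d_dirichlet k u f h) / 2.

(** ** Geodesics *)

Definition path : Type := R -> triple.

Definition in_interval (t1 t2 : Rbar) (t : R) : Prop := Rbar_lt t1 t /\ Rbar_lt t t2.

(** C^infinity in (t,x) jointly for [t] in the interval: [D m n] is the partial
    derivative of order [m] in [t] and [n] in [x]. *)
Definition smooth_on_cylinder (t1 t2 : Rbar) (v : R -> R -> R) : Prop :=
  exists D : nat -> nat -> R -> R -> R,
    (forall t x, in_interval t1 t2 t -> D 0%nat 0%nat t x = v t x) /\
    (forall m n t x, in_interval t1 t2 t ->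
       is_derive (fun s => D m n s x) t (D (S m) n t x) /\
       is_derive (fun y => D m n t y) x (D m (S n) t x) /\
       continuity_2d_pt (D m n) t x).

Definition velocity (u : path) (t : R) : triple :=
  fun i x => Derive (fun s => u s i x) t.

Definition acceleration (u : path) (t : R) : triple :=
  fun i x => Derive_n (fun s => u s i x) 2 t.

(** A smooth curve in M3 with nabla_{u_t} u_t = 0 for the Levi-Civita connection
    of the Dirichlet metric.  The metric is only weakly nondegenerate, so the
    equation is tested against every tangent vector [k]. *)
Definition canonical_geodesic (t1 t2 : Rbar) (u : path) : Prop :=
  (forall t, in_interval t1 t2 t -> in_M3 (u t)) /\
  (forall i, smooth_on_cylinder t1 t2 (fun t x => u t i x)) /\
  (forall t, in_interval t1 t2 t -> forall k, tangent_M3 k ->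
     dirichlet (u t) (acceleration u t) k
     + levi_civita (u t) (velocity u t) (velocity u t) k = 0).

(** ** Weighted volume functionals *)

(** The domain of a weight is (0,+oo): the values at other points are irrelevant. *)
Definition volume_weight (chi : R -> R) : Prop :=
  (forall v, 0 < v -> 0 <= chi v) /\
  (forall v w l, 0 < v -> 0 < w -> 0 <= l <= 1 ->
     l * chi v + (1 - l) * chi w <= chi (l * v + (1 - l) * w)) /\
  (forall v, 0 < v -> ex_derive chi v /\ ex_derive (Derive chi) v
                      /\ continuous (Derive_n chi 2) v).

(** If [chi] is constant then so is its volume functional, and Q = 0.  More
    precisely, a nonnegative concave [chi] is nondecreasing, and where
    [Derive chi v = 0] it is constant on [v,+oo) and Q vanishes identically. *)
Definition nonconstant_weight (chi : R -> R) : Prop :=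
  exists v w, 0 < v /\ 0 < w /\ chi v <> chi w.

Definition Vol (chi : R -> R) (u : triple) : R := RInt (fun x => chi (prod3 u x)) 0 1.

Definition weight_r (chi : R -> R) (v : R) : R := Derive_n chi 2 v.
Definition weight_s (chi : R -> R) (v : R) : R := Derive_n chi 2 v + Derive chi v * / v.

Definition concave_along_canonical_geodesics (chi : R -> R) : Prop :=
  forall (t1 t2 : Rbar) (u : path), canonical_geodesic t1 t2 u ->
  forall t t' l, in_interval t1 t2 t -> in_interval t1 t2 t' -> 0 <= l <= 1 ->
    l * Vol chi (u t) + (1 - l) * Vol chi (u t')
    <= Vol chi (u (l * t + (1 - l) * t')).

(** ** The quadratic form in the twelve variables a_i, b_ij *)

Inductive var : Type := va (i : idx) | vb (i j : idx).

Definition var_eq_dec (k l : var) : {k = l} + {k <> l}.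
Proof. repeat decide equality. Defined.

Definition sum_var (F : var -> R) : R :=
  sum3 (fun i => F (va i)) + sum3 (fun i => sum3 (fun j => F (vb i j))).

Definition formQ (r s : R) (z : var -> R) : R :=
  let a1 := z (va i1) in let a2 := z (va i2) in let a3 := z (va i3) in
  let b11 := z (vb i1 i1) in let b12 := z (vb i1 i2) in let b13 := z (vb i1 i3) in
  let b21 := z (vb i2 i1) in let b22 := z (vb i2 i2) in let b23 := z (vb i2 i3) in
  let b31 := z (vb i3 i1) in let b32 := z (vb i3 i2) in let b33 := z (vb i3 i3) in
  r * (a1 ^ 2 + a2 ^ 2 + a3 ^ 2) + 2 * s * (a1 * a2 + a2 * a3 + a1 * a3)
  + (r - s) * (b11 ^ 2 + b22 ^ 2 + b33 ^ 2)
  + a1 * (- 2 * (r - s) * b11 + s * b12 + s * b13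
          + (r - s) * b21 + r * b22 + s * b23
          + (r - s) * b31 + s * b32 + r * b33)
  + a2 * (r * b11 + (r - s) * b12 + s * b13
          + s * b21 - 2 * (r - s) * b22 + s * b23
          + s * b31 + (r - s) * b32 + r * b33)
  + a3 * (r * b11 + s * b12 + (r - s) * b13
          + s * b21 + r * b22 + (r - s) * b23
          + s * b31 + s * b32 - 2 * (r - s) * b33)
  + (r - s) * (- b11 * b21 - b12 * b22 + b13 * b23
               - b11 * b31 + b12 * b32 - b13 * b33
               + b21 * b31 - b22 * b32 - b23 * b33).

(** The variables a_i = f_i/u_i and b_ij = (u_i'/u_i) (Q_j(f_j)/u_j) at [x]. *)
Definition geodesic_vars (u f : triple) (x : R) (k : var) : R :=
  match k with
  | va i => f i x / u i x
  | vb i j => (Derive (u i) x / u i x) * (opQ u j (f j) x / u j x)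
  end.

(** Symmetric matrix of a quadratic form, by polarization. *)
Definition basis_vec (k l : var) : R := if var_eq_dec k l then 1 else 0.

Definition matrix_of (q : (var -> R) -> R) (k l : var) : R :=
  (q (fun m => basis_vec k m + basis_vec l m) - q (basis_vec k) - q (basis_vec l)) / 2.

Definition negative_semidefinite (M : var -> var -> R) : Prop :=
  forall z : var -> R,
    sum_var (fun k => sum_var (fun l => z k * M k l * z l)) <= 0.

(* Main.v *)
(** Write u_i = X_i' for circle diffeomorphisms X_i.  The metric is
    [int u (c_1^2 + c_2^2 + c_3^2)] with c_i = (X_i)_t / u_i, and the geodesic
    equation is the momentum balance
    (A_i Q_i(f_i))_t + ((u / u_i) (|c|^2 / 2 - c_i^2))_x = 0.
    Testing against all tangent vectors gives this equation pointwise up to a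
    multiple of A_i, and integrating the term [chi_u (u / u_i) (f_i)_t] of
    the second derivative of the volume by parts gives Q.

    Non-concavity needs actual geodesics.  In the variables ln u_i and c_i the
    equation is a first-order system with polynomial coefficients, so it can be
    solved by power series in t whose coefficients are trigonometric polynomials
    in x.  Take u_2 = 1 and u_1 u_3 constant, c_1 = c_3 = 0, c_2 = cos (2 pi x)
    and ln u_1 = A cos (2 pi n x) + constant.  Then u is a constant, which is
    small for large A, so that chi_u > 0 there; and
    Q = r c_2'^2 + (s - r) (u_1'/u_1)^2 c_2^2 has positive integral
    for large n because s - r = chi_u / u > 0. *)
From Stdlib Require Import Lra Lia ZArith FunctionalExtensionality List.
Require Import Defs.
Import ListNotations.

(** * Smooth and periodic functions *)

(** The obstacle to the power series is the loss of one x-derivative per order in t. Trigonometric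
    polynomials make this loss quantitative: differentiation costs a factor of the degree, the
    degree of the coefficient of t^k grows linearly in k, and the recursion divides by k + 1. The
    cubic system does not involve [opQ]. It provides u_i c_i as some antiderivative of the velocity,
    which equals Q_i(f_i) only if (u / u_i) c_i has integral 0. Both u_i and (u / u_i) c_i satisfy
    conservation laws on the circle, so the normalised mean and this integral condition have to be
    imposed on the initial data only. Keeping u constant at time 0 means that chi enters through its
    first two derivatives at a single point. That point does not depend on the frequency n, so r and
    s stay fixed while n grows. Concavity is then refuted by the second derivative at time 0
    alone. *)

Definition periodic (g : R -> R) : Prop := forall x, g (x + 1) = g x.
Definition smooth (g : R -> R) : Prop := forall n x, ex_derive_n g n x.
Definition cts (g : R -> R) : Prop := forall x, continuous g x.

(** The order is peeled off one derivative at a time, so that products and inverses follow by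
    induction without a Leibniz formula for [Derive_n]. *)
Fixpoint Ck (n : nat) (g : R -> R) : Prop :=
  match n with
  | O => True
  | S n => exists g', (forall x, is_derive g x (g' x)) /\ Ck n g'
  end.

Lemma smooth_Ck g : smooth g <-> forall n, Ck n g.
Proof.
  split.
  - intros Hg n.
    assert (H : forall n m, Ck n (Derive_n g m)).
    { clear n. induction n as [|n IH]; intros m; [exact I|].
      exists (Derive_n g (S m)). split; [|apply IH].
      intros x. apply Derive_correct. apply (Hg (S m)). }
    exact (H n 0%nat).
  - intros Hg.
    assert (HD : forall m n, Ck n (Derive_n g m)).
    { induction m as [|m IH]; intros n; [apply Hg|].
      destruct (IH (S n)) as [g' [H1 H2]].
      replace (Derive_n g (S m)) with g'; [exact H2|].
      apply functional_extensionality. intros x. symmetry.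
      apply is_derive_unique, H1. }
    intros [|n] x; [exact I|].
    destruct (HD n 1%nat) as [g' [H1 _]]. exists (g' x). apply H1.
Qed.

Lemma Ck_mono n : forall g, Ck (S n) g -> Ck n g.
Proof.
  induction n as [|n IH]; intros g; [exact (fun _ => I)|].
  intros [g' [H1 H2]]. exists g'. split; [exact H1|]. now apply IH.
Qed.

Lemma Ck_plus n : forall f g, Ck n f -> Ck n g -> Ck n (fun x => f x + g x).
Proof.
  induction n as [|n IH]; intros f g; [easy|].
  intros [f' [Hf1 Hf2]] [g' [Hg1 Hg2]].
  exists (fun x => f' x + g' x). split; [|now apply IH].
  intros x. now apply (is_derive_plus f g).
Qed.

Lemma Ck_mult n : forall f g, Ck n f -> Ck n g -> Ck n (fun x => f x * g x).
Proof.
  induction n as [|n IH]; intros f g; [easy|].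
  intros Hf Hg. pose proof (Ck_mono _ _ Hf). pose proof (Ck_mono _ _ Hg).
  destruct Hf as [f' [Hf1 Hf2]]. destruct Hg as [g' [Hg1 Hg2]].
  exists (fun x => f' x * g x + f x * g' x). split.
  - intros x. apply (is_derive_mult f g); [easy|easy|exact Rmult_comm].
  - apply Ck_plus; now apply IH.
Qed.

Lemma Ck_const n c : Ck n (fun _ => c).
Proof.
  revert c. induction n as [|n IH]; intros c; [exact I|].
  exists (fun _ => 0). split; [|apply IH]. intros x. apply @is_derive_const.
Qed.

Lemma Ck_inv n : forall g, (forall x, g x <> 0) -> Ck n g -> Ck n (fun x => / g x).
Proof.
  induction n as [|n IH]; intros g H0 Hg; [easy|].
  pose proof (Ck_mono _ _ Hg) as Hg'. destruct Hg as [g' [H1 H2]].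
  exists (fun x => - 1 * g' x * (/ g x * / g x)). split.
  - intros x. replace (-1 * g' x * (/ g x * / g x)) with (- g' x / g x ^ 2)
      by (field; apply H0).
    now apply is_derive_inv.
  - apply Ck_mult; [apply Ck_mult; [apply Ck_const|easy]|].
    apply Ck_mult; apply IH; easy.
Qed.

Lemma smooth_plus f g : smooth f -> smooth g -> smooth (fun x => f x + g x).
Proof. rewrite !smooth_Ck. intros Hf Hg n. now apply Ck_plus. Qed.

Lemma smooth_mult f g : smooth f -> smooth g -> smooth (fun x => f x * g x).
Proof. rewrite !smooth_Ck. intros Hf Hg n. now apply Ck_mult. Qed.

Lemma smooth_const c : smooth (fun _ => c).
Proof. rewrite smooth_Ck. intros n. apply Ck_const. Qed.

Lemma smooth_opp f : smooth f -> smooth (fun x => - f x).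
Proof.
  intros Hf. replace (fun x => - f x) with (fun x => -1 * f x)
    by (apply functional_extensionality; intros; ring).
  apply smooth_mult; [apply smooth_const|easy].
Qed.

Lemma smooth_minus f g : smooth f -> smooth g -> smooth (fun x => f x - g x).
Proof. intros Hf Hg. apply smooth_plus; [easy|now apply smooth_opp]. Qed.

Lemma smooth_inv g : (forall x, 0 < g x) -> smooth g -> smooth (fun x => / g x).
Proof.
  rewrite !smooth_Ck. intros H0 Hg n. apply Ck_inv; [|easy].
  intros x. specialize (H0 x). lra.
Qed.

Lemma smooth_div f g :
  (forall x, 0 < g x) -> smooth f -> smooth g -> smooth (fun x => f x / g x).
Proof. intros H0 Hf Hg. apply smooth_mult; [easy|now apply smooth_inv]. Qed.

Lemma smooth_pow f n : smooth f -> smooth (fun x => f x ^ n).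
Proof.
  intros Hf. induction n as [|n IH]; [exact (smooth_const 1)|exact (smooth_mult _ _ Hf IH)].
Qed.

Lemma smooth_Derive f : smooth f -> smooth (Derive f).
Proof.
  rewrite !smooth_Ck. intros Hf n. destruct (Hf (S n)) as [f' [H1 H2]].
  replace (Derive f) with f'; [exact H2|].
  apply functional_extensionality. intros x. symmetry. now apply is_derive_unique.
Qed.

Lemma smooth_is_derive f x : smooth f -> is_derive f x (Derive f x).
Proof. intros Hf. apply Derive_correct. exact (Hf 1%nat x). Qed.

Lemma smooth_cts f : smooth f -> cts f.
Proof. intros Hf x. apply @ex_derive_continuous. exact (Hf 1%nat x). Qed.

Lemma smooth_intro f f' : (forall x, is_derive f x (f' x)) -> smooth f' -> smooth f.
Proof.
  rewrite !smooth_Ck. intros H1 H2 [|n]; [exact I|]. exists f'. split; [exact H1|apply H2].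
Qed.

Lemma cts_plus f g : cts f -> cts g -> cts (fun x => f x + g x).
Proof. intros Hf Hg x. now apply @continuous_plus. Qed.

Lemma cts_mult f g : cts f -> cts g -> cts (fun x => f x * g x).
Proof. intros Hf Hg x. now apply @continuous_mult. Qed.

Lemma cts_const c : cts (fun _ => c).
Proof. intros x. apply continuous_const. Qed.

Lemma cts_opp f : cts f -> cts (fun x => - f x).
Proof. intros Hf x. now apply @continuous_opp. Qed.

Lemma cts_minus f g : cts f -> cts g -> cts (fun x => f x - g x).
Proof. intros Hf Hg. apply cts_plus; [easy|now apply cts_opp]. Qed.

Lemma cts_inv g : (forall x, 0 < g x) -> cts g -> cts (fun x => / g x).
Proof.
  intros H0 Hg x. apply continuous_comp; [apply Hg|].
  apply continuity_pt_filterlim, continuity_pt_inv; [|specialize (H0 x); lra].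
  apply continuity_pt_id.
Qed.

Lemma cts_div f g : (forall x, 0 < g x) -> cts f -> cts g -> cts (fun x => f x / g x).
Proof. intros H0 Hf Hg. apply cts_mult; [easy|now apply cts_inv]. Qed.

Lemma cts_pow f n : cts f -> cts (fun x => f x ^ n).
Proof. intros Hf. induction n as [|n IH]; [exact (cts_const 1)|exact (cts_mult _ _ Hf IH)]. Qed.

Lemma cts_ex_RInt (f : R -> R) a b : cts f -> ex_RInt f a b.
Proof. intros Hf. apply @ex_RInt_continuous. intros x _. apply Hf. Qed.

Lemma int_plus (f g : R -> R) a b : cts f -> cts g ->
  RInt (fun x => f x + g x) a b = RInt f a b + RInt g a b.
Proof. intros Hf Hg. apply (RInt_plus f g); now apply cts_ex_RInt. Qed.

Lemma int_scal (f : R -> R) c a b : cts f -> RInt (fun x => c * f x) a b = c * RInt f a b.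
Proof. intros Hf. apply (RInt_scal f); now apply cts_ex_RInt. Qed.

Lemma int_opp (f : R -> R) a b : cts f -> RInt (fun x => - f x) a b = - RInt f a b.
Proof. intros Hf. apply (RInt_opp f); now apply cts_ex_RInt. Qed.

Lemma int_minus (f g : R -> R) a b : cts f -> cts g ->
  RInt (fun x => f x - g x) a b = RInt f a b - RInt g a b.
Proof. intros Hf Hg. apply (RInt_minus f g); now apply cts_ex_RInt. Qed.

Lemma int_const (c : R) : RInt (fun _ => c) 0 1 = c.
Proof. rewrite RInt_const. change ((1 - 0) * c = c). ring. Qed.

Lemma int_ext01 (f g : R -> R) :
  (forall x, 0 < x < 1 -> f x = g x) -> RInt f 0 1 = RInt g 0 1.
Proof.
  intros H. apply RInt_ext. intros x. rewrite Rmin_left, Rmax_right by lra. apply H.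
Qed.

Lemma int_pos (f : R -> R) : cts f -> (forall x, 0 < f x) -> 0 < RInt f 0 1.
Proof.
  intros Hf H. apply RInt_gt_0; [lra|intros; apply H|intros; apply Hf].
Qed.

Lemma int_Derive (f f' : R -> R) a b :
  (forall x, is_derive f x (f' x)) -> cts f' -> RInt f' a b = f b - f a.
Proof.
  intros H H'. apply is_RInt_unique.
  apply (is_RInt_derive f f'); intros; [apply H|apply H'].
Qed.

Lemma primitive_derive g x : cts g -> is_derive (primitive g) x (g x).
Proof.
  intros Hg. unfold primitive.
  apply (is_derive_RInt g (fun y => RInt g 0 y) 0); [|apply Hg].
  apply filter_forall. intros y. apply (@RInt_correct R_CompleteNormedModule).
  now apply cts_ex_RInt.
Qed.

Lemma smooth_primitive g : smooth g -> smooth (primitive g).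
Proof.
  intros Hg. apply smooth_intro with g; [|easy].
  intros x. apply primitive_derive. now apply smooth_cts.
Qed.

Lemma primitive_Derive f f' x :
  (forall x, is_derive f x (f' x)) -> cts f' -> primitive f' x = f x - f 0.
Proof. apply int_Derive. Qed.

Lemma is_derive_shift (g : R -> R) x l : is_derive g (x + 1) l -> is_derive (fun y => g (y + 1)) x l.
Proof.
  intros H. replace l with (1 * l) by ring.
  apply (is_derive_comp g (fun y => y + 1)); [exact H|].
  auto_derive; [easy|ring].
Qed.

Lemma periodic_derive g g' :
  (forall x, is_derive g x (g' x)) -> periodic g -> periodic g'.
Proof.
  intros H Hg x. rewrite <- (is_derive_unique _ _ _ (H x)). symmetry.
  apply is_derive_unique.
  apply (is_derive_ext (fun y => g (y + 1))); [apply Hg|].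
  apply is_derive_shift, H.
Qed.

Lemma periodic_primitive (g : R -> R) :
  cts g -> periodic g -> RInt g 0 1 = 0 -> periodic (primitive g).
Proof.
  intros Hg Hp H0 x. unfold primitive.
  rewrite <- (RInt_Chasles g 0 1 (x + 1)) by now apply cts_ex_RInt.
  rewrite H0. change (0 + RInt g 1 (x + 1) = RInt g 0 x). rewrite Rplus_0_l.
  pose proof (RInt_comp_lin g 1 1 0 x) as H.
  replace (1 * 0 + 1) with 1 in H by ring.
  replace (1 * x + 1) with (x + 1) in H by ring.
  rewrite <- H by now apply cts_ex_RInt.
  apply RInt_ext. intros y _. change (1 * g (1 * y + 1) = g y).
  rewrite !Rmult_1_l. apply Hp.
Qed.

Lemma int_by_parts (f g f' g' : R -> R) :
  (forall x, is_derive f x (f' x)) -> (forall x, is_derive g x (g' x)) ->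
  cts f' -> cts g' -> periodic f -> periodic g ->
  RInt (fun x => f x * g' x) 0 1 = - RInt (fun x => f' x * g x) 0 1.
Proof.
  intros Hf Hg Hf' Hg' Pf Pg.
  assert (Cf : cts f) by (intros x; apply @ex_derive_continuous; eexists; apply Hf).
  assert (Cg : cts g) by (intros x; apply @ex_derive_continuous; eexists; apply Hg).
  assert (H : RInt (fun x => f' x * g x + f x * g' x) 0 1 = f 1 * g 1 - f 0 * g 0).
  { apply (int_Derive (fun x => f x * g x)).
    - intros x. apply (is_derive_mult f g); [easy|easy|exact Rmult_comm].
    - apply cts_plus; now apply cts_mult. }
  rewrite int_plus in H by now apply cts_mult.
  pose proof (Pf 0) as F0. pose proof (Pg 0) as G0. rewrite Rplus_0_l in F0, G0.
  rewrite F0, G0 in H. lra.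
Qed.

(** The antiderivative of d^2 is squeezed between 0 and its value at 1, so it vanishes on [0,1], and
    differentiating it recovers d^2. Only interior points have a neighbourhood on which it is known
    to vanish. *)
Lemma int_sqr_eq_0 (d : R -> R) :
  cts d -> RInt (fun x => d x * d x) 0 1 = 0 -> forall x, 0 < x < 1 -> d x = 0.
Proof.
  intros Hd H x Hx.
  assert (C : cts (fun x => d x * d x)) by now apply cts_mult.
  assert (HP : forall y, 0 <= y <= 1 -> primitive (fun x => d x * d x) y = 0).
  { intros y Hy. unfold primitive.
    rewrite <- (RInt_Chasles _ 0 y 1) in H by now apply cts_ex_RInt.
    change (RInt (fun x => d x * d x) 0 y + RInt (fun x => d x * d x) y 1 = 0) in H.
    assert (0 <= RInt (fun x => d x * d x) 0 y)
      by (apply RInt_ge_0; [lra|now apply cts_ex_RInt|intros; nra]).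
    assert (0 <= RInt (fun x => d x * d x) y 1)
      by (apply RInt_ge_0; [lra|now apply cts_ex_RInt|intros; nra]).
    lra. }
  assert (H1 : d x * d x = 0).
  { rewrite <- (is_derive_unique _ _ _ (primitive_derive _ x C)).
    rewrite (Derive_ext_loc _ (fun _ => 0)); [apply Derive_const|].
    assert (He : 0 < Rmin x (1 - x)) by (apply Rmin_pos; lra).
    exists (mkposreal _ He). intros y Hy. apply HP.
    change (Rabs (y - x) < Rmin x (1 - x)) in Hy.
    pose proof (Rmin_l x (1 - x)). pose proof (Rmin_r x (1 - x)).
    apply Rabs_def2 in Hy. lra. }
  nra.
Qed.

Ltac smooth_rules := repeat match goal with
  | |- smooth (fun _ => ?c) => apply (smooth_const c)
  | |- smooth (fun x => @?f x + @?g x) => apply (smooth_plus f g)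
  | |- smooth (fun x => @?f x - @?g x) => apply (smooth_minus f g)
  | |- smooth (fun x => @?f x * @?g x) => apply (smooth_mult f g)
  | |- smooth (fun x => @?f x / @?g x) => apply (smooth_div f g)
  | |- smooth (fun x => @?f x ^ ?n) => apply (smooth_pow f n)
  | |- smooth (fun x => - @?f x) => apply (smooth_opp f)
  end.

Ltac cts_rules := repeat match goal with
  | |- cts (fun _ => ?c) => apply (cts_const c)
  | |- cts (fun x => @?f x + @?g x) => apply (cts_plus f g)
  | |- cts (fun x => @?f x - @?g x) => apply (cts_minus f g)
  | |- cts (fun x => @?f x * @?g x) => apply (cts_mult f g)
  | |- cts (fun x => @?f x / @?g x) => apply (cts_div f g)
  | |- cts (fun x => @?f x ^ ?n) => apply (cts_pow f n)
  | |- cts (fun x => - @?f x) => apply (cts_opp f)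
  end.

(* The carrier of equations produced by [RInt] lemmas is a canonical structure
   projection that [ring] and [field] do not recognise as [R]. *)
Ltac real_eq := match goal with |- @eq _ ?a ?b => change (@eq R a b) end.

Lemma cts_continuous g x : cts g -> continuous g x.
Proof. intros H. apply H. Qed.

Lemma continuous_cts g : (forall x, continuous g x) -> cts g.
Proof. easy. Qed.

Lemma cts_of_derive g g' : (forall x, is_derive g x (g' x)) -> cts g.
Proof. intros H x. apply @ex_derive_continuous. eexists. apply H. Qed.

Lemma smooth_ex_derive_n g : smooth g -> forall n x, ex_derive_n g n x.
Proof. easy. Qed.

Lemma ex_derive_n_smooth g : (forall n x, ex_derive_n g n x) -> smooth g.
Proof. easy. Qed.

Lemma cts_primitive g : cts g -> cts (primitive g).
Proof. intros Hg. apply cts_of_derive with g. intros x. now apply primitive_derive. Qed.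

Opaque smooth cts.

Lemma periodic_INR g n x : periodic g -> g (x + INR n) = g x.
Proof.
  intros Hg. induction n as [|n IH]; [simpl; now rewrite Rplus_0_r|].
  rewrite S_INR, <- Rplus_assoc. now rewrite Hg.
Qed.

(** The representative does not depend on the function, so bounds on the compact interval [0,1]
    transfer to the whole line. *)
Lemma periodic_representative x :
  exists y, 0 <= y <= 1 /\ forall g, periodic g -> g x = g y.
Proof.
  destruct (base_Int_part x) as [H1 H2].
  exists (x - IZR (Int_part x)). split; [lra|]. intros g Hg.
  destruct (Z_le_gt_dec 0 (Int_part x)) as [H|H].
  - rewrite <- (Z2Nat.id _ H) at 1. rewrite <- INR_IZR_INZ.
    rewrite <- (periodic_INR g (Z.to_nat (Int_part x)) (x - _)) by easy.
    f_equal. ring.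
  - replace (x - IZR (Int_part x)) with (x + INR (Z.to_nat (- Int_part x))).
    + now rewrite periodic_INR.
    + rewrite INR_IZR_INZ, Z2Nat.id by lia. rewrite opp_IZR. ring.
Qed.

Lemma periodic_bounded g :
  cts g -> periodic g -> exists B, 0 < B /\ forall x, Rabs (g x) <= B.
Proof.
  intros Hg Pg.
  assert (C : forall x, 0 <= x <= 1 -> continuity_pt (fun x => Rabs (g x)) x).
  { intros x _. apply continuity_pt_filterlim.
    apply (continuous_comp g Rabs); [now apply cts_continuous|apply continuous_Rabs]. }
  destruct (continuity_ab_maj (fun x => Rabs (g x)) 0 1) as [m [Hm _]]; [lra|exact C|].
  exists (Rabs (g m) + 1). split; [pose proof (Rabs_pos (g m)); lra|].
  intros x. destruct (periodic_representative x) as [y [Hy Hxy]].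
  rewrite (Hxy g Pg). specialize (Hm y Hy). lra.
Qed.

(** By compactness |w / u| has a bound B, and |s| < 1 / B makes the factor 1 + s w / u positive at
    all points simultaneously. *)
Lemma periodic_line_pos u w :
  cts u -> cts w -> periodic u -> periodic w -> (forall x, 0 < u x) ->
  exists d : posreal, forall s, Rabs s < d -> forall x, 0 < u x + s * w x.
Proof.
  intros Cu Cw Pu Pw Hu.
  destruct (periodic_bounded (fun x => w x / u x)) as [B [HB H]].
  - now apply cts_div.
  - intros x. now rewrite Pu, Pw.
  - assert (Hd : 0 < / B) by now apply Rinv_0_lt_compat.
    exists (mkposreal _ Hd). simpl. intros s Hs x.
    replace (u x + s * w x) with (u x * (1 + s * (w x / u x)))
      by (field; specialize (Hu x); lra).
    apply Rmult_lt_0_compat; [apply Hu|].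
    assert (Rabs (s * (w x / u x)) < 1).
    { rewrite Rabs_mult. specialize (H x).
      apply Rle_lt_trans with (Rabs s * B).
      - apply Rmult_le_compat_l; [apply Rabs_pos|exact H].
      - apply Rlt_le_trans with (/ B * B); [|right; field; lra].
        now apply Rmult_lt_compat_r. }
    apply Rabs_def2 in H0. lra.
Qed.

Lemma derive_RInt_param (F dF : R -> R -> R) s0 :
  locally s0 (fun s => forall x, is_derive (fun z => F z x) s (dF s x)) ->
  (forall x, continuity_2d_pt dF s0 x) ->
  locally s0 (fun s => cts (F s)) ->
  is_derive (fun s => RInt (F s) 0 1) s0 (RInt (dF s0) 0 1).
Proof.
  intros HD HC HI.
  rewrite (RInt_ext (dF s0) (fun x => Derive (fun z => F z x) s0)).
  2:{ intros x _. symmetry. apply is_derive_unique, (locally_singleton _ _ HD). }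
  apply (is_derive_RInt_param F).
  - revert HD. apply filter_imp. intros s H x _. eexists. apply H.
  - intros x _. apply (continuity_2d_pt_ext_loc dF); [|apply HC].
    destruct HD as [d Hd]. exists d. intros u v Hu _. symmetry.
    apply is_derive_unique. apply Hd. exact Hu.
  - revert HI. apply filter_imp. intros s H. now apply cts_ex_RInt.
Qed.

Lemma cts_continuity_2d g t x : cts g -> continuity_2d_pt (fun _ y => g y) t x.
Proof.
  intros Hg. apply (continuity_1d_2d_pt_comp g (fun _ y => y)).
  - now apply continuity_pt_filterlim, cts_continuous.
  - apply continuity_2d_pt_id2.
Qed.

(** * The Dirichlet metric *)

Definition pos (u : triple) : Prop := forall i x, 0 < u i x.
Definition smooth3 (f : triple) : Prop := forall i, smooth_on_circle (f i).

Lemma smooth3_smooth f i : smooth3 f -> smooth (f i).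
Proof. intros H. exact (ex_derive_n_smooth _ (proj2 (H i))). Qed.

Lemma prod3_pos u x : pos u -> 0 < prod3 u x.
Proof.
  intros H. unfold prod3. repeat apply Rmult_lt_0_compat; apply H.
Qed.

Lemma weightA_pos u i x : pos u -> 0 < weightA u i x.
Proof.
  intros H. apply Rdiv_lt_0_compat; [now apply prod3_pos|apply pow_lt, H].
Qed.

(** Derivative of A_i = u / u_i^2 in the direction w, obtained by logarithmic differentiation. *)
Definition variationA (u w : triple) (i : idx) (x : R) : R :=
  weightA u i x * (sum3 (fun l => w l x / u l x) - 2 * (w i x / u i x)).

Definition line (u w : triple) (s : R) : triple := fun i x => u i x + s * w i x.

Lemma line_0 u w : line u w 0 = u.
Proof.
  apply functional_extensionality. intros i. apply functional_extensionality.
  intros x. unfold line. ring.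
Qed.

Lemma line_pos u w : smooth3 u -> smooth3 w -> pos u ->
  locally 0 (fun s => pos (line u w s)).
Proof.
  intros Su Sw Hu.
  assert (H : forall i, exists d : posreal,
             forall s, Rabs s < d -> forall x, 0 < u i x + s * w i x).
  { intros i. apply periodic_line_pos;
      [now apply smooth_cts, smooth3_smooth|now apply smooth_cts, smooth3_smooth
      |exact (proj1 (Su i))|exact (proj1 (Sw i))|apply Hu]. }
  destruct (H i1) as [d1 H1]. destruct (H i2) as [d2 H2]. destruct (H i3) as [d3 H3].
  assert (Hd : 0 < Rmin d1 (Rmin d2 d3))
    by (repeat apply Rmin_pos; apply cond_pos).
  exists (mkposreal _ Hd). intros s Hs.
  change (Rabs (s - 0) < Rmin d1 (Rmin d2 d3)) in Hs. rewrite Rminus_0_r in Hs.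
  pose proof (Rmin_l d1 (Rmin d2 d3)). pose proof (Rmin_r d1 (Rmin d2 d3)).
  pose proof (Rmin_l d2 d3). pose proof (Rmin_r d2 d3).
  intros [ | | ] x; [apply H1|apply H2|apply H3]; lra.
Qed.

Lemma weightA_line_derive u w i x s : pos (line u w s) ->
  is_derive (fun z => weightA (line u w z) i x) s (variationA (line u w s) w i x).
Proof.
  intros H. pose proof (H i1 x) as H1. pose proof (H i2 x) as H2.
  pose proof (H i3 x) as H3. unfold line in H1, H2, H3.
  unfold variationA, weightA, prod3, sum3, line.
  destruct i; auto_derive; [apply Rgt_not_eq; nra|field; lra|
    apply Rgt_not_eq; nra|field; lra|apply Rgt_not_eq; nra|field; lra].
Qed.

Lemma variationA_line_continuity u w i x : smooth3 u -> smooth3 w -> pos u ->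
  continuity_2d_pt (fun s x => variationA (line u w s) w i x) 0 x.
Proof.
  intros Su Sw Hu.
  assert (Cu : forall l, cts (u l)) by (intros l; now apply smooth_cts, smooth3_smooth).
  assert (Cw : forall l, cts (w l)) by (intros l; now apply smooth_cts, smooth3_smooth).
  assert (Cl : forall l, continuity_2d_pt (fun s x => line u w s l x) 0 x).
  { intros l. unfold line. apply continuity_2d_pt_plus; [now apply cts_continuity_2d|].
    apply continuity_2d_pt_mult; [apply continuity_2d_pt_id1|now apply cts_continuity_2d]. }
  assert (Ci : forall l, continuity_2d_pt (fun s x => / line u w s l x) 0 x).
  { intros l. apply continuity_2d_pt_inv; [easy|].
    rewrite line_0. specialize (Hu l x). lra. }
  assert (Cq : forall l, continuity_2d_pt (fun s x => w l x / line u w s l x) 0 x).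
  { intros l. apply continuity_2d_pt_mult; [now apply cts_continuity_2d|easy]. }
  unfold variationA, sum3. apply continuity_2d_pt_mult.
  - unfold weightA, prod3.
    apply (continuity_2d_pt_ext (fun s x => line u w s i1 x * line u w s i2 x * line u w s i3 x
              * (/ line u w s i x * / line u w s i x))).
    { intros s y. unfold Rdiv. simpl. rewrite Rmult_1_r. now rewrite Rinv_mult. }
    repeat apply continuity_2d_pt_mult; easy.
  - apply continuity_2d_pt_minus.
    + repeat apply continuity_2d_pt_plus; easy.
    + apply continuity_2d_pt_mult; [apply continuity_2d_pt_const|easy].
Qed.

Lemma smooth_prod3 u : smooth3 u -> smooth (prod3 u).
Proof. intros H. unfold prod3. smooth_rules; now apply smooth3_smooth. Qed.

Lemma smooth_weightA u i : smooth3 u -> pos u -> smooth (weightA u i).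
Proof.
  intros H Hu. unfold weightA. apply smooth_div.
  - intros x. apply pow_lt, Hu.
  - now apply smooth_prod3.
  - now apply smooth_pow, smooth3_smooth.
Qed.

Lemma smooth_ratio u w i : smooth3 u -> smooth3 w -> pos u -> smooth (fun x => w i x / u i x).
Proof. intros Su Sw Hu. apply smooth_div; [apply Hu|now apply smooth3_smooth|now apply smooth3_smooth]. Qed.

Lemma smooth_variationA u w i : smooth3 u -> smooth3 w -> pos u -> smooth (variationA u w i).
Proof.
  intros Su Sw Hu. unfold variationA, sum3. apply smooth_mult; [now apply smooth_weightA|].
  apply smooth_minus.
  - smooth_rules; try apply Hu; now apply smooth3_smooth.
  - apply smooth_mult; [apply smooth_const|now apply smooth_ratio].
Qed.

Lemma smooth_opQ u i g : smooth g -> smooth (opQ u i g).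
Proof.
  intros Hg. unfold opQ. apply smooth_minus; [now apply smooth_primitive|apply smooth_const].
Qed.

Lemma opQ_derive u i g x : smooth g -> is_derive (opQ u i g) x (g x).
Proof.
  intros Hg. replace (g x) with (g x - 0) by ring. unfold opQ.
  apply (is_derive_minus (primitive g) (fun _ => _)); [|apply @is_derive_const].
  now apply primitive_derive, smooth_cts.
Qed.

Lemma int_weighted_product (a F H : R -> R) al be : cts a -> cts F -> cts H ->
  RInt (fun x => a x * (F x - al) * (H x - be)) 0 1
  = RInt (fun x => a x * (F x * H x)) 0 1 - be * RInt (fun x => a x * F x) 0 1
    - al * RInt (fun x => a x * H x) 0 1 + al * be * RInt (fun x => a x * 1) 0 1.
Proof.
  intros Ca CF CH.
  assert (C1 : cts (fun x => a x * (F x * H x))) by now cts_rules.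
  assert (C2 : cts (fun x => a x * F x)) by now apply cts_mult.
  assert (C3 : cts (fun x => a x * H x)) by now apply cts_mult.
  assert (C4 : cts (fun x => a x * 1)) by (apply cts_mult; [easy|apply cts_const]).
  rewrite <- !int_scal, <- !int_minus, <- int_plus;
    try (now cts_rules).
  apply RInt_ext. intros x _. simpl. ring.
Qed.

(** The antiderivatives of f and h do not depend on u, so all dependence on the base point sits in
    the weights. The weight a is left free because the formula is applied both to A_i and to its
    variation. *)
Lemma int_opQ_product (a : R -> R) u i f h : cts a -> cts f -> cts h ->
  RInt (fun x => a x * opQ u i f x * opQ u i h x) 0 1
  = RInt (fun x => a x * (primitive f x * primitive h x)) 0 1
    - RInt (fun y => weightA u i y * primitive h y) 0 1 * / RInt (weightA u i) 0 1
      * RInt (fun x => a x * primitive f x) 0 1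
    - RInt (fun y => weightA u i y * primitive f y) 0 1 * / RInt (weightA u i) 0 1
      * RInt (fun x => a x * primitive h x) 0 1
    + RInt (fun y => weightA u i y * primitive f y) 0 1 * / RInt (weightA u i) 0 1
      * (RInt (fun y => weightA u i y * primitive h y) 0 1 * / RInt (weightA u i) 0 1)
      * RInt (fun x => a x * 1) 0 1.
Proof.
  intros Ca Cf Ch. unfold opQ. apply int_weighted_product; now try apply cts_primitive.
Qed.

Lemma int_weightA_pos u i : smooth3 u -> pos u -> 0 < RInt (weightA u i) 0 1.
Proof.
  intros Su Hu. apply int_pos; [now apply smooth_cts, smooth_weightA|].
  intros x. now apply weightA_pos.
Qed.

Lemma smooth3_line u w s : smooth3 u -> smooth3 w -> smooth3 (line u w s).
Proof.
  intros Su Sw i. split.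
  - intros x. unfold line. now rewrite (proj1 (Su i)), (proj1 (Sw i)).
  - apply smooth_ex_derive_n. unfold line. smooth_rules; now apply smooth3_smooth.
Qed.

(** Only the weight gets differentiated: varying u changes Q_i(f_i) by a constant, and constants are
    A_i-orthogonal to Q_i(h_i). *)
Lemma dirichlet_line_derive u w f h i : smooth3 u -> smooth3 w -> pos u ->
  smooth3 f -> smooth3 h ->
  is_derive (fun s => RInt (fun x => weightA (line u w s) i x * opQ (line u w s) i (f i) x
                                     * opQ (line u w s) i (h i) x) 0 1) 0
            (RInt (fun x => variationA u w i x * opQ u i (f i) x * opQ u i (h i) x) 0 1).
Proof.
  intros Su Sw Hu Sf Sh.
  assert (Cf : cts (f i)) by now apply smooth_cts, smooth3_smooth.
  assert (Ch : cts (h i)) by now apply smooth_cts, smooth3_smooth.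
  assert (CF : cts (primitive (f i))) by now apply smooth_cts, smooth_primitive, smooth3_smooth.
  assert (CH : cts (primitive (h i))) by now apply smooth_cts, smooth_primitive, smooth3_smooth.
  assert (J : forall phi, cts phi ->
     is_derive (fun s => RInt (fun x => weightA (line u w s) i x * phi x) 0 1) 0
               (RInt (fun x => variationA u w i x * phi x) 0 1)).
  { intros phi Cp.
    replace (RInt (fun x => variationA u w i x * phi x) 0 1)
      with (RInt (fun x => variationA (line u w 0) w i x * phi x) 0 1) by now rewrite line_0.
    apply (derive_RInt_param (fun s x => weightA (line u w s) i x * phi x)
                             (fun s x => variationA (line u w s) w i x * phi x)).
    - generalize (line_pos u w Su Sw Hu). apply filter_imp. intros s Hs x.
      replace (variationA (line u w s) w i x * phi x)
        with (variationA (line u w s) w i x * phi x + weightA (line u w s) i x * 0) by ring.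
      apply (is_derive_mult (fun z => weightA (line u w z) i x) (fun _ => phi x));
        [now apply weightA_line_derive|apply @is_derive_const|exact Rmult_comm].
    - intros x. apply continuity_2d_pt_mult; [now apply variationA_line_continuity|].
      now apply cts_continuity_2d.
    - generalize (line_pos u w Su Sw Hu). apply filter_imp. intros s Hs.
      apply cts_mult; [|easy]. apply smooth_cts, smooth_weightA; [|easy].
      now apply smooth3_line. }
  pose proof (J _ (cts_mult _ _ CF CH)) as JFH. pose proof (J _ CF) as JF.
  pose proof (J _ CH) as JH. pose proof (J _ (cts_const 1)) as J1.
  assert (E1 : forall v, RInt (weightA v i) 0 1 = RInt (fun x => weightA v i x * 1) 0 1).
  { intros v. apply RInt_ext. intros x _. simpl. ring. }
  assert (P1 : RInt (fun x => weightA (line u w 0) i x * 1) 0 1 <> 0).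
  { rewrite <- E1, line_0. pose proof (int_weightA_pos u i Su Hu). lra. }
  (* With a = A_i the expansion collapses to int A F H - (int A F)(int A H) / int A, a rational
     expression in integrals that are linear in A; [J] differentiates each of them. *)
  apply (is_derive_ext_loc (fun s =>
     RInt (fun x => weightA (line u w s) i x * (primitive (f i) x * primitive (h i) x)) 0 1
     - RInt (fun x => weightA (line u w s) i x * primitive (f i) x) 0 1
       * RInt (fun x => weightA (line u w s) i x * primitive (h i) x) 0 1
       / RInt (fun x => weightA (line u w s) i x * 1) 0 1)).
  { generalize (line_pos u w Su Sw Hu). apply filter_imp. intros s Hs.
    pose proof (int_weightA_pos _ i (smooth3_line u w s Su Sw) Hs) as Hp.
    rewrite int_opQ_product; [|apply smooth_cts, smooth_weightA; [now apply smooth3_line|easy]|easy|easy].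
    rewrite E1 in Hp |- *. real_eq. field. lra. }
  rewrite int_opQ_product; [|now apply smooth_cts, smooth_variationA|easy|easy].
  evar_last.
  - apply (is_derive_minus (fun s => RInt (fun x => weightA (line u w s) i x * (primitive (f i) x * primitive (h i) x)) 0 1)); [exact JFH|].
    apply (is_derive_div (fun s => RInt (fun x => weightA (line u w s) i x * primitive (f i) x) 0 1
       * RInt (fun x => weightA (line u w s) i x * primitive (h i) x) 0 1)); [|exact J1|exact P1].
    apply (is_derive_mult (fun s => RInt (fun x => weightA (line u w s) i x * primitive (f i) x) 0 1)); [exact JF|exact JH|exact Rmult_comm].
  - rewrite line_0 in P1 |- *. rewrite E1.
    unfold minus, plus, opp, mult; simpl. rewrite !line_0. field. exact P1.
Qed.

Lemma d_dirichlet_eq u w f h : smooth3 u -> smooth3 w -> pos u -> smooth3 f -> smooth3 h ->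
  d_dirichlet w u f h
  = sum3 (fun i => RInt (fun x => variationA u w i x * opQ u i (f i) x * opQ u i (h i) x) 0 1).
Proof.
  intros Su Sw Hu Sf Sh. unfold d_dirichlet. apply is_derive_unique.
  unfold dirichlet, sum3.
  apply @is_derive_plus; [apply @is_derive_plus|];
    apply (dirichlet_line_derive u w f h); easy.
Qed.

(** * The geodesic equation in pointwise form *)

Definition flux (u c : triple) (i : idx) (x : R) : R :=
  prod3 u x / u i x * (sum3 (fun j => c j x ^ 2) / 2 - c i x ^ 2).

Definition stress (u f : triple) : triple :=
  flux u (fun j x => opQ u j (f j) x / u j x).

Definition kappa (u f : triple) (i : idx) : R :=
  RInt (fun x => variationA u f i x * opQ u i (f i) x) 0 1 / RInt (weightA u i) 0 1.

(* For a path with [u_t = f] and [u_tt = g], the geodesic equation is [defect = 0];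
   [kappa] is the Lagrange multiplier of the zero-mean condition on tangent vectors. *)
Definition defect (u f g : triple) (i : idx) (x : R) : R :=
  weightA u i x * opQ u i (g i) x + variationA u f i x * opQ u i (f i) x
  - kappa u f i * weightA u i x + Derive (stress u f i) x.

Lemma periodic_opQ u i g : cts g -> periodic g -> RInt g 0 1 = 0 -> periodic (opQ u i g).
Proof.
  intros Cg Pg Ig x. unfold opQ. now rewrite (periodic_primitive g Cg Pg Ig x).
Qed.

Lemma tangent_smooth3 f : tangent_M3 f -> smooth3 f.
Proof. intros H i. apply H. Qed.

Lemma tangent_periodic_opQ u f i : tangent_M3 f -> periodic (opQ u i (f i)).
Proof.
  intros Tf. destruct (Tf i) as [[Pf Sf] If].
  apply periodic_opQ; [now apply smooth_cts, ex_derive_n_smooth|exact Pf|exact If].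
Qed.

Lemma smooth_c u f j : smooth3 u -> pos u -> smooth3 f ->
  smooth (fun x => opQ u j (f j) x / u j x).
Proof.
  intros Su Hu Sf. apply smooth_div; [apply Hu| |now apply smooth3_smooth].
  now apply smooth_opQ, smooth3_smooth.
Qed.

Lemma smooth_stress u f i : smooth3 u -> pos u -> smooth3 f -> smooth (stress u f i).
Proof.
  intros Su Hu Sf.
  assert (SQ : forall j, smooth (opQ u j (f j)))
    by (intros j; now apply smooth_opQ, smooth3_smooth).
  assert (Su' : forall j, smooth (u j)) by (intros j; now apply smooth3_smooth).
  unfold stress, flux, sum3. apply smooth_mult.
  - apply smooth_div; [apply Hu|now apply smooth_prod3|now apply smooth3_smooth].
  - apply smooth_minus; [apply smooth_mult; [|apply smooth_const]|].
    + smooth_rules; try apply Hu; first [apply SQ|apply Su'].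
    + apply smooth_pow. now apply smooth_c.
Qed.

Lemma periodic_prod3 u : smooth3 u -> periodic (prod3 u).
Proof.
  intros Su x. unfold prod3. now rewrite (proj1 (Su i1)), (proj1 (Su i2)), (proj1 (Su i3)).
Qed.

Lemma periodic_weightA u i : smooth3 u -> periodic (weightA u i).
Proof.
  intros Su x. unfold weightA. now rewrite (periodic_prod3 u Su), (proj1 (Su i)).
Qed.

Lemma periodic_stress u f i : smooth3 u -> tangent_M3 f -> periodic (stress u f i).
Proof.
  intros Su Tf x. unfold stress, flux, sum3.
  now rewrite (periodic_prod3 u Su), (proj1 (Su i1)), (proj1 (Su i2)), (proj1 (Su i3)),
    (proj1 (Su i)), (tangent_periodic_opQ u f i1 Tf), (tangent_periodic_opQ u f i2 Tf),
    (tangent_periodic_opQ u f i3 Tf), (tangent_periodic_opQ u f i Tf).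
Qed.

Lemma int_weightA_opQ u i g : smooth3 u -> pos u -> smooth g ->
  RInt (fun x => weightA u i x * opQ u i g x) 0 1 = 0.
Proof.
  intros Su Hu Sg.
  assert (CA : cts (weightA u i)) by now apply smooth_cts, smooth_weightA.
  assert (CG : cts (primitive g)) by now apply smooth_cts, smooth_primitive.
  unfold opQ. set (c := _ * / _).
  rewrite (RInt_ext _ (fun x => weightA u i x * primitive g x - c * weightA u i x))
    by (intros x _; cbv beta; real_eq; ring).
  rewrite int_minus, int_scal by now cts_rules.
  unfold c. real_eq. field. pose proof (int_weightA_pos u i Su Hu). lra.
Qed.

(** Moves the subtraction of the weighted mean from the test function to a, so that only the
    antiderivative of k is left as a test function. When a is the variation term, the resulting
    factor of A_i is [kappa]. *)
Lemma int_opQ_test (a : R -> R) u i k : cts a -> cts k ->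
  RInt (fun x => a x * opQ u i k x) 0 1
  = RInt (fun x => primitive k x * a x) 0 1
    - RInt a 0 1 / RInt (weightA u i) 0 1
      * RInt (fun x => weightA u i x * primitive k x) 0 1.
Proof.
  intros Ca Ck.
  assert (CK : cts (primitive k))
    by now apply cts_primitive.
  unfold opQ. set (c := _ * / _).
  rewrite (RInt_ext _ (fun x => primitive k x * a x - c * a x))
    by (intros x _; cbv beta; real_eq; ring).
  rewrite int_minus, int_scal by now cts_rules.
  unfold c, Rdiv. real_eq. ring.
Qed.

(** [flux] is the partial derivative in u_i of the energy density (1/2) sum_j A_j Q_j^2 with the Q_j
    held fixed, so varying the weights in the direction k pairs this gradient with k. *)
Lemma int_stress u f k : smooth3 u -> pos u -> smooth3 f -> smooth3 k ->
  sum3 (fun i => RInt (fun x => variationA u k i x * opQ u i (f i) x * opQ u i (f i) x) 0 1)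
  = 2 * sum3 (fun i => RInt (fun x => stress u f i x * k i x) 0 1).
Proof.
  intros Su Hu Sf Sk.
  assert (CQ : forall i, cts (opQ u i (f i)))
    by (intros i; now apply smooth_cts, smooth_opQ, smooth3_smooth).
  assert (CV : forall i, cts (variationA u k i)) by (intros i; now apply smooth_cts, smooth_variationA).
  assert (CS : forall i, cts (stress u f i)) by (intros i; now apply smooth_cts, smooth_stress).
  assert (Ck : forall i, cts (k i)) by (intros i; now apply smooth_cts, smooth3_smooth).
  unfold sum3.
  rewrite <- !int_plus, <- int_scal by (cts_rules; easy).
  apply RInt_ext. intros x _. unfold stress, flux, variationA, weightA, prod3, sum3.
  pose proof (Hu i1 x). pose proof (Hu i2 x). pose proof (Hu i3 x).
  real_eq. field. lra.
Qed.

(** For equal fields the first two terms of Koszul's formula coincide and give the variation of A_i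
    along f; the third is [int_stress]. Integration by parts then moves a derivative from the
    antiderivative of k onto the stress, so that all terms are tested against the same function. *)
Lemma geodesic_operator_eq u f g k :
  smooth3 u -> pos u -> tangent_M3 f -> tangent_M3 g -> tangent_M3 k ->
  dirichlet u g k + levi_civita u f f k
  = sum3 (fun i => RInt (fun x => primitive (k i) x * defect u f g i x) 0 1).
Proof.
  intros Su Hu Tf Tg Tk.
  pose proof (tangent_smooth3 f Tf) as Sf. pose proof (tangent_smooth3 g Tg) as Sg.
  pose proof (tangent_smooth3 k Tk) as Sk.
  unfold levi_civita. rewrite !d_dirichlet_eq, int_stress by easy.
  unfold dirichlet.
  assert (H : forall i,
    RInt (fun x => weightA u i x * opQ u i (g i) x * opQ u i (k i) x) 0 1
    + RInt (fun x => variationA u f i x * opQ u i (f i) x * opQ u i (k i) x) 0 1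
    - RInt (fun x => stress u f i x * k i x) 0 1
    = RInt (fun x => primitive (k i) x * defect u f g i x) 0 1).
  { intros i.
    assert (CA : cts (weightA u i)) by now apply smooth_cts, smooth_weightA.
    assert (CV : cts (variationA u f i)) by now apply smooth_cts, smooth_variationA.
    assert (CQg : cts (opQ u i (g i))) by now apply smooth_cts, smooth_opQ, smooth3_smooth.
    assert (CQf : cts (opQ u i (f i))) by now apply smooth_cts, smooth_opQ, smooth3_smooth.
    assert (Ck : cts (k i)) by now apply smooth_cts, smooth3_smooth.
    assert (CK : cts (primitive (k i))) by now apply smooth_cts, smooth_primitive, smooth3_smooth.
    assert (SE : smooth (stress u f i)) by now apply smooth_stress.
    assert (CE : cts (Derive (stress u f i))) by now apply smooth_cts, smooth_Derive.
    rewrite (int_opQ_test (fun x => weightA u i x * opQ u i (g i) x)),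
      (int_opQ_test (fun x => variationA u f i x * opQ u i (f i) x));
      [|now apply cts_mult|easy|now apply cts_mult|easy].
    rewrite int_weightA_opQ by (try easy; now apply smooth3_smooth).
    fold (kappa u f i).
    rewrite (int_by_parts (stress u f i) (primitive (k i)) (Derive (stress u f i)) (k i)).
    - rewrite (RInt_ext (fun x => primitive (k i) x * defect u f g i x)
        (fun x => (primitive (k i) x * (weightA u i x * opQ u i (g i) x)
                   + primitive (k i) x * (variationA u f i x * opQ u i (f i) x)
                   - kappa u f i * (weightA u i x * primitive (k i) x))
                  + Derive (stress u f i) x * primitive (k i) x)).
      2:{ intros x _. unfold defect. cbv beta. real_eq. ring. }
      assert (C4 : cts (fun x => kappa u f i * (weightA u i x * primitive (k i) x)))
        by now cts_rules.
      rewrite int_plus, int_minus, int_plus, int_scal;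
        try (now cts_rules).
      unfold Rdiv. real_eq. ring.
    - intros x. now apply smooth_is_derive.
    - intros x. now apply primitive_derive.
    - easy.
    - easy.
    - now apply periodic_stress.
    - apply periodic_primitive; [easy|exact (proj1 (proj1 (Tk i)))|exact (proj2 (Tk i))]. }
  unfold sum3. rewrite <- !H. real_eq. field.
Qed.

(** This is what determines [kappa]: A_i Q_i(g_i) integrates to 0 and the stress is periodic, so
    [kappa] has to balance the variation term. *)
Lemma int_defect u f g i :
  smooth3 u -> pos u -> tangent_M3 f -> tangent_M3 g -> RInt (defect u f g i) 0 1 = 0.
Proof.
  intros Su Hu Tf Tg.
  pose proof (tangent_smooth3 f Tf) as Sf. pose proof (tangent_smooth3 g Tg) as Sg.
  assert (CA : cts (weightA u i)) by now apply smooth_cts, smooth_weightA.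
  assert (CV : cts (variationA u f i)) by now apply smooth_cts, smooth_variationA.
  assert (CQg : cts (opQ u i (g i))) by now apply smooth_cts, smooth_opQ, smooth3_smooth.
  assert (CQf : cts (opQ u i (f i))) by now apply smooth_cts, smooth_opQ, smooth3_smooth.
  assert (SE : smooth (stress u f i)) by now apply smooth_stress.
  assert (CE : cts (Derive (stress u f i))) by now apply smooth_cts, smooth_Derive.
  assert (C4 : cts (fun x => kappa u f i * weightA u i x))
    by now cts_rules.
  unfold defect.
  rewrite int_plus, int_minus, int_plus, int_scal;
    try (now cts_rules).
  rewrite int_weightA_opQ by (try easy; now apply smooth3_smooth).
    rewrite (int_Derive (stress u f i) (Derive (stress u f i))); [|intros x; now apply smooth_is_derive|easy].
  pose proof (periodic_stress u f i Su Tf 0) as P. rewrite Rplus_0_l in P. rewrite P.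
    unfold kappa. real_eq. field. pose proof (int_weightA_pos u i Su Hu). lra.
Qed.

Lemma periodic_variationA u w i : smooth3 u -> smooth3 w -> periodic (variationA u w i).
Proof.
  intros Su Sw x. unfold variationA, sum3.
  now rewrite (periodic_weightA u i Su), (proj1 (Su i1)), (proj1 (Su i2)), (proj1 (Su i3)),
    (proj1 (Su i)), (proj1 (Sw i1)), (proj1 (Sw i2)), (proj1 (Sw i3)), (proj1 (Sw i)).
Qed.

Lemma smooth_on_circle_defect u f g i :
  smooth3 u -> pos u -> tangent_M3 f -> tangent_M3 g -> smooth_on_circle (defect u f g i).
Proof.
  intros Su Hu Tf Tg.
  pose proof (tangent_smooth3 f Tf) as Sf. pose proof (tangent_smooth3 g Tg) as Sg.
  assert (SE : smooth (stress u f i)) by now apply smooth_stress.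
  split.
  - intros x. unfold defect.
    rewrite (periodic_weightA u i Su), (tangent_periodic_opQ u g i Tg),
      (tangent_periodic_opQ u f i Tf), (periodic_variationA u f i Su Sf).
    f_equal. apply (periodic_derive (stress u f i)).
    + intros y. now apply smooth_is_derive.
    + now apply periodic_stress.
  - apply smooth_ex_derive_n. unfold defect.
    apply smooth_plus; [apply smooth_minus; [apply smooth_plus|]|].
    + apply smooth_mult; [now apply smooth_weightA|now apply smooth_opQ, smooth3_smooth].
    + apply smooth_mult; [now apply smooth_variationA|now apply smooth_opQ, smooth3_smooth].
    + apply smooth_mult; [apply smooth_const|now apply smooth_weightA].
    + now apply smooth_Derive.
Qed.

Definition idx_eq_dec (i j : idx) : {i = j} + {i <> j}.
Proof. decide equality. Defined.

Lemma sum3_single (F : idx -> R) i : (forall j, j <> i -> F j = 0) -> sum3 F = F i.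
Proof.
  intros H. unfold sum3.
  destruct i; [rewrite (H i2), (H i3)|rewrite (H i1), (H i3)|rewrite (H i1), (H i2)];
    try easy; ring.
Qed.

(** The derivative of the defect D is an admissible tangent vector; placed in component i, with 0 in
    the others, it turns the equation into int (D - D(0)) D = 0. Since D has mean zero, this is int
    D^2 = 0. *)
Lemma defect_eq_0 u f g :
  smooth3 u -> pos u -> tangent_M3 f -> tangent_M3 g ->
  (forall k, tangent_M3 k -> dirichlet u g k + levi_civita u f f k = 0) ->
  forall i x, 0 < x < 1 -> defect u f g i x = 0.
Proof.
  intros Su Hu Tf Tg H i.
  destruct (smooth_on_circle_defect u f g i Su Hu Tf Tg) as [Pd Sd].
  apply ex_derive_n_smooth in Sd.
  assert (Cd : cts (defect u f g i)) by now apply smooth_cts.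
  assert (CDd : cts (Derive (defect u f g i))) by now apply smooth_cts, smooth_Derive.
  assert (Id : RInt (Derive (defect u f g i)) 0 1 = 0).
  { rewrite (int_Derive (defect u f g i) (Derive (defect u f g i))); [|intros y; now apply smooth_is_derive|easy].
    pose proof (Pd 0) as P. rewrite Rplus_0_l in P. rewrite P. real_eq. ring. }
  pose (k := fun j : idx => if idx_eq_dec j i then Derive (defect u f g i) else fun _ => 0).
  assert (Tk : tangent_M3 k).
  { intros j. unfold k. destruct (idx_eq_dec j i).
    - repeat split; [|exact (smooth_ex_derive_n _ (smooth_Derive _ Sd))|exact Id].
      apply (periodic_derive (defect u f g i)); [intros y; now apply smooth_is_derive|easy].
    - repeat split; [exact (smooth_ex_derive_n _ (smooth_const 0))|apply int_const]. }
  apply int_sqr_eq_0; [easy|].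
  specialize (H k Tk). rewrite geodesic_operator_eq in H by easy.
  rewrite (sum3_single _ i) in H.
  - unfold k in H. destruct (idx_eq_dec i i); [|easy].
    rewrite (RInt_ext _ (fun x => defect u f g i x * defect u f g i x
                                  - defect u f g i 0 * defect u f g i x)) in H.
    + rewrite int_minus, int_scal, int_defect in H; try (now cts_rules); try easy. lra.
    + intros x _. rewrite (primitive_Derive (defect u f g i) (Derive (defect u f g i))); [cbv beta; real_eq; ring| |easy].
      intros y. now apply smooth_is_derive.
  - intros j Hj. unfold k. destruct (idx_eq_dec j i); [easy|].
    rewrite (RInt_ext _ (fun _ => 0)); [apply int_const|].
    intros x _. unfold primitive. rewrite RInt_const. change ((x - 0) * 0 * defect u f g j x = 0). ring.
Qed.

Lemma geodesic_operator_0 u f g k :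
  smooth3 u -> pos u -> tangent_M3 f -> tangent_M3 g -> tangent_M3 k ->
  (forall i x, defect u f g i x = 0) -> dirichlet u g k + levi_civita u f f k = 0.
Proof.
  intros Su Hu Tf Tg Tk H. rewrite geodesic_operator_eq by easy.
  assert (Z : forall i, RInt (fun x => primitive (k i) x * defect u f g i x) 0 1 = 0).
  { intros i. rewrite (RInt_ext _ (fun _ => 0)); [apply int_const|].
    intros x _. rewrite H. cbv beta. real_eq. ring. }
  unfold sum3. rewrite !Z. ring.
Qed.

(** * Second variation of the weighted volume *)

Lemma prod3_derive u x : smooth3 u -> pos u ->
  is_derive (prod3 u) x (prod3 u x * sum3 (fun j => Derive (u j) x / u j x)).
Proof.
  intros Su Hu.
  assert (Hd : forall j, is_derive (u j) x (Derive (u j) x))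
    by (intros j; now apply smooth_is_derive, smooth3_smooth).
  pose proof (Hu i1 x). pose proof (Hu i2 x). pose proof (Hu i3 x).
  evar_last.
  - apply (is_derive_mult (fun x => u i1 x * u i2 x) (u i3)); [|apply Hd|exact Rmult_comm].
    apply (is_derive_mult (u i1) (u i2)); [apply Hd|apply Hd|exact Rmult_comm].
  - unfold plus, mult, prod3, sum3; simpl. field. lra.
Qed.

Lemma prod3_div_derive u i x : smooth3 u -> pos u ->
  is_derive (fun x => prod3 u x / u i x) x
    (prod3 u x / u i x * (sum3 (fun j => Derive (u j) x / u j x) - Derive (u i) x / u i x)).
Proof.
  intros Su Hu. pose proof (Hu i x). pose proof (prod3_pos u x Hu).
  evar_last.
  - apply is_derive_div; [now apply prod3_derive| |lra].
    now apply smooth_is_derive, smooth3_smooth.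
  - field. lra.
Qed.

Lemma velocity_derive u f j x : smooth3 u -> pos u -> smooth3 f ->
  is_derive (fun x => opQ u j (f j) x / u j x) x
    (f j x / u j x - Derive (u j) x / u j x * (opQ u j (f j) x / u j x)).
Proof.
  intros Su Hu Sf. pose proof (Hu j x).
  evar_last.
  - apply is_derive_div; [now apply opQ_derive, smooth3_smooth| |lra].
    now apply smooth_is_derive, smooth3_smooth.
  - field. lra.
Qed.

Lemma flux_derive u c c' i x : smooth3 u -> pos u ->
  (forall j, is_derive (c j) x (c' j)) ->
  let b := fun j => Derive (u j) x / u j x in
  is_derive (flux u c i) x
  (prod3 u x / u i x
    * ((sum3 b - b i) * (sum3 (fun j => c j x ^ 2) / 2 - c i x ^ 2)
       + sum3 (fun j => c j x * c' j) - 2 * (c i x * c' i))).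
Proof.
  intros Su Hu Hc b.
  evar_last.
  - apply (is_derive_mult (fun x => prod3 u x / u i x)
             (fun x => sum3 (fun j => c j x ^ 2) / 2 - c i x ^ 2));
      [now apply prod3_div_derive| |exact Rmult_comm].
    apply (is_derive_minus (fun x => sum3 (fun j => c j x ^ 2) / 2) (fun x => c i x ^ 2)).
    + unfold Rdiv, sum3. apply (is_derive_mult (fun x => c i1 x ^ 2 + c i2 x ^ 2 + c i3 x ^ 2) (fun _ => / 2));
        [|apply @is_derive_const|exact Rmult_comm].
      apply (is_derive_plus (fun x => c i1 x ^ 2 + c i2 x ^ 2) (fun x => c i3 x ^ 2));
        [apply (is_derive_plus (fun x => c i1 x ^ 2) (fun x => c i2 x ^ 2))|];
        apply is_derive_pow, Hc.
    + apply is_derive_pow, Hc.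
  - unfold plus, minus, opp, mult, scal, sum3; simpl. unfold mult; simpl.
    fold (b i1) (b i2) (b i3) (b i).
    unfold plus, opp, zero; simpl. field. pose proof (Hu i x). lra.
Qed.

Lemma stress_derive u f i x : smooth3 u -> pos u -> smooth3 f ->
  let a := fun j => f j x / u j x in
  let b := fun j => Derive (u j) x / u j x in
  let c := fun j => opQ u j (f j) x / u j x in
  Derive (stress u f i) x
  = prod3 u x / u i x
    * ((sum3 b - b i) * (sum3 (fun j => c j ^ 2) / 2 - c i ^ 2)
       + sum3 (fun j => c j * (a j - b j * c j)) - 2 * (c i * (a i - b i * c i))).
Proof.
  intros Su Hu Sf a b c. apply is_derive_unique.
  apply (flux_derive u (fun j x => opQ u j (f j) x / u j x) (fun j => a j - b j * c j));
    [easy|easy|]. intros j. now apply velocity_derive.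
Qed.

Lemma weight_derive chi v : volume_weight chi -> 0 < v -> is_derive chi v (Derive chi v).
Proof. intros Hchi Hv. apply Derive_correct. now apply (proj2 (proj2 Hchi)). Qed.

Lemma weight_derive_2 chi v : volume_weight chi -> 0 < v -> is_derive (Derive chi) v (weight_r chi v).
Proof. intros Hchi Hv. apply Derive_correct. now apply (proj2 (proj2 Hchi)). Qed.

Lemma weight_continuous chi v : volume_weight chi -> 0 < v -> continuous chi v.
Proof. intros Hchi Hv. apply @ex_derive_continuous. eexists. now apply weight_derive. Qed.

Lemma weight_continuous_1 chi v : volume_weight chi -> 0 < v -> continuous (Derive chi) v.
Proof. intros Hchi Hv. apply @ex_derive_continuous. eexists. now apply weight_derive_2. Qed.

Lemma weight_continuous_2 chi v : volume_weight chi -> 0 < v -> continuous (weight_r chi) v.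
Proof. intros Hchi Hv. now apply (proj2 (proj2 Hchi)). Qed.

Lemma cts_comp_pos (h g : R -> R) : (forall v, 0 < v -> continuous h v) ->
  cts g -> (forall x, 0 < g x) -> cts (fun x => h (g x)).
Proof.
  intros Hh Cg Hg. apply continuous_cts. intros x.
  apply (continuous_comp g h); [now apply cts_continuous|apply Hh, Hg].
Qed.

Lemma weighted_cofactor_derive chi u i x : volume_weight chi -> smooth3 u -> pos u ->
  let b := fun j => Derive (u j) x / u j x in
  is_derive (fun x => Derive chi (prod3 u x) * (prod3 u x / u i x)) x
    (prod3 u x / u i x * (weight_r chi (prod3 u x) * (prod3 u x * sum3 b)
                          + Derive chi (prod3 u x) * (sum3 b - b i))).
Proof.
  intros Hchi Su Hu b. pose proof (prod3_pos u x Hu).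
  evar_last.
  - apply (is_derive_mult (fun x => Derive chi (prod3 u x)) (fun x => prod3 u x / u i x));
      [|now apply prod3_div_derive|exact Rmult_comm].
    apply (is_derive_comp (Derive chi) (prod3 u)); [now apply weight_derive_2|].
    now apply prod3_derive.
  - fold b. fold (b i). unfold plus, mult, scal; simpl. unfold mult; simpl. ring.
Qed.

(* Integrating by parts against [Q_i(f_i') - kappa_i], the geodesic equation
   [defect = 0] expresses it through first derivatives only. *)
Lemma second_variation_formQ chi u f g : volume_weight chi ->
  smooth3 u -> pos u -> tangent_M3 f -> tangent_M3 g ->
  (forall i x, 0 < x < 1 -> defect u f g i x = 0) ->
  RInt (fun x => weight_r chi (prod3 u x)
                   * (f i1 x * u i2 x * u i3 x + u i1 x * f i2 x * u i3 x
                      + u i1 x * u i2 x * f i3 x) ^ 2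
                 + Derive chi (prod3 u x)
                   * (g i1 x * u i2 x * u i3 x + u i1 x * g i2 x * u i3 x
                      + u i1 x * u i2 x * g i3 x
                      + 2 * (f i1 x * f i2 x * u i3 x + f i1 x * u i2 x * f i3 x
                             + u i1 x * f i2 x * f i3 x))) 0 1
  = RInt (fun x => prod3 u x ^ 2
            * formQ (weight_r chi (prod3 u x)) (weight_s chi (prod3 u x))
                    (geodesic_vars u f x)) 0 1.
Proof.
  intros Hchi Su Hu Tf Tg Hdef.
  pose proof (tangent_smooth3 f Tf) as Sf. pose proof (tangent_smooth3 g Tg) as Sg.
  assert (CP : cts (prod3 u)) by now apply smooth_cts, smooth_prod3.
  assert (HP : forall x, 0 < prod3 u x) by (intros x; now apply prod3_pos).
  assert (Cu : forall i, cts (u i)) by (intros i; now apply smooth_cts, smooth3_smooth).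
  assert (Cf : forall i, cts (f i)) by (intros i; now apply smooth_cts, smooth3_smooth).
  assert (Cg : forall i, cts (g i)) by (intros i; now apply smooth_cts, smooth3_smooth).
  assert (CDu : forall i, cts (Derive (u i)))
    by (intros i; now apply smooth_cts, smooth_Derive, smooth3_smooth).
  assert (C1 : cts (fun x => Derive chi (prod3 u x)))
    by (apply cts_comp_pos; [intros v; now apply weight_continuous_1|easy|easy]).
  assert (C2 : cts (fun x => weight_r chi (prod3 u x)))
    by (apply cts_comp_pos; [intros v; now apply weight_continuous_2|easy|easy]).
  (* Among the antiderivatives of g_i, this is the one for which the vanishing of the defect reads
     A_i V_i = - (variation term) - (stress)'. *)
  pose (V := fun i x => opQ u i (g i) x - kappa u f i).
  assert (DV : forall i x, is_derive (V i) x (g i x)).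
  { intros i x. replace (g i x) with (g i x - 0) by ring.
    apply (is_derive_minus (opQ u i (g i)) (fun _ => _)); [|apply @is_derive_const].
    now apply opQ_derive, smooth3_smooth. }
  assert (CV : forall i, cts (V i)) by (intros i; now apply cts_of_derive with (g i)).
  (* The coefficient of g_i in the integrand: u / u_i is the partial derivative of u in u_i. *)
  pose (W := fun i x => Derive chi (prod3 u x) * (prod3 u x / u i x)).
  pose (W' := fun i x => prod3 u x / u i x
    * (weight_r chi (prod3 u x) * (prod3 u x * sum3 (fun j => Derive (u j) x / u j x))
       + Derive chi (prod3 u x) * (sum3 (fun j => Derive (u j) x / u j x)
                                   - Derive (u i) x / u i x))).
  assert (DW : forall i x, is_derive (W i) x (W' i x))
    by (intros i x; now apply weighted_cofactor_derive).
  assert (CW : forall i, cts (W i)) by (intros i; now apply cts_of_derive with (W' i)).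
  assert (CW' : forall i, cts (W' i)).
  { intros i. unfold W', sum3. cts_rules; first [apply Hu|exact CP|exact C1|exact C2|apply CDu|apply Cu]. }
  assert (BP : forall i, RInt (fun x => W i x * g i x) 0 1
                         = - RInt (fun x => W' i x * V i x) 0 1).
  { intros i. apply int_by_parts; try easy.
    - intros x. unfold W. now rewrite (periodic_prod3 u Su), (proj1 (Su i)).
    - intros x. unfold V. now rewrite (tangent_periodic_opQ u g i Tg). }
  pose (Z := fun x => weight_r chi (prod3 u x)
                   * (f i1 x * u i2 x * u i3 x + u i1 x * f i2 x * u i3 x
                      + u i1 x * u i2 x * f i3 x) ^ 2
                 + Derive chi (prod3 u x)
                   * (2 * (f i1 x * f i2 x * u i3 x + f i1 x * u i2 x * f i3 x
                             + u i1 x * f i2 x * f i3 x))).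
  assert (CZ : cts Z).
  { unfold Z. cts_rules; first [exact C1|exact C2|apply Cu|apply Cf]. }
  rewrite (RInt_ext _ (fun x => Z x + W i1 x * g i1 x + W i2 x * g i2 x + W i3 x * g i3 x)).
  2:{ intros x _. pose proof (Hu i1 x). pose proof (Hu i2 x). pose proof (Hu i3 x).
      unfold Z, W. real_eq.
      generalize (Derive chi (prod3 u x)) (weight_r chi (prod3 u x)). intros s r.
      unfold prod3. field. lra. }
  rewrite !int_plus, !BP by (cts_rules; easy).
  rewrite <- !int_opp, <- !int_plus by (cts_rules; easy).
  apply int_ext01. intros x Hx.
  pose proof (Hu i1 x) as H1. pose proof (Hu i2 x) as H2. pose proof (Hu i3 x) as H3.
  pose proof (HP x) as Hp.
  pose (a := fun j => f j x / u j x).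
  pose (b := fun j => Derive (u j) x / u j x).
  pose (c := fun j => opQ u j (f j) x / u j x).
  (* Dividing the vanishing defect by A_i leaves u_i times a polynomial in a, b, c, free of
     accelerations and second x-derivatives. *)
  assert (EV : forall i, V i x = - u i x * (c i * (sum3 a - 2 * a i)
     + ((sum3 b - b i) * (sum3 (fun j => c j ^ 2) / 2 - c i ^ 2)
       + sum3 (fun j => c j * (a j - b j * c j)) - 2 * (c i * (a i - b i * c i))))).
  { intros i. specialize (Hdef i x Hx). unfold defect in Hdef.
    unfold variationA in Hdef. fold a in Hdef. fold (a i) in Hdef.
    replace (opQ u i (f i) x) with (c i * u i x) in Hdef
      by (unfold c; field; specialize (Hu i x); lra).
    pose proof (stress_derive u f i x Su Hu Sf) as E. cbv zeta in E.
    change (Derive (stress u f i) x = prod3 u x / u i x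
      * ((sum3 b - b i) * (sum3 (fun j => c j ^ 2) / 2 - c i ^ 2)
         + sum3 (fun j => c j * (a j - b j * c j)) - 2 * (c i * (a i - b i * c i)))) in E.
    rewrite E in Hdef.
    pose proof (Hu i x) as Hi.
    apply (Rmult_eq_reg_l (prod3 u x / (u i x) ^ 2)).
    - unfold V. unfold weightA in Hdef.
      match type of Hdef with ?L = 0 =>
        match goal with |- ?l = ?r => cut (l - r = L); [lra|] end end.
      field. lra.
    - apply Rgt_not_eq. apply Rdiv_lt_0_compat; [easy|now apply pow_lt]. }
  rewrite !EV.
  unfold Z, W', formQ, geodesic_vars.
  fold (a i1) (a i2) (a i3) (b i1) (b i2) (b i3) (c i1) (c i2) (c i3). fold b.
  replace (f i1 x) with (a i1 * u i1 x) by (unfold a; field; lra).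
  replace (f i2 x) with (a i2 * u i2 x) by (unfold a; field; lra).
  replace (f i3 x) with (a i3 * u i3 x) by (unfold a; field; lra).
  (* The definition of s read backwards: chi_u = (s - r) u. From here r and s are independent
     letters, and the claim is an identity of rational functions. *)
  replace (Derive chi (prod3 u x))
    with ((weight_s chi (prod3 u x) - weight_r chi (prod3 u x)) * prod3 u x)
    by (unfold weight_s, weight_r; field; lra).
  generalize (weight_s chi (prod3 u x)) (weight_r chi (prod3 u x)). intros s r.
  unfold sum3, prod3. clearbody a b c. field. lra.
Qed.

(** * Partial derivatives of smooth paths and of the volume along them *)

Definition jet (t1 t2 : Rbar) (D : nat -> nat -> R -> R -> R) : Prop :=
  forall m n t x, in_interval t1 t2 t ->
    is_derive (fun s => D m n s x) t (D (S m) n t x) /\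
    is_derive (fun y => D m n t y) x (D m (S n) t x) /\
    continuity_2d_pt (D m n) t x.

Lemma in_interval_locally t1 t2 t :
  in_interval t1 t2 t -> locally t (in_interval t1 t2).
Proof.
  intros [H1 H2]. apply filter_and.
  - now apply (open_Rbar_gt' (Finite t) t1).
  - now apply (open_Rbar_lt' (Finite t) t2).
Qed.


Lemma jet_smooth t1 t2 D m n t : jet t1 t2 D -> in_interval t1 t2 t -> smooth (D m n t).
Proof.
  intros J Ht. apply smooth_Ck. intros k. revert n.
  induction k as [|k IH]; intros n; [exact I|].
  exists (D m (S n) t). split; [|apply IH]. intros x. now apply J.
Qed.

Lemma jet_int_derive t1 t2 D m n t : jet t1 t2 D -> in_interval t1 t2 t ->
  is_derive (fun s => RInt (D m n s) 0 1) t (RInt (D (S m) n t) 0 1).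
Proof.
  intros J Ht. apply derive_RInt_param.
  - generalize (in_interval_locally _ _ _ Ht). apply filter_imp.
    intros s Hs x. now apply J.
  - intros x. now apply J.
  - generalize (in_interval_locally _ _ _ Ht). apply filter_imp.
    intros s Hs. eapply smooth_cts, jet_smooth; [exact J|exact Hs].
Qed.

(** Also applied with f and g equal, to identify two expressions for the same partial derivative. *)
Lemma derive_locally_unique (f g : R -> R) t l l' :
  locally t (fun s => f s = g s) -> is_derive f t l -> is_derive g t l' -> l = l'.
Proof.
  intros H Hf Hg. rewrite <- (is_derive_unique _ _ _ Hf), <- (is_derive_unique _ _ _ Hg).
  now apply Derive_ext_loc.
Qed.

Lemma jet_periodic t1 t2 D m t : jet t1 t2 D ->
  (forall t, in_interval t1 t2 t -> periodic (D m 0%nat t)) ->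
  in_interval t1 t2 t -> periodic (D (S m) 0%nat t).
Proof.
  intros J P Ht x.
  apply (derive_locally_unique (fun s => D m 0%nat s (x + 1)) (fun s => D m 0%nat s x) t).
  - generalize (in_interval_locally _ _ _ Ht). apply filter_imp. intros s Hs. now apply P.
  - now apply J.
  - now apply J.
Qed.

Lemma jet_int_0 t1 t2 D m t c : jet t1 t2 D ->
  (forall t, in_interval t1 t2 t -> RInt (D m 0%nat t) 0 1 = c) ->
  in_interval t1 t2 t -> RInt (D (S m) 0%nat t) 0 1 = 0.
Proof.
  intros J P Ht.
  apply (derive_locally_unique (fun s => RInt (D m 0%nat s) 0 1) (fun s => c) t).
  - generalize (in_interval_locally _ _ _ Ht). apply filter_imp. intros s Hs. now apply P.
  - now apply jet_int_derive with t1 t2.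
  - apply @is_derive_const.
Qed.

Lemma geodesic_jet t1 t2 u : (forall i, smooth_on_cylinder t1 t2 (fun t x => u t i x)) ->
  exists D : idx -> nat -> nat -> R -> R -> R,
    (forall t, in_interval t1 t2 t -> u t = fun i => D i 0%nat 0%nat t) /\
    (forall i, jet t1 t2 (D i)).
Proof.
  intros H. destruct (H i1) as [D1 [E1 J1]], (H i2) as [D2 [E2 J2]], (H i3) as [D3 [E3 J3]].
  exists (fun i => match i with i1 => D1 | i2 => D2 | i3 => D3 end). split.
  - intros t Ht. apply functional_extensionality. intros i.
    apply functional_extensionality. intros x. symmetry.
    destruct i; [now apply E1|now apply E2|now apply E3].
  - intros [ | | ]; [exact J1|exact J2|exact J3].
Qed.

Lemma velocity_jet t1 t2 u D t :
  (forall t, in_interval t1 t2 t -> u t = fun i => D i 0%nat 0%nat t) ->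
  (forall i, jet t1 t2 (D i)) -> in_interval t1 t2 t ->
  velocity u t = fun i => D i 1%nat 0%nat t.
Proof.
  intros E J Ht. apply functional_extensionality. intros i.
  apply functional_extensionality. intros x. unfold velocity.
  rewrite (Derive_ext_loc _ (fun s => D i 0%nat 0%nat s x)).
  - apply is_derive_unique. now apply J.
  - generalize (in_interval_locally _ _ _ Ht). apply filter_imp. intros s Hs. now rewrite E.
Qed.

Lemma acceleration_jet t1 t2 u D t :
  (forall t, in_interval t1 t2 t -> u t = fun i => D i 0%nat 0%nat t) ->
  (forall i, jet t1 t2 (D i)) -> in_interval t1 t2 t ->
  acceleration u t = fun i => D i 2%nat 0%nat t.
Proof.
  intros E J Ht. apply functional_extensionality. intros i.
  apply functional_extensionality. intros x. unfold acceleration.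
  change (Derive (fun s => velocity u s i x) t = D i 2%nat 0%nat t x).
  rewrite (Derive_ext_loc _ (fun s => D i 1%nat 0%nat s x)).
  - apply is_derive_unique. now apply J.
  - generalize (in_interval_locally _ _ _ Ht). apply filter_imp. intros s Hs.
    now rewrite (velocity_jet t1 t2 u D).
Qed.

Lemma is_derive_prod_fst (a b c : R -> R) a' b' c' t :
  is_derive a t a' -> is_derive b t b' -> is_derive c t c' ->
  is_derive (fun s => a s * b s * c s) t (a' * b t * c t + a t * b' * c t + a t * b t * c').
Proof.
  intros Ha Hb Hc. evar_last.
  - apply (is_derive_mult (fun s => a s * b s) c); [|exact Hc|exact Rmult_comm].
    apply (is_derive_mult a b); [exact Ha|exact Hb|exact Rmult_comm].
  - unfold plus, mult; simpl. ring.
Qed.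

Lemma is_derive_plus3 (a b c : R -> R) a' b' c' t :
  is_derive a t a' -> is_derive b t b' -> is_derive c t c' ->
  is_derive (fun s => a s + b s + c s) t (a' + b' + c').
Proof.
  intros Ha Hb Hc.
  apply (is_derive_plus (fun s => a s + b s) c); [|exact Hc].
  now apply (is_derive_plus a b).
Qed.

Lemma continuity_2d_comp_pos (h : R -> R) (g : R -> R -> R) t x :
  (forall v, 0 < v -> continuous h v) -> 0 < g t x -> continuity_2d_pt g t x ->
  continuity_2d_pt (fun s y => h (g s y)) t x.
Proof.
  intros Hh Hg Cg. apply continuity_1d_2d_pt_comp; [|exact Cg].
  apply continuity_pt_filterlim. now apply Hh.
Qed.

(** Two differentiations under the integral give chi_uu (u_t)^2 + chi_u u_tt; the geodesic equation
    enters afterwards, through [defect_eq_0], to remove the accelerations. Velocity and acceleration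
    are tangent because periodicity and the mean can be differentiated in t. *)
Lemma volume_second_derivative chi t1 t2 u t :
  volume_weight chi -> canonical_geodesic t1 t2 u -> in_interval t1 t2 t ->
  ex_derive (fun tau => Vol chi (u tau)) t /\
  is_derive (Derive (fun tau => Vol chi (u tau))) t
    (RInt (fun x => prod3 (u t) x ^ 2
             * formQ (weight_r chi (prod3 (u t) x)) (weight_s chi (prod3 (u t) x))
                     (geodesic_vars (u t) (velocity u t) x)) 0 1).
Proof.
  intros Hchi [HM [HS HG]] Ht.
  destruct (geodesic_jet t1 t2 u HS) as [D [E J]].
  assert (Per : forall i s, in_interval t1 t2 s -> periodic (D i 0%nat 0%nat s)).
  { intros i s Hs. destruct (HM s Hs i) as [[P _] _]. rewrite E in P by easy. exact P. }
  assert (Mean : forall i s, in_interval t1 t2 s -> RInt (D i 0%nat 0%nat s) 0 1 = 1).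
  { intros i s Hs. destruct (HM s Hs i) as [_ [_ P]]. rewrite E in P by easy. exact P. }
  assert (Hp : forall i s x, in_interval t1 t2 s -> 0 < D i 0%nat 0%nat s x).
  { intros i s x Hs. destruct (HM s Hs i) as [_ [P _]]. rewrite E in P by easy. apply P. }
  assert (Tf : forall s, in_interval t1 t2 s -> tangent_M3 (fun i => D i 1%nat 0%nat s)).
  { intros s Hs i. split; [split|].
    - apply (jet_periodic t1 t2); [apply J|apply Per|exact Hs].
    - apply smooth_ex_derive_n, (jet_smooth t1 t2); [apply J|exact Hs].
    - apply (jet_int_0 t1 t2 _ _ _ 1); [apply J|apply Mean|exact Hs]. }
  assert (Tg : tangent_M3 (fun i => D i 2%nat 0%nat t)).
  { intros i. split; [split|].
    - apply (jet_periodic t1 t2); [apply J|intros s Hs; exact (proj1 (proj1 (Tf s Hs i)))|exact Ht].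
    - apply smooth_ex_derive_n, (jet_smooth t1 t2); [apply J|exact Ht].
    - apply (jet_int_0 t1 t2 _ _ _ 0); [apply J|intros s Hs; exact (proj2 (Tf s Hs i))|exact Ht]. }
  pose (P0 := fun s x => D i1 0%nat 0%nat s x * D i2 0%nat 0%nat s x * D i3 0%nat 0%nat s x).
  pose (P1 := fun s x =>
    D i1 1%nat 0%nat s x * D i2 0%nat 0%nat s x * D i3 0%nat 0%nat s x
    + D i1 0%nat 0%nat s x * D i2 1%nat 0%nat s x * D i3 0%nat 0%nat s x
    + D i1 0%nat 0%nat s x * D i2 0%nat 0%nat s x * D i3 1%nat 0%nat s x).
  pose (P2 := fun s x =>
    D i1 2%nat 0%nat s x * D i2 0%nat 0%nat s x * D i3 0%nat 0%nat s x
    + D i1 0%nat 0%nat s x * D i2 2%nat 0%nat s x * D i3 0%nat 0%nat s x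
    + D i1 0%nat 0%nat s x * D i2 0%nat 0%nat s x * D i3 2%nat 0%nat s x
    + 2 * (D i1 1%nat 0%nat s x * D i2 1%nat 0%nat s x * D i3 0%nat 0%nat s x
           + D i1 1%nat 0%nat s x * D i2 0%nat 0%nat s x * D i3 1%nat 0%nat s x
           + D i1 0%nat 0%nat s x * D i2 1%nat 0%nat s x * D i3 1%nat 0%nat s x)).
  assert (P0pos : forall s x, in_interval t1 t2 s -> 0 < P0 s x).
  { intros s x Hs. unfold P0. repeat apply Rmult_lt_0_compat; now apply Hp. }
  assert (DP0 : forall s x, in_interval t1 t2 s -> is_derive (fun z => P0 z x) s (P1 s x)).
  { intros s x Hs. unfold P0, P1.
    apply (is_derive_prod_fst (fun z => D i1 0%nat 0%nat z x) (fun z => D i2 0%nat 0%nat z x)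
             (fun z => D i3 0%nat 0%nat z x)); now apply J. }
  assert (DP1 : forall s x, in_interval t1 t2 s -> is_derive (fun z => P1 z x) s (P2 s x)).
  { intros s x Hs. unfold P1, P2.
    assert (H : forall m n k,
      is_derive (fun z => D i1 m 0%nat z x * D i2 n 0%nat z x * D i3 k 0%nat z x) s
        (D i1 (S m) 0%nat s x * D i2 n 0%nat s x * D i3 k 0%nat s x
         + D i1 m 0%nat s x * D i2 (S n) 0%nat s x * D i3 k 0%nat s x
         + D i1 m 0%nat s x * D i2 n 0%nat s x * D i3 (S k) 0%nat s x)).
    { intros m n k.
      apply (is_derive_prod_fst (fun z => D i1 m 0%nat z x) (fun z => D i2 n 0%nat z x)
             (fun z => D i3 k 0%nat z x)); now apply J. }
    evar_last.
    - apply (is_derive_plus3 _ _ _ _ _ _ _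
        (H 1%nat 0%nat 0%nat) (H 0%nat 1%nat 0%nat) (H 0%nat 0%nat 1%nat)).
    - cbv beta. ring. }
  assert (CJ : forall i m s x, in_interval t1 t2 s -> continuity_2d_pt (D i m 0%nat) s x)
    by (intros i m s x Hs; now apply J).
  assert (C0 : forall s x, in_interval t1 t2 s -> continuity_2d_pt P0 s x).
  { intros s x Hs. unfold P0.
    repeat apply continuity_2d_pt_mult; now apply CJ. }
  assert (C1 : forall s x, in_interval t1 t2 s -> continuity_2d_pt P1 s x).
  { intros s x Hs. unfold P1.
    repeat first [apply continuity_2d_pt_plus|apply continuity_2d_pt_mult|now apply CJ]. }
  assert (C2 : forall s x, in_interval t1 t2 s -> continuity_2d_pt P2 s x).
  { intros s x Hs. unfold P2.
    repeat first [apply continuity_2d_pt_plus|apply continuity_2d_pt_mult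
                 |apply continuity_2d_pt_const|now apply CJ]. }
  assert (SD : forall i m s, in_interval t1 t2 s -> cts (D i m 0%nat s))
    by (intros i m s Hs; apply smooth_cts, (jet_smooth t1 t2); [apply J|exact Hs]).
  assert (cP0 : forall s, in_interval t1 t2 s -> cts (P0 s))
    by (intros s Hs; unfold P0; cts_rules; now apply SD).
  assert (cP1 : forall s, in_interval t1 t2 s -> cts (P1 s))
    by (intros s Hs; unfold P1; cts_rules; now apply SD).
  assert (Loc : forall s, in_interval t1 t2 s ->
     locally s (fun z => Vol chi (u z) = RInt (fun x => chi (P0 z x)) 0 1)).
  { intros s Hs. generalize (in_interval_locally _ _ _ Hs). apply filter_imp.
    intros z Hz. now rewrite E. }
  assert (V1 : forall s, in_interval t1 t2 s ->
     is_derive (fun tau => Vol chi (u tau)) s (RInt (fun x => Derive chi (P0 s x) * P1 s x) 0 1)).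
  { intros s Hs.
    apply (is_derive_ext_loc (fun z => RInt (fun x => chi (P0 z x)) 0 1)).
    { generalize (Loc s Hs). apply filter_imp. intros z Hz. now symmetry. }
    apply (derive_RInt_param (fun z x => chi (P0 z x)) (fun z x => Derive chi (P0 z x) * P1 z x)).
    - generalize (in_interval_locally _ _ _ Hs). apply filter_imp. intros z Hz x.
      rewrite Rmult_comm.
      apply (is_derive_comp chi (fun z => P0 z x)); [|now apply DP0].
      now apply weight_derive, P0pos.
    - intros x. apply continuity_2d_pt_mult; [|now apply C1].
      apply continuity_2d_comp_pos; [intros v; now apply weight_continuous_1|now apply P0pos|now apply C0].
    - generalize (in_interval_locally _ _ _ Hs). apply filter_imp. intros z Hz.
      apply cts_comp_pos; [intros v; now apply weight_continuous|now apply cP0|].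
      intros x. now apply P0pos. }
  split; [eexists; now apply V1|].
  apply (is_derive_ext_loc (fun s => RInt (fun x => Derive chi (P0 s x) * P1 s x) 0 1)).
  { generalize (in_interval_locally _ _ _ Ht). apply filter_imp. intros s Hs.
    symmetry. apply is_derive_unique. now apply V1. }
  rewrite (velocity_jet t1 t2 u D t E J Ht), (E t Ht).
  assert (Su : smooth3 (fun i => D i 0%nat 0%nat t)).
  { rewrite <- (E t Ht). intros i. exact (proj1 (HM t Ht i)). }
  assert (Hu : pos (fun i => D i 0%nat 0%nat t)) by (intros i x; now apply Hp).
  rewrite <- (second_variation_formQ chi _ _ (fun i => D i 2%nat 0%nat t)); [|easy|easy|easy|now apply Tf|easy|].
  2:{ apply defect_eq_0; [easy|easy|now apply Tf|easy|].
      intros k Tk. specialize (HG t Ht k Tk).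
      rewrite (velocity_jet t1 t2 u D t E J Ht), (acceleration_jet t1 t2 u D t E J Ht), (E t Ht) in HG.
      exact HG. }
  apply (derive_RInt_param (fun z x => Derive chi (P0 z x) * P1 z x)
          (fun z x => weight_r chi (P0 z x) * P1 z x ^ 2 + Derive chi (P0 z x) * P2 z x)).
  - generalize (in_interval_locally _ _ _ Ht). apply filter_imp. intros z Hz x.
    evar_last.
    + apply (is_derive_mult (fun z => Derive chi (P0 z x)) (fun z => P1 z x));
        [|now apply DP1|exact Rmult_comm].
      apply (is_derive_comp (Derive chi) (fun z => P0 z x)); [|now apply DP0].
      now apply weight_derive_2, P0pos.
    + unfold plus, mult, scal; simpl. unfold mult; simpl. ring.
  - intros x. apply continuity_2d_pt_plus; apply continuity_2d_pt_mult.
    + apply continuity_2d_comp_pos; [intros v; now apply weight_continuous_2|now apply P0pos|now apply C0].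
    + apply (continuity_2d_pt_ext (fun z x => P1 z x * P1 z x)); [intros; ring|].
      apply continuity_2d_pt_mult; now apply C1.
    + apply continuity_2d_comp_pos; [intros v; now apply weight_continuous_1|now apply P0pos|now apply C0].
    + now apply C2.
  - generalize (in_interval_locally _ _ _ Ht). apply filter_imp. intros z Hz.
    apply cts_mult; [|now apply cP1].
    apply cts_comp_pos; [intros v; now apply weight_continuous_1|now apply cP0|].
    intros x. now apply P0pos.
Qed.

(** * Trigonometric polynomials *)

(* The triple [(a, n, phi)] stands for [a cos (2 pi n x + phi)]. *)
Definition tpoly : Type := list (R * Z * R).

Fixpoint teval (p : tpoly) (x : R) : R :=
  match p with
  | [] => 0
  | (a, n, phi) :: p => a * cos (2 * PI * IZR n * x + phi) + teval p x
  end.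

(** A norm of the list, not of the function: terms of equal frequency are never merged. It bounds
    the supremum and is exactly multiplicative under [tmul]. *)
Fixpoint tnorm (p : tpoly) : R :=
  match p with [] => 0 | (a, _, _) :: p => Rabs a + tnorm p end.

Fixpoint tdeg (N : R) (p : tpoly) : Prop :=
  match p with [] => True | (_, n, _) :: p => Rabs (IZR n) <= N /\ tdeg N p end.

(** Differentiation shifts the phase by PI / 2, which avoids a second family of sine terms. *)
Fixpoint tder (p : tpoly) : tpoly :=
  match p with
  | [] => []
  | (a, n, phi) :: p => (a * (2 * PI * IZR n), n, phi + PI / 2) :: tder p
  end.

Fixpoint tscal (c : R) (p : tpoly) : tpoly :=
  match p with [] => [] | (a, n, phi) :: p => (c * a, n, phi) :: tscal c p end.

(** The product-to-sum formula for cosines. Differences of frequencies may be negative, hence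
    frequencies in Z and the absolute value in [tdeg]. *)
Fixpoint tmul1 (a : R) (n : Z) (phi : R) (q : tpoly) : tpoly :=
  match q with
  | [] => []
  | (b, m, psi) :: q =>
      (a * b / 2, (n + m)%Z, phi + psi) :: (a * b / 2, (n - m)%Z, phi - psi)
      :: tmul1 a n phi q
  end.

Fixpoint tmul (p q : tpoly) : tpoly :=
  match p with [] => [] | (a, n, phi) :: p => tmul1 a n phi q ++ tmul p q end.

Fixpoint tsum (f : nat -> tpoly) (n : nat) : tpoly :=
  match n with O => f O | S n => tsum f n ++ f (S n) end.

Lemma teval_app p q x : teval (p ++ q) x = teval p x + teval q x.
Proof.
  induction p as [|[[a n] phi] p IH]; simpl; [ring|]. rewrite IH. ring.
Qed.

Lemma tnorm_app p q : tnorm (p ++ q) = tnorm p + tnorm q.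
Proof.
  induction p as [|[[a n] phi] p IH]; simpl; [ring|]. rewrite IH. ring.
Qed.

Lemma tdeg_app N p q : tdeg N p -> tdeg N q -> tdeg N (p ++ q).
Proof.
  induction p as [|[[a n] phi] p IH]; simpl; [easy|]. intros [H1 H2] Hq. split; auto.
Qed.

Lemma tnorm_pos p : 0 <= tnorm p.
Proof.
  induction p as [|[[a n] phi] p IH]; simpl; [lra|]. pose proof (Rabs_pos a). lra.
Qed.

Lemma teval_bound p x : Rabs (teval p x) <= tnorm p.
Proof.
  induction p as [|[[a n] phi] p IH]; simpl; [rewrite Rabs_R0; lra|].
  eapply Rle_trans; [apply Rabs_triang|]. apply Rplus_le_compat; [|exact IH].
  rewrite Rabs_mult. rewrite <- (Rmult_1_r (Rabs a)) at 2.
  apply Rmult_le_compat_l; [apply Rabs_pos|].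
  apply Rabs_le, COS_bound.
Qed.

Lemma tdeg_mono N M p : N <= M -> tdeg N p -> tdeg M p.
Proof.
  intros H. induction p as [|[[a n] phi] p IH]; simpl; [easy|].
  intros [H1 H2]. split; [lra|auto].
Qed.

Lemma teval_tder p x : is_derive (teval p) x (teval (tder p) x).
Proof.
  induction p as [|[[a n] phi] p IH]; simpl; [apply @is_derive_const|].
  apply (is_derive_plus (fun x => a * cos (2 * PI * IZR n * x + phi)) (teval p)); [|exact IH].
  auto_derive; [easy|].
  rewrite <- Rplus_assoc, cos_plus, cos_PI2, sin_PI2. ring.
Qed.

Lemma tdeg_tder N p : tdeg N p -> tdeg N (tder p).
Proof.
  induction p as [|[[a n] phi] p IH]; simpl; [easy|]. intros [H1 H2]. auto.
Qed.

(** A Bernstein inequality, immediate for this norm because each term acquires its own frequency as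
    a factor. *)
Lemma tnorm_tder N p : tdeg N p -> tnorm (tder p) <= 2 * PI * N * tnorm p.
Proof.
  pose proof PI_RGT_0.
  induction p as [|[[a n] phi] p IH]; simpl; [lra|]. intros [H1 H2].
  specialize (IH H2). rewrite !Rabs_mult, (Rabs_pos_eq 2), (Rabs_pos_eq PI) by lra.
  assert (Rabs a * (2 * PI * Rabs (IZR n)) <= Rabs a * (2 * PI * N)).
  { apply Rmult_le_compat_l; [apply Rabs_pos|]. apply Rmult_le_compat_l; lra. }
  lra.
Qed.

Lemma teval_tscal c p x : teval (tscal c p) x = c * teval p x.
Proof.
  induction p as [|[[a n] phi] p IH]; simpl; [ring|]. rewrite IH. ring.
Qed.

Lemma tnorm_tscal c p : tnorm (tscal c p) = Rabs c * tnorm p.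
Proof.
  induction p as [|[[a n] phi] p IH]; simpl; [ring|]. rewrite IH, Rabs_mult. ring.
Qed.

Lemma tdeg_tscal N c p : tdeg N p -> tdeg N (tscal c p).
Proof.
  induction p as [|[[a n] phi] p IH]; simpl; [easy|]. intros [H1 H2]. auto.
Qed.

Lemma teval_tmul1 a n phi q x :
  teval (tmul1 a n phi q) x = a * cos (2 * PI * IZR n * x + phi) * teval q x.
Proof.
  induction q as [|[[b m] psi] q IH]; simpl; [ring|]. rewrite IH.
  rewrite plus_IZR, minus_IZR.
  replace (2 * PI * (IZR n + IZR m) * x + (phi + psi))
    with ((2 * PI * IZR n * x + phi) + (2 * PI * IZR m * x + psi)) by ring.
  replace (2 * PI * (IZR n - IZR m) * x + (phi - psi))
    with ((2 * PI * IZR n * x + phi) - (2 * PI * IZR m * x + psi)) by ring.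
  rewrite cos_plus, cos_minus. field.
Qed.

Lemma tnorm_tmul1 a n phi q : tnorm (tmul1 a n phi q) = Rabs a * tnorm q.
Proof.
  induction q as [|[[b m] psi] q IH]; simpl; [ring|]. rewrite IH.
  unfold Rdiv. rewrite !Rabs_mult, (Rabs_pos_eq (/ 2)) by lra. field.
Qed.

Lemma tdeg_tmul1 N M a n phi q :
  Rabs (IZR n) <= N -> tdeg M q -> tdeg (N + M) (tmul1 a n phi q).
Proof.
  intros Hn. induction q as [|[[b m] psi] q IH]; simpl; [easy|]. intros [H1 H2].
  rewrite plus_IZR, minus_IZR. repeat split; [| |now apply IH].
  - eapply Rle_trans; [apply Rabs_triang|]. lra.
  - unfold Rminus. eapply Rle_trans; [apply Rabs_triang|]. rewrite Rabs_Ropp. lra.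
Qed.

Lemma teval_tmul p q x : teval (tmul p q) x = teval p x * teval q x.
Proof.
  induction p as [|[[a n] phi] p IH]; simpl; [ring|].
  rewrite teval_app, IH, teval_tmul1. ring.
Qed.

Lemma tnorm_tmul p q : tnorm (tmul p q) = tnorm p * tnorm q.
Proof.
  induction p as [|[[a n] phi] p IH]; simpl; [ring|].
  rewrite tnorm_app, IH, tnorm_tmul1. ring.
Qed.

Lemma tdeg_tmul N M p q : tdeg N p -> tdeg M q -> tdeg (N + M) (tmul p q).
Proof.
  induction p as [|[[a n] phi] p IH]; simpl; [easy|]. intros [H1 H2] Hq.
  apply tdeg_app; [now apply tdeg_tmul1|auto].
Qed.

Lemma teval_periodic p : periodic (teval p).
Proof.
  intros x. induction p as [|[[a n] phi] p IH]; simpl; [easy|]. rewrite IH. do 2 f_equal.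
  destruct (Z_le_gt_dec 0 n) as [H|H].
  - rewrite <- (cos_period (2 * PI * IZR n * x + phi) (Z.to_nat n)). f_equal.
    rewrite INR_IZR_INZ, Z2Nat.id by lia. ring.
  - rewrite <- (cos_period (2 * PI * IZR n * (x + 1) + phi) (Z.to_nat (- n))). f_equal.
    rewrite INR_IZR_INZ, Z2Nat.id, opp_IZR by lia. ring.
Qed.

Lemma teval_tsum f n x : teval (tsum f n) x = sum_f_R0 (fun i => teval (f i) x) n.
Proof. induction n as [|n IH]; simpl; [easy|]. now rewrite teval_app, IH. Qed.

Lemma tnorm_tsum f n : tnorm (tsum f n) = sum_f_R0 (fun i => tnorm (f i)) n.
Proof. induction n as [|n IH]; simpl; [easy|]. now rewrite tnorm_app, IH. Qed.

Lemma tdeg_tsum N f n : (forall i, (i <= n)%nat -> tdeg N (f i)) -> tdeg N (tsum f n).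
Proof.
  intros H. induction n as [|n IH]; simpl; [now apply H|].
  apply tdeg_app; [apply IH; intros; apply H; lia|now apply H].
Qed.

Lemma tsum_ext f g n : (forall i, (i <= n)%nat -> f i = g i) -> tsum f n = tsum g n.
Proof.
  intros H. induction n as [|n IH]; simpl; [now apply H|].
  rewrite IH by (intros; apply H; lia). now rewrite H.
Qed.

Definition tconv (s t : nat -> tpoly) (k : nat) : tpoly :=
  tsum (fun i => tmul (s i) (t (k - i)%nat)) k.

Lemma teval_tconv s t k x :
  teval (tconv s t k) x = PS_mult (fun i => teval (s i) x) (fun i => teval (t i) x) k.
Proof.
  unfold tconv, PS_mult. rewrite teval_tsum. apply sum_eq. intros i _. apply teval_tmul.
Qed.

(** * A majorant sequence stable under convolution *)

Definition inv_sq (k : nat) : R := / (INR k + 1) ^ 2.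

Lemma inv_sq_pos k : 0 < inv_sq k.
Proof. apply Rinv_0_lt_compat, pow_lt. pose proof (pos_INR k). lra. Qed.

Lemma inv_sq_le_1 k : inv_sq k <= 1.
Proof.
  unfold inv_sq. rewrite <- Rinv_1. apply Rinv_le_contravar; [lra|].
  pose proof (pos_INR k). nra.
Qed.

Lemma inv_sq_succ k : inv_sq k <= 4 * inv_sq (S k).
Proof.
  unfold inv_sq. rewrite S_INR. pose proof (pos_INR k) as H. set (y := INR k) in *.
  replace (4 * / (y + 1 + 1) ^ 2) with (/ ((y + 2) / 2) ^ 2) by (field; lra).
  apply Rinv_le_contravar; [apply pow_lt; lra|]. apply pow_incr. lra.
Qed.

(** Telescoping, since 1 / (n + 2)^2 is at most 1 / (n + 1) - 1 / (n + 2). *)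
Lemma sum_inv_sq n : sum_f_R0 inv_sq n <= 2 - / (INR n + 1).
Proof.
  induction n as [|n IH].
  - unfold inv_sq. simpl. lra.
  - change (sum_f_R0 inv_sq n + / (INR (S n) + 1) ^ 2 <= 2 - / (INR (S n) + 1)).
    rewrite !S_INR. pose proof (pos_INR n) as H. set (y := INR n) in *.
    assert (/ (y + 1 + 1) ^ 2 <= / (y + 1) - / (y + 1 + 1)); [|lra].
    replace (/ (y + 1) - / (y + 1 + 1)) with (/ ((y + 1) * (y + 2))) by (field; lra).
    apply Rinv_le_contravar; nra.
Qed.

(** With a = i + 1 and b = k - i + 1 this is (a + b)^2 <= 2 (a^2 + b^2), followed by a + b = k + 2
    >= k + 1. *)
Lemma inv_sq_split i k : (i <= k)%nat ->
  inv_sq i * inv_sq (k - i) <= 2 * inv_sq k * (inv_sq i + inv_sq (k - i)).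
Proof.
  intros H. unfold inv_sq. rewrite minus_INR by easy.
  pose proof (pos_INR i) as Hi. pose proof (le_INR _ _ H) as Hk.
  set (a := INR i + 1). set (b := INR k - INR i + 1).
  replace (INR k) with (a + b - 2) by (unfold a, b; ring).
  assert (0 < a) by (unfold a; lra). assert (0 < b) by (unfold b; lra).
  assert (1 <= a) by (unfold a; lra). assert (1 <= b) by (unfold b; lra).
  apply Rle_trans with (2 * / (a + b) ^ 2 * (/ a ^ 2 + / b ^ 2)).
  - replace (/ a ^ 2 * / b ^ 2) with ((a + b) ^ 2 * / (a ^ 2 * b ^ 2 * (a + b) ^ 2))
      by (field; lra).
    replace (2 * / (a + b) ^ 2 * (/ a ^ 2 + / b ^ 2))
      with (2 * (a ^ 2 + b ^ 2) * / (a ^ 2 * b ^ 2 * (a + b) ^ 2)) by (field; lra).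
    apply Rmult_le_compat_r; [|pose proof (pow2_ge_0 (a - b)); simpl in *; lra].
    apply Rlt_le, Rinv_0_lt_compat. apply Rmult_lt_0_compat; [apply Rmult_lt_0_compat|]; apply pow_lt; lra.
  - apply Rmult_le_compat_r.
    + apply Rlt_le, Rplus_lt_0_compat; apply Rinv_0_lt_compat, pow_lt; lra.
    + apply Rmult_le_compat_l; [lra|]. apply Rinv_le_contravar; [apply pow_lt; lra|].
      apply pow_incr. lra.
Qed.

Lemma sum_f_R0_rev f k : sum_f_R0 (fun i => f (k - i)%nat) k = sum_f_R0 f k.
Proof.
  induction k as [|k IH]; [easy|].
  rewrite decomp_sum by lia. rewrite Nat.sub_0_r. simpl pred.
  rewrite (sum_eq (fun i => f (S k - S i)%nat) (fun i => f (k - i)%nat)).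
  - rewrite IH. simpl. ring.
  - intros i _. now rewrite Nat.sub_succ.
Qed.

(** The 8 is the factor 2 of [inv_sq_split] times two sums, each at most 2. *)
Lemma conv_inv_sq k : sum_f_R0 (fun i => inv_sq i * inv_sq (k - i)) k <= 8 * inv_sq k.
Proof.
  eapply Rle_trans.
  - apply sum_Rle. intros i Hi. now apply inv_sq_split.
  - rewrite (sum_eq _ (fun i => (inv_sq i + inv_sq (k - i)) * (2 * inv_sq k))) by (intros; ring).
    rewrite <- scal_sum, sum_plus, (sum_f_R0_rev inv_sq).
    pose proof (sum_inv_sq k) as H. pose proof (inv_sq_pos k).
    assert (0 < / (INR k + 1)) by (apply Rinv_0_lt_compat; pose proof (pos_INR k); lra).
    nra.
Qed.

Lemma tnorm_tconv s t S T K k : 0 <= K -> 0 <= S -> 0 <= T ->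
  (forall i, (i <= k)%nat -> tnorm (s i) <= S * (inv_sq i * K ^ i)) ->
  (forall i, (i <= k)%nat -> tnorm (t i) <= T * (inv_sq i * K ^ i)) ->
  tnorm (tconv s t k) <= 8 * S * T * (inv_sq k * K ^ k).
Proof.
  intros HK HS HT Hs Ht. unfold tconv. rewrite tnorm_tsum.
  eapply Rle_trans.
  - apply (sum_Rle _ (fun i => inv_sq i * inv_sq (k - i) * (S * T * K ^ k))).
    intros i Hi. rewrite tnorm_tmul.
    replace (K ^ k) with (K ^ i * K ^ (k - i)) by (rewrite <- pow_add; f_equal; lia).
    replace (inv_sq i * inv_sq (k - i) * (S * T * (K ^ i * K ^ (k - i))))
      with (S * (inv_sq i * K ^ i) * (T * (inv_sq (k - i) * K ^ (k - i)))) by ring.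
    apply Rmult_le_compat; [apply tnorm_pos|apply tnorm_pos|now apply Hs|apply Ht; lia].
  - rewrite <- scal_sum.
    replace (8 * S * T * (inv_sq k * K ^ k)) with (S * T * K ^ k * (8 * inv_sq k)) by ring.
    apply Rmult_le_compat_l; [|apply conv_inv_sq].
    repeat apply Rmult_le_pos; try easy. now apply pow_le.
Qed.

Lemma tdeg_tconv s t p q N k :
  (forall i, (i <= k)%nat -> tdeg (p i) (s i)) ->
  (forall i, (i <= k)%nat -> tdeg (q i) (t i)) ->
  (forall i, (i <= k)%nat -> p i + q (k - i)%nat <= N) -> tdeg N (tconv s t k).
Proof.
  intros Hs Ht HN. apply tdeg_tsum. intros i Hi.
  apply tdeg_mono with (p i + q (k - i)%nat); [now apply HN|].
  apply tdeg_tmul; [now apply Hs|apply Ht; lia].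
Qed.

Lemma tconv_ext s t s' t' k :
  (forall i, (i <= k)%nat -> s i = s' i) -> (forall i, (i <= k)%nat -> t i = t' i) ->
  tconv s t k = tconv s' t' k.
Proof.
  intros Hs Ht. apply tsum_ext. intros i Hi. rewrite Hs, Ht by lia. easy.
Qed.

(** * Power series in time with coefficients depending on x *)

Lemma CV_radius_geom a C L t :
  0 < L -> (forall k, Rabs (a k) <= C * L ^ k) -> Rabs t * L < 1 ->
  Rbar_lt (Rabs t) (CV_radius a).
Proof.
  intros HL Ha Ht. apply Rbar_lt_le_trans with (/ L).
  - simpl. apply (Rmult_lt_reg_r L); [easy|]. rewrite Rinv_l; lra.
  - apply (proj1 (CV_radius_bounded a)). exists C. intros k.
    rewrite Rabs_mult, <- RPow_abs, Rabs_inv, (Rabs_pos_eq L), pow_inv by lra.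
    apply (Rmult_le_reg_r (L ^ k)); [now apply pow_lt|].
    rewrite Rmult_assoc, Rinv_l, Rmult_1_r; [apply Ha|]. apply pow_nonzero. lra.
Qed.

Lemma ex_pseries_geom a C L t :
  0 < L -> (forall k, Rabs (a k) <= C * L ^ k) -> Rabs t * L < 1 -> ex_pseries a t.
Proof.
  intros HL Ha Ht. apply CV_radius_inside. now apply CV_radius_geom with C L.
Qed.

Lemma PSeries_geom a C L t :
  0 < L -> (forall k, Rabs (a k) <= C * L ^ k) -> Rabs t * L < 1 ->
  Rabs (PSeries a t) <= C * / (1 - Rabs t * L).
Proof.
  intros HL Ha Ht.
  assert (Hq : Rabs (Rabs t * L) < 1).
  { rewrite Rabs_pos_eq; [easy|]. apply Rmult_le_pos; [apply Rabs_pos|lra]. }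
  rewrite <- (Series_geom _ Hq), <- Series_scal_l.
  assert (Hle : forall k, 0 <= Rabs (a k * t ^ k) <= C * (Rabs t * L) ^ k).
  { intros k. split; [apply Rabs_pos|].
    rewrite Rabs_mult, <- RPow_abs, Rpow_mult_distr.
    replace (C * (Rabs t ^ k * L ^ k)) with (C * L ^ k * Rabs t ^ k) by ring.
    apply Rmult_le_compat_r; [apply pow_le, Rabs_pos|apply Ha]. }
  assert (Hex : ex_series (fun k => C * (Rabs t * L) ^ k)).
  { apply (ex_series_scal_l C (fun k => (Rabs t * L) ^ k)). now apply ex_series_geom. }
  unfold PSeries. eapply Rle_trans.
  - apply Series_Rabs. apply (ex_series_le (fun k => Rabs (a k * t ^ k)) (fun k => C * (Rabs t * L) ^ k)); [|exact Hex].
    intros k. change (Rabs (Rabs (a k * t ^ k)) <= C * (Rabs t * L) ^ k).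
    rewrite Rabs_Rabsolu. apply Hle.
  - now apply Series_le.
Qed.

(** The tool for differentiating a series in x term by term: quadratic remainders of the
    coefficients can be summed. *)
Lemma is_derive_quadratic (f : R -> R) x l M :
  (forall y, Rabs (f y - f x - (y - x) * l) <= M * (y - x) ^ 2) -> is_derive f x l.
Proof.
  intros H. apply is_derive_Reals. intros eps Heps.
  assert (HM : 0 < Rabs M + 1) by (pose proof (Rabs_pos M); lra).
  assert (Hd : 0 < eps / (Rabs M + 1)) by now apply Rdiv_lt_0_compat.
  exists (mkposreal _ Hd). intros h Hh0 Hh. simpl in Hh.
  specialize (H (x + h)). replace (x + h - x) with h in H by ring.
  replace ((f (x + h) - f x) / h - l) with ((f (x + h) - f x - h * l) / h) by (field; easy).
  unfold Rdiv. rewrite Rabs_mult, Rabs_inv.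
  pose proof (Rabs_pos_lt h Hh0) as Hp.
  apply (Rmult_lt_reg_r (Rabs h)); [easy|].
  rewrite Rmult_assoc, Rinv_l, Rmult_1_r by lra.
  eapply Rle_lt_trans; [exact H|].
  replace (M * h ^ 2) with (M * Rabs h * Rabs h)
    by (rewrite <- (pow2_abs h); ring).
  apply Rmult_lt_compat_r; [easy|].
  apply Rle_lt_trans with (Rabs M * Rabs h).
  - apply Rmult_le_compat_r; [lra|apply Rle_abs].
  - apply Rle_lt_trans with ((Rabs M + 1) * Rabs h); [lra|].
    apply Rlt_le_trans with ((Rabs M + 1) * (eps / (Rabs M + 1))).
    + now apply Rmult_lt_compat_l.
    + right. field. lra.
Qed.

(* [e n k] is the [n]-th derivative of the coefficient of [t^k]. *)
Definition analytic (K : R) (e : nat -> nat -> R -> R) : Prop :=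
  (forall n k x, is_derive (e n k) x (e (S n) k x)) /\
  (forall n L, K < L -> exists C, forall k x, Rabs (e n k x) <= C * L ^ k).

Definition dcoef (e : nat -> nat -> R -> R) (n k : nat) (x : R) : R :=
  INR (S k) * e n (S k) x.

Definition evalt (e : nat -> nat -> R -> R) (n : nat) (t x : R) : R :=
  PSeries (fun k => e n k x) t.

(** Bernoulli's inequality for (1 + q)^k with 1 + q = L / K: every rate above K absorbs a factor k +
    1. *)
Lemma succ_le_geom K L : 0 < K -> K < L -> exists C, 0 < C /\ forall k, INR (S k) * K ^ k <= C * L ^ k.
Proof.
  intros HK HL. set (q := L / K - 1).
  assert (Hq : 0 < q).
  { unfold q. apply Rlt_0_minus. apply (Rmult_lt_reg_r K); [easy|]. unfold Rdiv.
    rewrite Rmult_assoc, Rinv_l; lra. }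
  assert (Hi : 0 < / q) by now apply Rinv_0_lt_compat.
  exists (1 + / q). split; [lra|]. intros k.
  replace (L ^ k) with ((1 + q) ^ k * K ^ k).
  - rewrite <- Rmult_assoc. apply Rmult_le_compat_r; [apply pow_le; lra|].
    pose proof (poly k q Hq) as Hb. rewrite S_INR.
    pose proof (pos_INR k).
    apply Rle_trans with ((1 + / q) * (1 + INR k * q)).
    + replace ((1 + / q) * (1 + INR k * q)) with (1 + INR k + (INR k * q + / q))
        by (field; lra).
      assert (0 <= INR k * q) by (apply Rmult_le_pos; lra). lra.
    + apply Rmult_le_compat_l; lra.
  - rewrite <- Rpow_mult_distr. f_equal. unfold q. field. lra.
Qed.

(** The midpoint of K and L bounds the coefficients, and the gap up to L absorbs the factor k + 1.
    Stability under this loss is the reason for asking for bounds at all rates above K instead of at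
    K itself. *)
Lemma analytic_dcoef K e : 0 < K -> analytic K e -> analytic K (dcoef e).
Proof.
  intros HK [HD HB]. split.
  - intros n k x. unfold dcoef. apply (is_derive_scal (e n (S k))), HD.
  - intros n L HL. destruct (HB n ((K + L) / 2)) as [C HC]; [lra|].
    destruct (succ_le_geom ((K + L) / 2) L) as [C' [HC' H']]; [lra|lra|].
    assert (C0 : 0 <= C).
    { pose proof (HC 0%nat 0). pose proof (Rabs_pos (e n 0%nat 0)). simpl in *. lra. }
    exists (C * ((K + L) / 2) * C'). intros k x. unfold dcoef.
    rewrite Rabs_mult, (Rabs_pos_eq (INR (S k))) by apply pos_INR.
    apply Rle_trans with (INR (S k) * (C * ((K + L) / 2) ^ S k)).
    + apply Rmult_le_compat_l; [apply pos_INR|apply HC].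
    + replace (INR (S k) * (C * ((K + L) / 2) ^ S k))
        with (C * ((K + L) / 2) * (INR (S k) * ((K + L) / 2) ^ k)) by (simpl; ring).
      rewrite (Rmult_assoc _ C'). apply Rmult_le_compat_l; [|apply H'].
      apply Rmult_le_pos; lra.
Qed.

Lemma analytic_rate K t : 0 < K -> Rabs t * K < 1 -> exists L, K < L /\ Rabs t * L < 1.
Proof.
  intros HK Ht. pose proof (Rabs_pos t) as Hp.
  assert (H1 : 0 < Rabs t + 1) by lra.
  exists (K + (1 - Rabs t * K) / (2 * (Rabs t + 1))). 
  assert (H : 0 < (1 - Rabs t * K) / (2 * (Rabs t + 1))) by (apply Rdiv_lt_0_compat; lra).
  split; [lra|].
  assert (Rabs t * ((1 - Rabs t * K) / (2 * (Rabs t + 1))) <= (1 - Rabs t * K) / 2); [|lra].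
  replace ((1 - Rabs t * K) / 2)
    with ((Rabs t + 1) * ((1 - Rabs t * K) / (2 * (Rabs t + 1)))) by (field; lra).
  apply Rmult_le_compat_r; lra.
Qed.

Lemma is_derive_lipschitz (f f' : R -> R) M x y :
  (forall z, is_derive f z (f' z)) -> (forall z, Rabs (f' z) <= M) ->
  Rabs (f y - f x) <= M * Rabs (y - x).
Proof.
  intros Hf HM.
  destruct (MVT_gen f x y f') as [c [_ Hc]].
  - intros z _. apply Hf.
  - intros z _. apply continuity_pt_filterlim, @ex_derive_continuous. eexists. apply Hf.
  - rewrite Hc, Rabs_mult. apply Rmult_le_compat_r; [apply Rabs_pos|apply HM].
Qed.

Lemma is_derive_taylor (f f' f'' : R -> R) M x y :
  (forall z, is_derive f z (f' z)) -> (forall z, is_derive f' z (f'' z)) ->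
  (forall z, Rabs (f'' z) <= M) ->
  Rabs (f y - f x - (y - x) * f' x) <= M * (y - x) ^ 2.
Proof.
  intros Hf Hf' HM.
  assert (M0 : 0 <= M) by (pose proof (HM 0); pose proof (Rabs_pos (f'' 0)); lra).
  destruct (MVT_gen f x y f') as [c [Hc1 Hc]].
  - intros z _. apply Hf.
  - intros z _. apply continuity_pt_filterlim, @ex_derive_continuous. eexists. apply Hf.
  - rewrite Hc. replace (f' c * (y - x) - (y - x) * f' x) with ((f' c - f' x) * (y - x)) by ring.
    rewrite Rabs_mult.
    replace (M * (y - x) ^ 2) with (M * Rabs (y - x) * Rabs (y - x))
      by (rewrite <- (pow2_abs (y - x)); ring).
    apply Rmult_le_compat_r; [apply Rabs_pos|].
    eapply Rle_trans; [now apply (is_derive_lipschitz f' f'' M)|].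
    apply Rmult_le_compat_l; [easy|].
    unfold Rmin, Rmax in Hc1. destruct (Rle_dec x y); unfold Rabs;
      destruct (Rcase_abs (c - x)), (Rcase_abs (y - x)); lra.
Qed.

Lemma evalt_derive_t K e n t x : 0 < K -> analytic K e -> Rabs t * K < 1 ->
  is_derive (fun s => evalt e n s x) t (evalt (dcoef e) n t x).
Proof.
  intros HK [HD HB] Ht. destruct (analytic_rate K t HK Ht) as [L [HL1 HL2]].
  destruct (HB n L HL1) as [C HC].
  apply (is_derive_PSeries (fun k => e n k x)).
  apply CV_radius_geom with C L; [lra|intros k; apply HC|easy].
Qed.

Lemma evalt_lipschitz_x K e n L t : 0 < K -> analytic K e -> K < L -> Rabs t * L < 1 ->
  exists M, forall s x y, Rabs s <= Rabs t ->
    Rabs (evalt e n s y - evalt e n s x) <= M * Rabs (y - x).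
Proof.
  intros HK [HD HB] HL Ht.
  destruct (HB n L HL) as [C HC]. destruct (HB (S n) L HL) as [C1 HC1].
  assert (P1 : 0 <= C1).
  { pose proof (HC1 0%nat 0). pose proof (Rabs_pos (e (S n) 0%nat 0)). simpl in *. lra. }
  exists (C1 * / (1 - Rabs t * L)). intros s x y Hs.
  assert (HsL : Rabs s * L <= Rabs t * L) by (apply Rmult_le_compat_r; lra).
  unfold evalt. rewrite <- PSeries_minus;
    [|apply ex_pseries_geom with C L; [lra|intros; apply HC|lra]
     |apply ex_pseries_geom with C L; [lra|intros; apply HC|lra]].
  apply Rle_trans with (C1 * Rabs (y - x) * / (1 - Rabs s * L)).
  - apply PSeries_geom; [lra| |lra]. intros k.
    change (Rabs (e n k y - e n k x) <= C1 * Rabs (y - x) * L ^ k).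
    replace (C1 * Rabs (y - x) * L ^ k) with (C1 * L ^ k * Rabs (y - x)) by ring.
    apply (is_derive_lipschitz (e n k) (e (S n) k)); [apply HD|intros; apply HC1].
  - replace (C1 * / (1 - Rabs t * L) * Rabs (y - x))
      with (C1 * Rabs (y - x) * / (1 - Rabs t * L)) by ring.
    apply Rmult_le_compat_l; [apply Rmult_le_pos; [easy|apply Rabs_pos]|].
    apply Rinv_le_contravar; lra.
Qed.

(** The Taylor remainder of the k-th coefficient is at most C2 L^k (y - x)^2; summing over k gives
    the estimate that [is_derive_quadratic] asks for. *)
Lemma evalt_derive_x K e n t x : 0 < K -> analytic K e -> Rabs t * K < 1 ->
  is_derive (evalt e n t) x (evalt e (S n) t x).
Proof.
  intros HK [HD HB] Ht. destruct (analytic_rate K t HK Ht) as [L [HL1 HL2]].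
  destruct (HB n L HL1) as [C HC]. destruct (HB (S n) L HL1) as [C1 HC1].
  destruct (HB (S (S n)) L HL1) as [C2 HC2].
  assert (X : forall y, ex_pseries (fun k => e n k y) t)
    by (intros y; apply ex_pseries_geom with C L; [lra|intros; apply HC|lra]).
  assert (X1 : ex_pseries (fun k => e (S n) k x) t)
    by (apply ex_pseries_geom with C1 L; [lra|intros; apply HC1|lra]).
  apply (is_derive_quadratic _ _ _ (C2 * / (1 - Rabs t * L))). intros y.
  unfold evalt. rewrite <- PSeries_scal.
  rewrite <- PSeries_minus by apply X.
  rewrite <- PSeries_minus; [|now apply ex_pseries_minus|].
  2:{ apply ex_pseries_scal; [exact (Rmult_comm _ _)|exact X1]. }
  replace (C2 * / (1 - Rabs t * L) * (y - x) ^ 2)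
    with (C2 * (y - x) ^ 2 * / (1 - Rabs t * L)) by ring.
  apply PSeries_geom; [lra| |lra]. intros k.
  change (Rabs (e n k y - e n k x - (y - x) * e (S n) k x) <= C2 * (y - x) ^ 2 * L ^ k).
  replace (C2 * (y - x) ^ 2 * L ^ k) with (C2 * L ^ k * (y - x) ^ 2) by ring.
  apply (is_derive_taylor (e n k) (e (S n) k) (e (S (S n)) k)); [apply HD|apply HD|].
  intros; apply HC2.
Qed.

(** Continuity in t at fixed x combines with a Lipschitz bound in x that is uniform over nearby
    times. The radius r lies halfway between |t| and 1 / K, which leaves room for those times. *)
Lemma evalt_continuity K e n t x : 0 < K -> analytic K e -> Rabs t * K < 1 ->
  continuity_2d_pt (evalt e n) t x.
Proof.
  intros HK He Ht.
  assert (Hr : exists r, Rabs t < Rabs r /\ Rabs r * K < 1).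
  { exists ((Rabs t + / K) / 2). pose proof (Rabs_pos t).
    assert (Rabs t < / K).
    { apply (Rmult_lt_reg_r K); [easy|]. rewrite Rinv_l; lra. }
    rewrite (Rabs_pos_eq (_ / 2)) by lra. split; [lra|].
    replace ((Rabs t + / K) / 2 * K) with ((Rabs t * K + 1) / 2) by (field; lra). lra. }
  destruct Hr as [r [Hr1 Hr2]].
  destruct (analytic_rate K r HK Hr2) as [L [HL1 HL2]].
  destruct (evalt_lipschitz_x K e n L r HK He HL1 HL2) as [M HM].
  assert (M0 : 0 <= M).
  { specialize (HM r 0 1 (Rle_refl _)). rewrite Rminus_0_r, Rabs_R1, Rmult_1_r in HM.
    eapply Rle_trans; [apply Rabs_pos|exact HM]. }
  pose proof (evalt_derive_t K e n t x HK He Ht) as Hd.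
  assert (Hc : continuous (fun s => evalt e n s x) t)
    by (apply @ex_derive_continuous; eexists; exact Hd).
  intros eps.
  assert (He2 : 0 < eps / 2) by (apply Rdiv_lt_0_compat; [apply cond_pos|lra]).
  destruct (Hc (ball (evalt e n t x) (mkposreal _ He2)) (locally_ball _ _)) as [d1 Hd1].
  assert (Hd2 : 0 < eps / (2 * (M + 1))) by (apply Rdiv_lt_0_compat; [apply cond_pos|lra]).
  assert (Hd3 : 0 < Rmin d1 (Rmin (eps / (2 * (M + 1))) (Rabs r - Rabs t)))
    by (repeat apply Rmin_pos; [apply cond_pos|easy|lra]).
  exists (mkposreal _ Hd3). simpl. intros s y Hs Hy.
  pose proof (Rmin_l d1 (Rmin (eps / (2 * (M + 1))) (Rabs r - Rabs t))).
  pose proof (Rmin_r d1 (Rmin (eps / (2 * (M + 1))) (Rabs r - Rabs t))).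
  pose proof (Rmin_l (eps / (2 * (M + 1))) (Rabs r - Rabs t)).
  pose proof (Rmin_r (eps / (2 * (M + 1))) (Rabs r - Rabs t)).
  assert (Hst : Rabs s <= Rabs r).
  { replace s with (t + (s - t)) by ring.
    eapply Rle_trans; [apply Rabs_triang|]. lra. }
  assert (A1 : Rabs (evalt e n s x - evalt e n t x) < eps / 2).
  { apply Hd1. change (Rabs (s - t) < d1). lra. }
  assert (A2 : Rabs (evalt e n s y - evalt e n s x) < eps / 2).
  { eapply Rle_lt_trans; [now apply HM|].
    apply Rle_lt_trans with ((M + 1) * Rabs (y - x)).
    - apply Rmult_le_compat_r; [apply Rabs_pos|lra].
    - apply Rlt_le_trans with ((M + 1) * (eps / (2 * (M + 1)))).
      + apply Rmult_lt_compat_l; lra.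
      + right. field. lra. }
  replace (evalt e n s y - evalt e n t x)
    with ((evalt e n s y - evalt e n s x) + (evalt e n s x - evalt e n t x)) by ring.
  eapply Rle_lt_trans; [apply Rabs_triang|]. lra.
Qed.

Lemma in_interval_sym e t : in_interval (Finite (- e)) (Finite e) t <-> Rabs t < e.
Proof.
  unfold in_interval. simpl. split.
  - intros [H1 H2]. now apply Rabs_def1.
  - intros H. apply Rabs_def2 in H. lra.
Qed.

Lemma analytic_jet K e : 0 < K -> analytic K e ->
  jet (Finite (- / K)) (Finite (/ K)) (fun m n => evalt (Nat.iter m dcoef e) n).
Proof.
  intros HK He m n t x Ht. apply in_interval_sym in Ht.
  assert (HtK : Rabs t * K < 1).
  { apply (Rmult_lt_reg_r (/ K)); [now apply Rinv_0_lt_compat|].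
    rewrite Rmult_assoc, Rinv_r, Rmult_1_r, Rmult_1_l by lra. easy. }
  assert (Hm : analytic K (Nat.iter m dcoef e)).
  { clear -HK He. induction m as [|m IH]; simpl; [easy|]. now apply analytic_dcoef. }
  split; [|split].
  - exact (evalt_derive_t K _ n t x HK Hm HtK).
  - exact (evalt_derive_x K _ n t x HK Hm HtK).
  - exact (evalt_continuity K _ n t x HK Hm HtK).
Qed.

(** * Cauchy-Kovalevskaya theorem for cubic systems *)

Ltac nonneg := repeat match goal with
  | |- 0 <= _ * _ => apply Rmult_le_pos
  | |- 0 <= _ ^ _ => apply pow_le
  end; lra.

(* A term [(g, b, c, d)] stands for [g w_b w_c (w_d)_x]. *)
Definition cubic (F : Type) : Type := list (R * F * F * F).

Fixpoint cubic_eval {F} (p : cubic F) (v v' : F -> R) : R :=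
  match p with
  | [] => 0
  | (g, b, c, d) :: p => g * (v b * v c * v' d) + cubic_eval p v v'
  end.

(** The coefficient of t^k of the right-hand side by Cauchy products, where [w i b] is the
    coefficient of t^i of the field b. *)
Fixpoint cubic_coef {F} (p : cubic F) (w : nat -> F -> tpoly) (k : nat) : tpoly :=
  match p with
  | [] => []
  | (g, b, c, d) :: p =>
      tscal g (tconv (tconv (fun i => w i b) (fun i => w i c)) (fun i => tder (w i d)) k)
      ++ cubic_coef p w k
  end.

Fixpoint cubic_norm {F} (p : cubic F) : R :=
  match p with [] => 0 | (g, _, _, _) :: p => Rabs g + cubic_norm p end.

Lemma cubic_coef_ext F (p : cubic F) w w' k :
  (forall i, (i <= k)%nat -> w i = w' i) -> cubic_coef p w k = cubic_coef p w' k.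
Proof.
  intros H. induction p as [|[[[g b] c] d] p IH]; simpl; [easy|]. rewrite IH. do 2 f_equal.
  apply tconv_ext; intros i Hi; [apply tconv_ext; intros j Hj|]; rewrite H by lia; easy.
Qed.


Definition ck_step {F} (rhs : F -> cubic F) (w : nat -> F -> tpoly) (k : nat) (a : F) : tpoly :=
  tscal (/ INR (S k)) (cubic_coef (rhs a) w k).

(** Course-of-values recursion in structural form, because coefficient k + 1 needs all earlier ones.
    Level k is meaningful for indices up to k; beyond them the newest coefficient is repeated as a
    filler. *)
Fixpoint ck_history {F} (rhs : F -> cubic F) (w0 : F -> tpoly) (k : nat) : nat -> F -> tpoly :=
  match k with
  | O => fun _ => w0
  | S k => fun j => if (j <=? k)%nat then ck_history rhs w0 k j
                    else ck_step rhs (ck_history rhs w0 k) k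
  end.

Definition ck_coef {F} (rhs : F -> cubic F) (w0 : F -> tpoly) (k : nat) : F -> tpoly :=
  ck_history rhs w0 k k.

Lemma ck_history_coef F (rhs : F -> cubic F) w0 k j :
  (j <= k)%nat -> ck_history rhs w0 k j = ck_coef rhs w0 j.
Proof.
  induction k as [|k IH]; intros Hj.
  - now replace j with O by lia.
  - unfold ck_coef. destruct (Nat.eq_dec j (S k)) as [->|Hne]; [easy|].
    cbn [ck_history]. destruct (Nat.leb_spec j k); [now apply IH|lia].
Qed.

Lemma ck_coef_succ F (rhs : F -> cubic F) w0 k a :
  ck_coef rhs w0 (S k) a = tscal (/ INR (S k)) (cubic_coef (rhs a) (ck_coef rhs w0) k).
Proof.
  unfold ck_coef at 1. cbn [ck_history]. destruct (Nat.leb_spec (S k) k); [lia|].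
  unfold ck_step. f_equal. apply cubic_coef_ext. intros i Hi. now apply ck_history_coef.
Qed.

(* The coefficient of [t^k] has degree at most d (2 k + 1), so that [x]-derivatives
   cost a factor O(k), which the factor k + 1 of the recursion absorbs. *)
Lemma cubic_coef_bound F (p : cubic F) w A d K k :
  0 <= A -> 0 <= d -> 0 <= K ->
  (forall i, (i <= k)%nat -> forall a, tnorm (w i a) <= A * (inv_sq i * K ^ i)) ->
  (forall i, (i <= k)%nat -> forall a, tdeg (d * (2 * INR i + 1)) (w i a)) ->
  tnorm (cubic_coef p w k)
    <= cubic_norm p * (8 * (8 * A * A) * (2 * PI * (d * (2 * INR k + 1)) * A) * (inv_sq k * K ^ k))
  /\ tdeg (d * (2 * INR (S k) + 1)) (cubic_coef p w k).
Proof.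
  intros HA Hd HK Hn Hdeg. pose proof PI_RGT_0 as HPI.
  induction p as [|[[[g b] c] e] p [IH1 IH2]]; simpl cubic_coef.
  - simpl. split; [lra|easy].
  - split.
    + rewrite tnorm_app, tnorm_tscal. simpl cubic_norm. rewrite Rmult_plus_distr_r.
      apply Rplus_le_compat; [|exact IH1]. apply Rmult_le_compat_l; [apply Rabs_pos|].
      apply tnorm_tconv; [easy|nra| | |].
      * pose proof (pos_INR k). nonneg.
      * intros i Hi. apply tnorm_tconv; [easy|easy|easy| |]; intros j Hj; apply Hn; lia.
      * intros i Hi. eapply Rle_trans; [apply tnorm_tder, Hdeg, Hi|].
        rewrite (Rmult_assoc _ A). apply Rmult_le_compat; [|apply tnorm_pos| |now apply Hn].
        -- pose proof (pos_INR i). nonneg.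
        -- apply Rmult_le_compat_l; [lra|]. apply Rmult_le_compat_l; [easy|].
           apply le_INR in Hi. lra.
    + apply tdeg_app; [|exact IH2]. apply tdeg_tscal.
      (* Two factors of total index m have degree at most d (2 m + 2); the third factor raises this
         to d (2 k + 3), which is the bound for index k + 1. *)
      apply (tdeg_tconv _ _ (fun i => d * (2 * INR i + 2)) (fun i => d * (2 * INR i + 1))).
      * intros i Hi.
        apply (tdeg_tconv _ _ (fun i => d * (2 * INR i + 1)) (fun i => d * (2 * INR i + 1)));
          try (intros j Hj; apply Hdeg; lia).
        intros j Hj. rewrite minus_INR by easy. lra.
      * intros i Hi. apply tdeg_tder, Hdeg, Hi.
      * intros i Hi. rewrite minus_INR, S_INR by easy. lra.
Qed.

(** 1024 is 8 * 8 * 2 * 2 * 4: two convolutions, the 2 of 2 PI in a derivative, the 2 in the degree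
    bound 2 d (k + 1), and [inv_sq_succ]. A cubic term gives A^3, one factor of which belongs to the
    bound being proved; k + 1 cancels against the recursion. *)
Lemma ck_coef_bound F (rhs : F -> cubic F) w0 A d G K :
  0 <= A -> 0 <= d -> 0 <= G ->
  (forall a, tnorm (w0 a) <= A) -> (forall a, tdeg d (w0 a)) ->
  (forall a, cubic_norm (rhs a) <= G) -> 1024 * PI * G * d * A ^ 2 <= K -> 0 <= K ->
  forall k a, tnorm (ck_coef rhs w0 k a) <= A * (inv_sq k * K ^ k)
              /\ tdeg (d * (2 * INR k + 1)) (ck_coef rhs w0 k a).
Proof.
  intros HA Hd HG Hn Hdeg Hrhs HK HK0. pose proof PI_RGT_0 as HPI.
  assert (H : forall k j, (j <= k)%nat -> forall a,
     tnorm (ck_coef rhs w0 j a) <= A * (inv_sq j * K ^ j)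
     /\ tdeg (d * (2 * INR j + 1)) (ck_coef rhs w0 j a)).
  { induction k as [|k IH]; intros j Hj a.
    - replace j with O by lia. unfold ck_coef, inv_sq. simpl. split.
      + specialize (Hn a). lra.
      + replace (d * (2 * 0 + 1)) with d by ring. apply Hdeg.
    - destruct (Nat.eq_dec j (S k)) as [->|Hne]; [|apply IH; lia].
      rewrite ck_coef_succ.
      destruct (cubic_coef_bound F (rhs a) (ck_coef rhs w0) A d K k HA Hd HK0) as [H1 H2].
      + intros i Hi b. now apply IH.
      + intros i Hi b. now apply IH.
      + split; [|now apply tdeg_tscal].
        rewrite tnorm_tscal. pose proof (pos_INR k) as Hk.
        assert (HS : 0 < INR (S k)) by (rewrite S_INR; lra).
        rewrite Rabs_pos_eq by (apply Rlt_le, Rinv_0_lt_compat; lra).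
        apply (Rmult_le_reg_l (INR (S k))); [easy|].
        rewrite <- Rmult_assoc, Rinv_r, Rmult_1_l by lra.
        eapply Rle_trans; [exact H1|].
        pose proof (inv_sq_pos k) as Hq. pose proof (inv_sq_succ k) as Hq'.
        pose proof (pow_le K k HK0) as Hp.
        assert (E0 : 0 <= PI * d * A ^ 2 * A)
          by (nonneg).
        apply Rle_trans with (G * (8 * (8 * A * A) * (2 * PI * (d * (2 * INR (S k))) * A) * (4 * inv_sq (S k) * K ^ k))).
        * apply Rmult_le_compat; [| |apply Hrhs|].
          -- clear. induction (rhs a) as [|[[[g ?] ?] ?] p IH]; simpl; [lra|].
             pose proof (Rabs_pos g). lra.
          -- nonneg.
          -- apply Rmult_le_compat; [nonneg|apply Rmult_le_pos; lra| |].
             ++ rewrite S_INR.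
                replace (8 * (8 * A * A) * (2 * PI * (d * (2 * INR k + 1)) * A))
                  with (128 * (2 * INR k + 1) * (PI * d * A ^ 2 * A)) by ring.
                replace (8 * (8 * A * A) * (2 * PI * (d * (2 * (INR k + 1))) * A))
                  with (128 * (2 * INR k + 2) * (PI * d * A ^ 2 * A)) by ring.
                apply Rmult_le_compat_r; lra.
             ++ apply Rmult_le_compat_r; lra.
        * replace (G * (8 * (8 * A * A) * (2 * PI * (d * (2 * INR (S k))) * A) * (4 * inv_sq (S k) * K ^ k)))
            with (INR (S k) * (A * (inv_sq (S k) * K ^ k)) * (1024 * PI * G * d * A ^ 2)) by ring.
          replace (INR (S k) * (A * (inv_sq (S k) * K ^ S k)))
            with (INR (S k) * (A * (inv_sq (S k) * K ^ k)) * K) by (simpl; ring).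
          apply Rmult_le_compat_l; [|easy]. pose proof (inv_sq_pos (S k)).
          nonneg. }
  intros k a. now apply (H k k).
Qed.

Definition tpoly_family (s : nat -> tpoly) (n k : nat) (x : R) : R :=
  teval (Nat.iter n tder (s k)) x.

(** Each x-derivative costs the degree, which is O(k), and this is paid for by raising the rate from
    the midpoint of K and L to L. *)
Lemma tpoly_family_analytic s A d K : 0 < K -> 0 <= A -> 0 <= d ->
  (forall k, tnorm (s k) <= A * (inv_sq k * K ^ k)) ->
  (forall k, tdeg (d * (2 * INR k + 1)) (s k)) -> analytic K (tpoly_family s).
Proof.
  intros HK HA Hd Hn Hdeg. pose proof PI_RGT_0 as HPI. split.
  - intros n k x. apply teval_tder.
  - assert (D : forall n k, tdeg (d * (2 * INR k + 1)) (Nat.iter n tder (s k))).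
    { intros n k. induction n as [|n IH]; simpl; [apply Hdeg|now apply tdeg_tder]. }
    assert (H : forall n L, K < L -> exists C, 0 <= C /\
              forall k, tnorm (Nat.iter n tder (s k)) <= C * L ^ k).
    { induction n as [|n IH]; intros L HL.
      - exists A. split; [easy|]. intros k. eapply Rle_trans; [apply Hn|].
        apply Rmult_le_compat_l; [easy|]. rewrite <- (Rmult_1_l (L ^ k)).
        apply Rmult_le_compat; [apply Rlt_le, inv_sq_pos|apply pow_le; lra|apply inv_sq_le_1|].
        apply pow_incr. lra.
      - destruct (IH ((K + L) / 2)) as [C [C0 HC]]; [lra|].
        destruct (succ_le_geom ((K + L) / 2) L) as [C' [HC' H']]; [lra|lra|].
        exists (4 * PI * d * C * C'). split; [nonneg|].
        intros k. eapply Rle_trans; [apply (tnorm_tder _ _ (D n k))|].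
        pose proof (pos_INR k).
        apply Rle_trans with (2 * PI * (d * (2 * INR (S k))) * (C * ((K + L) / 2) ^ k)).
        + apply Rmult_le_compat; [nonneg|apply tnorm_pos| |apply HC].
          rewrite S_INR. apply Rmult_le_compat_l; [lra|]. apply Rmult_le_compat_l; lra.
        + replace (2 * PI * (d * (2 * INR (S k))) * (C * ((K + L) / 2) ^ k))
            with (4 * PI * d * C * (INR (S k) * ((K + L) / 2) ^ k)) by ring.
          rewrite (Rmult_assoc _ C'). apply Rmult_le_compat_l; [|apply H'].
          nonneg. }
    intros n L HL. destruct (H n L HL) as [C [_ HC]]. exists C. intros k x.
    eapply Rle_trans; [apply teval_bound|apply HC].
Qed.

Theorem cauchy_kovalevskaya F (rhs : F -> cubic F) (w0 : F -> tpoly) A d G :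
  0 <= A -> 0 <= d -> 0 <= G ->
  (forall a, tnorm (w0 a) <= A) -> (forall a, tdeg d (w0 a)) ->
  (forall a, cubic_norm (rhs a) <= G) ->
  exists T, 0 < T /\ exists D : F -> nat -> nat -> R -> R -> R,
    (forall a, jet (Finite (- T)) (Finite T) (D a)) /\
    (forall a x, D a 0%nat 0%nat 0 x = teval (w0 a) x) /\
    (forall a t, periodic (D a 0%nat 0%nat t)) /\
    (forall a t x, Rabs t < T ->
       D a 1%nat 0%nat t x
       = cubic_eval (rhs a) (fun b => D b 0%nat 0%nat t x) (fun b => D b 0%nat 1%nat t x)).
Proof.
  intros HA Hd HG Hn Hdeg Hrhs. pose proof PI_RGT_0 as HPI.
  (* The summand 1 keeps K positive even when G, d or A is 0; the time of existence is 1 / K. *)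
  pose (K := 1024 * PI * G * d * A ^ 2 + 1).
  assert (HK1 : 0 <= 1024 * PI * G * d * A ^ 2)
    by (nonneg).
  assert (HK : 0 < K) by (unfold K; lra).
  assert (B : forall k a, tnorm (ck_coef rhs w0 k a) <= A * (inv_sq k * K ^ k)
              /\ tdeg (d * (2 * INR k + 1)) (ck_coef rhs w0 k a)).
  { apply ck_coef_bound with G; try easy; unfold K; lra. }
  pose (e := fun a => tpoly_family (fun k => ck_coef rhs w0 k a)).
  assert (An : forall a, analytic K (e a)).
  { intros a. apply tpoly_family_analytic with A d; [easy|easy|easy| |]; intros k; apply B. }
  exists (/ K). split; [now apply Rinv_0_lt_compat|].
  exists (fun a m n => evalt (Nat.iter m dcoef (e a)) n).
  split; [|split; [|split]].
  - intros a. now apply analytic_jet.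
  - intros a x. unfold evalt. simpl. rewrite PSeries_0. reflexivity.
  - intros a t x. unfold evalt. simpl. apply PSeries_ext. intros k.
    unfold e, tpoly_family. simpl. apply teval_periodic.
  - intros a t x Ht. unfold evalt. simpl Nat.iter.
    assert (HtK : Rabs t * K < 1).
    { apply (Rmult_lt_reg_r (/ K)); [now apply Rinv_0_lt_compat|].
      rewrite Rmult_assoc, Rinv_r, Rmult_1_r, Rmult_1_l by lra. easy. }
    destruct (analytic_rate K t HK HtK) as [L [HL1 HL2]].
    assert (CV : forall b n, Rbar_lt (Rabs t) (CV_radius (fun k => e b n k x))).
    { intros b n. destruct (proj2 (An b) n L HL1) as [C HC].
      apply CV_radius_geom with C L; [lra|intros k; apply HC|easy]. }
    rewrite (PSeries_ext _ (fun k => teval (cubic_coef (rhs a) (ck_coef rhs w0) k) x)).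
    2:{ intros k. unfold dcoef, e, tpoly_family. simpl Nat.iter.
        rewrite ck_coef_succ, teval_tscal, <- Rmult_assoc, Rinv_r; [ring|].
        apply not_0_INR. lia. }
    apply is_pseries_unique.
    induction (rhs a) as [|[[[g b] c] f] p IH]; simpl.
    + apply (is_pseries_ext (fun k => 0 * e a 0%nat k x)); [intros k; real_eq; ring|].
      evar_last.
      * apply (is_pseries_scal 0 (fun k => e a 0%nat k x) t); [exact (Rmult_comm _ _)|].
        apply PSeries_correct, CV_radius_inside, CV.
      * apply Rmult_0_l.
    + apply (is_pseries_ext (fun k =>
        g * PS_mult (PS_mult (fun i => e b 0%nat i x) (fun i => e c 0%nat i x)) (fun i => e f 1%nat i x) k
        + teval (cubic_coef p (ck_coef rhs w0) k) x)).
      { intros k. rewrite teval_app, teval_tscal, teval_tconv. do 2 f_equal.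
        unfold PS_mult at 1 3. apply sum_eq. intros i _. now rewrite teval_tconv. }
      apply @is_pseries_plus; [|exact IH].
      refine (is_pseries_scal (K := R_AbsRing) (V := R_NormedModule) g _ t
        (PSeries _ t * PSeries _ t * PSeries _ t) (Rmult_comm _ _) _).
      apply is_pseries_mult; [apply is_pseries_mult| | |].
      * apply PSeries_correct, CV_radius_inside, CV.
      * apply PSeries_correct, CV_radius_inside, CV.
      * apply CV.
      * apply CV.
      * apply PSeries_correct, CV_radius_inside, CV.
      (* The inner Cauchy product also grows at most geometrically, since it is the evaluation of a
         [tconv] controlled by the majorant. *)
      * apply CV_radius_geom with (8 * A * A) L; [lra| |easy]. intros k.
        change (Rabs (PS_mult (fun i => teval (ck_coef rhs w0 i b) x)
                       (fun i => teval (ck_coef rhs w0 i c) x) k) <= 8 * A * A * L ^ k).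
        rewrite <- (teval_tconv (fun i => ck_coef rhs w0 i b) (fun i => ck_coef rhs w0 i c)).
        eapply Rle_trans; [apply teval_bound|].
        eapply Rle_trans.
        -- apply (tnorm_tconv _ _ A A K); [lra|easy|easy| |]; intros i _; apply B.
        -- apply Rmult_le_compat_l; [nra|]. rewrite <- (Rmult_1_l (L ^ k)).
           apply Rmult_le_compat; [apply Rlt_le, inv_sq_pos|apply pow_le; lra|apply inv_sq_le_1|].
           apply pow_incr. lra.
      * apply CV.
Qed.

(** * Smooth functions on a cylinder *)

(** A [jet] demands the whole array of partial derivatives at once, which is awkward for products
    and exponentials. This class grows order by order, so closure follows by induction;
    [smooth2_jet] leads back to arrays. *)
Fixpoint Cyl (t1 t2 : Rbar) (n : nat) (h : R -> R -> R) : Prop :=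
  (forall t x, in_interval t1 t2 t -> continuity_2d_pt h t x) /\
  match n with
  | O => True
  | S n => exists ht hx,
      (forall t x, in_interval t1 t2 t -> is_derive (fun s => h s x) t (ht t x)) /\
      (forall t x, in_interval t1 t2 t -> is_derive (h t) x (hx t x)) /\
      Cyl t1 t2 n ht /\ Cyl t1 t2 n hx
  end.

Definition smooth2 t1 t2 (h : R -> R -> R) : Prop := forall n, Cyl t1 t2 n h.

Lemma Cyl_continuity t1 t2 n h : Cyl t1 t2 n h ->
  forall t x, in_interval t1 t2 t -> continuity_2d_pt h t x.
Proof. destruct n; intros [H _]; exact H. Qed.

Lemma Cyl_mono t1 t2 n : forall h, Cyl t1 t2 (S n) h -> Cyl t1 t2 n h.
Proof.
  induction n as [|n IH]; intros h; [intros [H _]; now split|].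
  intros [HC [ht [hx [H1 [H2 [H3 H4]]]]]]. split; [exact HC|].
  exists ht, hx. split; [exact H1|split; [exact H2|split; now apply IH]].
Qed.

Lemma continuity_2d_ext_cyl t1 t2 h g t x :
  (forall t x, in_interval t1 t2 t -> h t x = g t x) -> in_interval t1 t2 t ->
  continuity_2d_pt h t x -> continuity_2d_pt g t x.
Proof.
  intros E Ht. apply continuity_2d_pt_ext_loc.
  destruct (in_interval_locally _ _ _ Ht) as [d Hd]. exists d.
  intros s y Hs _. apply E, Hd, Hs.
Qed.

Lemma is_derive_ext_cyl t1 t2 (h g : R -> R -> R) t x l :
  (forall t x, in_interval t1 t2 t -> h t x = g t x) -> in_interval t1 t2 t ->
  is_derive (fun s => h s x) t l -> is_derive (fun s => g s x) t l.
Proof.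
  intros E Ht. apply is_derive_ext_loc.
  generalize (in_interval_locally _ _ _ Ht). apply filter_imp. intros s Hs. now apply E.
Qed.

Lemma Cyl_ext t1 t2 n h g :
  (forall t x, in_interval t1 t2 t -> h t x = g t x) -> Cyl t1 t2 n h -> Cyl t1 t2 n g.
Proof.
  intros E H.
  assert (HC : forall t x, in_interval t1 t2 t -> continuity_2d_pt g t x).
  { intros t x Ht. apply (continuity_2d_ext_cyl t1 t2 h); [easy|easy|].
    now apply (Cyl_continuity t1 t2 n). }
  destruct n as [|n]; [now split|]. split; [exact HC|].
  destruct H as [_ [ht [hx [H1 [H2 [H3 H4]]]]]]. exists ht, hx.
  split; [|split; [|split; assumption]].
  - intros t x Ht. apply (is_derive_ext_cyl t1 t2 h); [easy|easy|now apply H1].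
  - intros t x Ht. apply (is_derive_ext (h t)); [|now apply H2]. intros y. now apply E.
Qed.

Lemma Cyl_plus t1 t2 n : forall h g, Cyl t1 t2 n h -> Cyl t1 t2 n g ->
  Cyl t1 t2 n (fun t x => h t x + g t x).
Proof.
  induction n as [|n IH]; intros h g Hh Hg;
    (split; [intros t x Ht; apply continuity_2d_pt_plus;
             eapply Cyl_continuity; eassumption|]); [exact I|].
  destruct Hh as [_ [ht [hx [H1 [H2 [H3 H4]]]]]], Hg as [_ [gt [gx [G1 [G2 [G3 G4]]]]]].
  exists (fun t x => ht t x + gt t x), (fun t x => hx t x + gx t x).
  split; [|split; [|split; now apply IH]].
  - intros t x Ht. apply (is_derive_plus (fun s => h s x) (fun s => g s x)); [now apply H1|now apply G1].
  - intros t x Ht. apply (is_derive_plus (h t) (g t)); [now apply H2|now apply G2].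
Qed.

Lemma Cyl_mult t1 t2 n : forall h g, Cyl t1 t2 n h -> Cyl t1 t2 n g ->
  Cyl t1 t2 n (fun t x => h t x * g t x).
Proof.
  induction n as [|n IH]; intros h g Hh Hg;
    (split; [intros t x Ht; apply continuity_2d_pt_mult;
             eapply Cyl_continuity; eassumption|]); [exact I|].
  pose proof (Cyl_mono _ _ _ _ Hh) as Hh'. pose proof (Cyl_mono _ _ _ _ Hg) as Hg'.
  destruct Hh as [_ [ht [hx [H1 [H2 [H3 H4]]]]]], Hg as [_ [gt [gx [G1 [G2 [G3 G4]]]]]].
  exists (fun t x => ht t x * g t x + h t x * gt t x), (fun t x => hx t x * g t x + h t x * gx t x).
  split; [|split; [|split; apply Cyl_plus; now apply IH]].
  - intros t x Ht. apply (is_derive_mult (fun s => h s x) (fun s => g s x));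
      [now apply H1|now apply G1|exact Rmult_comm].
  - intros t x Ht. apply (is_derive_mult (h t) (g t)); [now apply H2|now apply G2|exact Rmult_comm].
Qed.

Lemma Cyl_exp t1 t2 n : forall h, Cyl t1 t2 n h -> Cyl t1 t2 n (fun t x => exp (h t x)).
Proof.
  assert (C : forall h t x, continuity_2d_pt h t x -> continuity_2d_pt (fun t x => exp (h t x)) t x).
  { intros h t x H. apply continuity_1d_2d_pt_comp; [|exact H].
    apply derivable_continuous_pt, derivable_pt_exp. }
  induction n as [|n IH]; intros h Hh;
    (split; [intros t x Ht; apply C; eapply Cyl_continuity; eassumption|]); [exact I|].
  pose proof (Cyl_mono _ _ _ _ Hh) as Hh'.
  destruct Hh as [_ [ht [hx [H1 [H2 [H3 H4]]]]]].
  exists (fun t x => ht t x * exp (h t x)), (fun t x => hx t x * exp (h t x)).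
  split; [|split; [|split; apply Cyl_mult; auto]].
  - intros t x Ht. apply (is_derive_comp exp (fun s => h s x)); [apply is_derive_exp|now apply H1].
  - intros t x Ht. apply (is_derive_comp exp (h t)); [apply is_derive_exp|now apply H2].
Qed.

Lemma smooth2_mult t1 t2 h g :
  smooth2 t1 t2 h -> smooth2 t1 t2 g -> smooth2 t1 t2 (fun t x => h t x * g t x).
Proof. intros Hh Hg n. now apply Cyl_mult. Qed.

Lemma smooth2_exp t1 t2 h : smooth2 t1 t2 h -> smooth2 t1 t2 (fun t x => exp (h t x)).
Proof. intros Hh n. now apply Cyl_exp. Qed.

Lemma jet_smooth2 t1 t2 D m n : jet t1 t2 D -> smooth2 t1 t2 (D m n).
Proof.
  intros J k. revert m n.
  induction k as [|k IH]; intros m n; (split; [intros t x Ht; now apply J|]); [exact I|].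
  exists (D (S m) n), (D m (S n)).
  split; [intros; now apply J|split; [intros; now apply J|split; apply IH]].
Qed.

Definition dt (h : R -> R -> R) (t x : R) : R := Derive (fun s => h s x) t.
Definition dx (h : R -> R -> R) (t x : R) : R := Derive (h t) x.

Lemma smooth2_dt t1 t2 h : smooth2 t1 t2 h ->
  smooth2 t1 t2 (dt h) /\
  forall t x, in_interval t1 t2 t -> is_derive (fun s => h s x) t (dt h t x).
Proof.
  intros H. split.
  - intros n. destruct (H (S n)) as [_ [ht [hx [H1 [_ [H3 _]]]]]].
    apply (Cyl_ext t1 t2 n ht); [|exact H3].
    intros t x Ht. symmetry. apply is_derive_unique. now apply H1.
  - intros t x Ht. apply Derive_correct.
    destruct (H 1%nat) as [_ [ht [hx [H1 _]]]]. exists (ht t x). now apply H1.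
Qed.

Lemma smooth2_dx t1 t2 h : smooth2 t1 t2 h ->
  smooth2 t1 t2 (dx h) /\
  forall t x, in_interval t1 t2 t -> is_derive (h t) x (dx h t x).
Proof.
  intros H. split.
  - intros n. destruct (H (S n)) as [_ [ht [hx [_ [H2 [_ H4]]]]]].
    apply (Cyl_ext t1 t2 n hx); [|exact H4].
    intros t x Ht. symmetry. apply is_derive_unique. now apply H2.
  - intros t x Ht. apply Derive_correct.
    destruct (H 1%nat) as [_ [ht [hx [_ [H2 _]]]]]. exists (hx t x). now apply H2.
Qed.

Lemma smooth2_dt_dx t1 t2 h t x : smooth2 t1 t2 h -> in_interval t1 t2 t ->
  dx (dt h) t x = dt (dx h) t x.
Proof.
  intros H Ht.
  destruct (smooth2_dt _ _ _ H) as [S1 D1]. destruct (smooth2_dx _ _ _ H) as [S2 D2].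
  destruct (smooth2_dx _ _ _ S1) as [S3 D3]. destruct (smooth2_dt _ _ _ S2) as [S4 D4].
  symmetry. apply (Schwarz h t x).
  - destruct (in_interval_locally _ _ _ Ht) as [d Hd]. exists d. intros s y Hs _.
    specialize (Hd s Hs).
    split; [eexists; now apply D1|split; [eexists; now apply D2|split]].
    + eexists. now apply D4.
    + eexists. now apply D3.
  - exact (Cyl_continuity _ _ _ _ (S4 O) t x Ht).
  - exact (Cyl_continuity _ _ _ _ (S3 O) t x Ht).
Qed.

(** The array consists of m derivatives in t applied after n derivatives in x. Its t-derivative is
    immediate; the x-derivative has to be commuted past the t-derivatives by Schwarz's theorem. *)
Lemma smooth2_jet t1 t2 h : smooth2 t1 t2 h -> exists D, D 0%nat 0%nat = h /\ jet t1 t2 D.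
Proof.
  intros H.
  assert (Sx : forall n, smooth2 t1 t2 (Nat.iter n dx h)).
  { induction n as [|n IH]; simpl; [exact H|]. now apply smooth2_dx. }
  assert (Stx : forall m n, smooth2 t1 t2 (Nat.iter m dt (Nat.iter n dx h))).
  { intros m n. induction m as [|m IH]; simpl; [apply Sx|]. now apply smooth2_dt. }
  assert (Com : forall m n t x, in_interval t1 t2 t ->
    dx (Nat.iter m dt (Nat.iter n dx h)) t x = Nat.iter m dt (Nat.iter (S n) dx h) t x).
  { intros m n. induction m as [|m IH]; intros t x Ht; [easy|].
    simpl Nat.iter at 1. rewrite (smooth2_dt_dx t1 t2) by (try easy; apply Stx).
    change (dt (dx (Nat.iter m dt (Nat.iter n dx h))) t x
            = dt (Nat.iter m dt (Nat.iter (S n) dx h)) t x).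
    unfold dt at 1 3. apply Derive_ext_loc.
    generalize (in_interval_locally _ _ _ Ht). apply filter_imp. intros s Hs. now apply IH. }
  exists (fun m n => Nat.iter m dt (Nat.iter n dx h)). split; [easy|].
  intros m n t x Ht. split; [|split].
  - destruct (smooth2_dt _ _ _ (Stx m n)) as [_ D]. now apply D.
  - destruct (smooth2_dx _ _ _ (Stx m n)) as [_ D]. rewrite <- Com by easy. now apply D.
  - exact (Cyl_continuity _ _ _ _ (Stx m n O) t x Ht).
Qed.

(** * Geodesics with trigonometric polynomial initial data *)

(* The logarithms [fpi i] of the [u_i] and the velocities [fvel i] = c_i solve
   a cubic first-order system; [fone] is the constant 1, which makes it homogeneous. *)
Inductive field : Type := fone | fpi (i : idx) | fvel (i : idx).

(** The cyclic successor writes u / u_i as the product of the components at [nxt i] and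
    [nxt (nxt i)], without a case distinction. *)
Definition nxt (i : idx) : idx := match i with i1 => i2 | i2 => i3 | i3 => i1 end.

(** The first equation is (u_i)_t = (u_i c_i)_x divided by u_i. The second is the momentum balance
    for (u / u_i) c_i, expanded and divided by u / u_i, with the first equation substituted for the
    time derivatives of the logarithms. *)
Definition geodesic_rhs (a : field) : cubic field :=
  match a with
  | fone => []
  | fpi i => [(1, fone, fone, fvel i); (1, fone, fvel i, fpi i)]
  | fvel i =>
      let j := nxt i in let k := nxt j in
      [(1, fone, fvel i, fvel i);
       (-1, fone, fvel i, fvel j); (-1, fone, fvel j, fvel j);
       (-1, fone, fvel i, fvel k); (-1, fone, fvel k, fvel k);
       (-1, fvel i, fvel j, fpi j); (- / 2, fvel j, fvel j, fpi j);
       (- / 2, fvel k, fvel k, fpi j); (/ 2, fvel i, fvel i, fpi j);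
       (-1, fvel i, fvel k, fpi k); (- / 2, fvel j, fvel j, fpi k);
       (- / 2, fvel k, fvel k, fpi k); (/ 2, fvel i, fvel i, fpi k)]
  end.

(** Both left-hand sides are the time derivative of (u / u_i) c_i = A_i u_i c_i. The first form
    serves conservation of total momentum, the second the defect. The value 0 at [fpi] is a
    placeholder: logarithms enter the right-hand side only through their x-derivatives. *)
Lemma momentum_balance u c cx ct f i x : smooth3 u -> pos u ->
  (forall j, is_derive (c j) x (cx j)) ->
  (forall j, f j x = u j x * (cx j + Derive (u j) x / u j x * c j x)) ->
  ct = cubic_eval (geodesic_rhs (fvel i))
         (fun a => match a with fone => 1 | fpi j => 0 | fvel j => c j x end)
         (fun a => match a with fone => 0 | fpi j => Derive (u j) x / u j x
                              | fvel j => cx j end) ->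
  (f (nxt i) x * u (nxt (nxt i)) x + u (nxt i) x * f (nxt (nxt i)) x) * c i x
    + u (nxt i) x * u (nxt (nxt i)) x * ct = - Derive (flux u c i) x /\
  weightA u i x * (f i x * c i x + u i x * ct) + variationA u f i x * (u i x * c i x)
    = - Derive (flux u c i) x.
Proof.
  intros Su Hu Hc Hf ->.
  rewrite (is_derive_unique _ _ _ (flux_derive u c cx i x Su Hu Hc)).
  pose proof (Hu i1 x). pose proof (Hu i2 x). pose proof (Hu i3 x).
  unfold variationA, weightA, prod3, sum3. rewrite !Hf.
  destruct i; simpl; split; field; lra.
Qed.

(** Changing the antiderivative adds a constant, which the subtraction of the A_i-weighted mean
    removes. *)
Lemma opQ_primitive u i (Q g : R -> R) x : smooth3 u -> pos u ->
  (forall y, is_derive Q y (g y)) -> cts g ->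
  opQ u i g x = Q x - RInt (fun y => weightA u i y * Q y) 0 1 / RInt (weightA u i) 0 1.
Proof.
  intros Su Hu HQ Cg.
  assert (CA : cts (weightA u i)) by now apply smooth_cts, smooth_weightA.
  assert (CQ : cts Q) by now apply cts_of_derive with g.
  unfold opQ. rewrite (primitive_Derive Q g) by easy.
  rewrite (RInt_ext (fun y => weightA u i y * primitive g y)
             (fun y => weightA u i y * Q y - Q 0 * weightA u i y)).
  - rewrite int_minus, int_scal by (cts_rules; easy).
    real_eq. field. pose proof (int_weightA_pos u i Su Hu). lra.
  - intros y _. rewrite (primitive_Derive Q g) by easy. real_eq. ring.
Qed.

Lemma constant_on_interval (f : R -> R) T t :
  (forall s, Rabs s < T -> is_derive f s 0) -> Rabs t < T -> f t = f 0.
Proof.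
  intros H Ht.
  assert (B : forall s, Rmin 0 t <= s <= Rmax 0 t -> Rabs s < T).
  { intros s Hs. apply Rabs_def2 in Ht. apply Rabs_def1;
    unfold Rmin, Rmax in Hs; destruct (Rle_dec 0 t); lra. }
  destruct (MVT_gen f 0 t (fun _ => 0)) as [c [_ Hc]].
  - intros s Hs. apply H, B. lra.
  - intros s Hs. apply continuity_pt_filterlim, @ex_derive_continuous.
    eexists. apply H, B, Hs.
  - lra.
Qed.

Lemma tdeg_exists p : exists N, 0 <= N /\ tdeg N p.
Proof.
  induction p as [|[[a n] phi] p [N [H0 H1]]]; [exists 0; simpl; lra|].
  exists (Rmax N (Rabs (IZR n))). pose proof (Rmax_l N (Rabs (IZR n))). split; [lra|].
  split; [apply Rmax_r|]. now apply tdeg_mono with N.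
Qed.

Lemma idx_max (v : idx -> R) : exists B, forall i, v i <= B.
Proof.
  exists (Rmax (v i1) (Rmax (v i2) (v i3))).
  pose proof (Rmax_l (v i1) (Rmax (v i2) (v i3))). pose proof (Rmax_r (v i1) (Rmax (v i2) (v i3))).
  pose proof (Rmax_l (v i2) (v i3)). pose proof (Rmax_r (v i2) (v i3)).
  intros [ | | ]; lra.
Qed.

Definition initial_data (p c : idx -> tpoly) (a : field) : tpoly :=
  match a with fone => [(1, 0%Z, 0)] | fpi i => p i | fvel i => c i end.

Lemma initial_data_bounds p c : exists A d, 0 <= A /\ 0 <= d /\
  (forall a, tnorm (initial_data p c a) <= A) /\ (forall a, tdeg d (initial_data p c a)).
Proof.
  destruct (idx_max (fun i => tnorm (p i))) as [A1 H1].
  destruct (idx_max (fun i => tnorm (c i))) as [A2 H2].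
  assert (E : forall r : idx -> tpoly, exists d, 0 <= d /\ forall i, tdeg d (r i)).
  { intros r. destruct (tdeg_exists (r i1)) as [d1 [P1 D1]], (tdeg_exists (r i2)) as [d2 [P2 D2]],
      (tdeg_exists (r i3)) as [d3 [P3 D3]].
    exists (d1 + d2 + d3). split; [lra|].
    intros [ | | ]; [apply tdeg_mono with d1|apply tdeg_mono with d2|apply tdeg_mono with d3];
      try easy; lra. }
  destruct (E p) as [d1 [P1 D1]], (E c) as [d2 [P2 D2]].
  exists (Rabs A1 + Rabs A2 + 1), (d1 + d2).
  pose proof (Rle_abs A1). pose proof (Rle_abs A2).
  pose proof (Rabs_pos A1). pose proof (Rabs_pos A2).
  split; [lra|split; [lra|split]].
  - intros [|i|i]; simpl; [rewrite Rabs_R1; lra|specialize (H1 i); simpl in H1; lra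
      |specialize (H2 i); simpl in H2; lra].
  - intros [|i|i]; simpl; [rewrite Rabs_R0; split; [lra|easy]
      |now apply tdeg_mono with d1; [lra|]|now apply tdeg_mono with d2; [lra|]].
Qed.

(** The velocity equation attains the bound: seven coefficients of size 1 and six of size 1/2. *)
Lemma geodesic_rhs_norm a : cubic_norm (geodesic_rhs a) <= 10.
Proof.
  assert (E1 : Rabs (-1) = 1) by (rewrite Rabs_left; lra).
  assert (E2 : Rabs (- / 2) = / 2) by (rewrite Rabs_left; lra).
  assert (E3 : Rabs (/ 2) = / 2) by (rewrite Rabs_right; lra).
  destruct a as [|i|i]; simpl; rewrite ?Rabs_R1, ?E1, ?E2, ?E3; lra.
Qed.

(** The second hypothesis says that each (u / u_i) c_i has integral 0 initially. It persists in
    time, as does the mean of u_i, because both quantities have x-derivatives of periodic functions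
    as their time derivatives; its persistence identifies Q_i(f_i) with u_i c_i. *)
Theorem geodesic_existence (p c : idx -> tpoly) :
  (forall i, RInt (fun x => exp (teval (p i) x)) 0 1 = 1) ->
  (forall i, RInt (fun x => exp (teval (p (nxt i)) x) * exp (teval (p (nxt (nxt i))) x)
                            * teval (c i) x) 0 1 = 0) ->
  exists T u, 0 < T /\ canonical_geodesic (Finite (- T)) (Finite T) u /\
    (forall i x, u 0 i x = exp (teval (p i) x)) /\
    (forall i x, opQ (u 0) i (velocity u 0 i) x = u 0 i x * teval (c i) x) /\
    (forall i x, velocity u 0 i x
       = u 0 i x * (teval (tder (c i)) x + teval (tder (p i)) x * teval (c i) x)).
Proof.
  intros Hmean Hmom.
  destruct (initial_data_bounds p c) as [A [d [HA [Hd [HN HD]]]]].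
  destruct (cauchy_kovalevskaya field geodesic_rhs (initial_data p c) A d 10 HA Hd)
    as [T [HT [D [J [D0 [DP DE]]]]]]; [lra|exact HN|exact HD|exact geodesic_rhs_norm|].
  set (t1 := Finite (- T)) in *. set (t2 := Finite T) in *.
  assert (I0 : Rabs 0 < T) by (rewrite Rabs_R0; lra).
  assert (IN : forall t, Rabs t < T -> in_interval t1 t2 t)
    by (intros t Ht; now apply in_interval_sym).
  assert (NI : forall t, in_interval t1 t2 t -> Rabs t < T)
    by (intros t Ht; now apply in_interval_sym in Ht).
  assert (One : forall t x, Rabs t < T -> D fone 0%nat 0%nat t x = 1).
  { intros t x Ht. rewrite (constant_on_interval (fun s => D fone 0%nat 0%nat s x) T t).
    - rewrite D0. simpl. replace (2 * PI * 0 * x + 0) with 0 by ring. rewrite cos_0. ring.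
    - intros s Hs. replace 0 with (D fone 1%nat 0%nat s x) by (rewrite DE; easy).
      now apply J, IN.
    - easy. }
  pose (P := fun i t x => exp (D (fpi i) 0%nat 0%nat t x)).
  pose (C := fun i => D (fvel i) 0%nat 0%nat).
  pose (Q := fun i t x => P i t x * C i t x).
  pose (M := fun i t x => P (nxt i) t x * P (nxt (nxt i)) t x * C i t x).
  assert (SC : forall i, smooth2 t1 t2 (C i)) by (intros i; apply jet_smooth2, J).
  assert (SP : forall i, smooth2 t1 t2 (P i)) by (intros i; apply smooth2_exp, jet_smooth2, J).
  assert (SQ : forall i, smooth2 t1 t2 (Q i)) by (intros i; now apply smooth2_mult).
  assert (SM : forall i, smooth2 t1 t2 (M i))
    by (intros i; apply smooth2_mult; [now apply smooth2_mult|easy]).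
  assert (JP : forall i, exists E, E 0%nat 0%nat = P i /\ jet t1 t2 E)
    by (intros i; now apply smooth2_jet).
  assert (exists DPi : idx -> nat -> nat -> R -> R -> R,
            forall i, DPi i 0%nat 0%nat = P i /\ jet t1 t2 (DPi i)) as [DPi HP].
  { destruct (JP i1) as [E1 H1], (JP i2) as [E2 H2], (JP i3) as [E3 H3].
    exists (fun i => match i with i1 => E1 | i2 => E2 | i3 => E3 end). now intros [ | | ]. }
  pose (u := fun t i x => P i t x).
  pose (f := fun t i x => DPi i 1%nat 0%nat t x).
  pose (g := fun t i x => DPi i 2%nat 0%nat t x).
  pose (ct := fun i t x => D (fvel i) 1%nat 0%nat t x).
  assert (Hpos : forall t, pos (u t)) by (intros t i x; apply exp_pos).
  assert (Pper : forall i t, periodic (P i t)) by (intros i t x; unfold P; now rewrite DP).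
  assert (Cper : forall i t, periodic (C i t)) by (intros i t x; apply DP).
  assert (Dpx : forall i t x, Rabs t < T ->
     is_derive (P i t) x (P i t x * D (fpi i) 0%nat 1%nat t x)).
  { intros i t x Ht. unfold P. rewrite Rmult_comm.
    apply (is_derive_comp exp (D (fpi i) 0%nat 0%nat t)); [apply is_derive_exp|].
    now apply J, IN. }
  assert (Dpt : forall i t x, Rabs t < T ->
     f t i x = P i t x * (D (fvel i) 0%nat 1%nat t x + D (fpi i) 0%nat 1%nat t x * C i t x)).
  { intros i t x Ht. destruct (HP i) as [H1 H2].
    apply (derive_locally_unique (fun s => DPi i 0%nat 0%nat s x) (fun s => P i s x) t).
    - apply filter_forall. intros s. now rewrite H1.
    - now apply H2, IN.
    - unfold P. rewrite Rmult_comm.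
      apply (is_derive_comp exp (fun s => D (fpi i) 0%nat 0%nat s x)); [apply is_derive_exp|].
      replace (D (fvel i) 0%nat 1%nat t x + D (fpi i) 0%nat 1%nat t x * C i t x)
        with (D (fpi i) 1%nat 0%nat t x); [now apply J, IN|].
      rewrite DE by easy. simpl. rewrite One by easy. unfold C. ring. }
  assert (Dct : forall i t x, Rabs t < T -> is_derive (fun s => C i s x) t (ct i t x))
    by (intros i t x Ht; now apply J, IN).
  assert (Dcx : forall i t x, Rabs t < T -> is_derive (C i t) x (D (fvel i) 0%nat 1%nat t x))
    by (intros i t x Ht; now apply J, IN).
  assert (Dput : forall i t x, Rabs t < T -> is_derive (fun s => P i s x) t (f t i x)).
  { intros i t x Ht. destruct (HP i) as [H1 H2]. rewrite <- H1. now apply H2, IN. }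
  assert (Dqx : forall i t x, Rabs t < T -> is_derive (Q i t) x (f t i x)).
  { intros i t x Ht. rewrite Dpt by easy. unfold Q.
    replace (P i t x * (D (fvel i) 0%nat 1%nat t x + D (fpi i) 0%nat 1%nat t x * C i t x))
      with (P i t x * D (fpi i) 0%nat 1%nat t x * C i t x + P i t x * D (fvel i) 0%nat 1%nat t x) by ring.
    apply (is_derive_mult (P i t) (C i t)); [now apply Dpx|now apply Dcx|exact Rmult_comm]. }
  (* The time derivative of u_i c_i. Since the x-derivative of u_i c_i is f_i, equality of mixed
     partials makes this an antiderivative of the acceleration. *)
  pose (qt := fun i t x => f t i x * C i t x + P i t x * ct i t x).
  assert (Dqt : forall i t x, Rabs t < T -> is_derive (fun s => Q i s x) t (qt i t x)).
  { intros i t x Ht. apply (is_derive_mult (fun s => P i s x) (fun s => C i s x));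
      [now apply Dput|now apply Dct|exact Rmult_comm]. }
  assert (Dqtx : forall i t x, Rabs t < T -> is_derive (qt i t) x (g t i x)).
  { intros i t x Ht. destruct (smooth2_jet _ _ _ (SQ i)) as [E [E0 JE]].
    destruct (HP i) as [H1 H2].
    assert (Et : forall s y, Rabs s < T -> E 1%nat 0%nat s y = qt i s y).
    { intros s y Hs. apply (derive_locally_unique (fun r => Q i r y) (fun r => Q i r y) s).
      - now apply filter_forall.
      - rewrite <- E0. now apply JE, IN.
      - now apply Dqt. }
    assert (Ex : forall s y, Rabs s < T -> E 0%nat 1%nat s y = f s i y).
    { intros s y Hs. apply (derive_locally_unique (Q i s) (Q i s) y).
      - now apply filter_forall.
      - rewrite <- E0. now apply JE, IN.
      - now apply Dqx. }
    replace (g t i x) with (E 1%nat 1%nat t x).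
    - apply (is_derive_ext (E 1%nat 0%nat t)); [intros y; now apply Et|]. now apply JE, IN.
    - apply (derive_locally_unique (fun s => E 0%nat 1%nat s x) (fun s => f s i x) t).
      + generalize (in_interval_locally _ _ _ (IN t Ht)). apply filter_imp.
        intros s Hs. apply Ex. now apply NI.
      + now apply JE, IN.
      + now apply H2, IN. }
  assert (Su : forall t, Rabs t < T -> smooth3 (u t)).
  { intros t Ht i. split; [apply Pper|]. destruct (HP i) as [H1 H2].
    apply smooth_ex_derive_n. unfold u. change (smooth (P i t)). rewrite <- H1.
    apply (jet_smooth t1 t2); [exact H2|now apply IN]. }
  assert (Sc : forall i t, Rabs t < T -> smooth (C i t))
    by (intros i t Ht; apply (jet_smooth t1 t2); [apply J|now apply IN]).
  assert (Sf : forall i m t, Rabs t < T -> smooth (DPi i m 0%nat t))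
    by (intros i m t Ht; apply (jet_smooth t1 t2); [apply HP|now apply IN]).
  assert (Mean : forall i t, Rabs t < T -> RInt (P i t) 0 1 = 1).
  { intros i t Ht. destruct (HP i) as [H1 H2].
    rewrite (constant_on_interval (fun s => RInt (P i s) 0 1) T t).
    - refine (eq_trans _ (Hmean i)). apply RInt_ext. intros x _. unfold P. now rewrite D0.
    - intros s Hs. evar_last.
      + rewrite <- H1. apply (jet_int_derive t1 t2); [exact H2|now apply IN].
      + rewrite (int_Derive (Q i s) (DPi i 1%nat 0%nat s)).
        * pose proof (Pper i s 0) as E1. pose proof (Cper i s 0) as E2. unfold Q.
          rewrite Rplus_0_l in E1, E2. rewrite E1, E2. real_eq. ring.
        * intros x. now apply Dqx.
        * now apply smooth_cts, Sf.
    - easy. }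
  assert (Tf : forall t, Rabs t < T -> tangent_M3 (f t)).
  { intros t Ht i. destruct (HP i) as [H1 H2]. split; [split|].
    - apply (jet_periodic t1 t2); [exact H2| |now apply IN].
      intros s _. rewrite H1. apply Pper.
    - now apply smooth_ex_derive_n, Sf.
    - apply (jet_int_0 t1 t2 _ _ _ 1); [exact H2| |now apply IN].
      intros s Hs. rewrite H1. apply Mean. now apply NI. }
  assert (Tg : forall t, Rabs t < T -> tangent_M3 (g t)).
  { intros t Ht i. destruct (HP i) as [H1 H2]. split; [split|].
    - apply (jet_periodic t1 t2); [exact H2| |now apply IN].
      intros s Hs. apply NI in Hs. exact (proj1 (proj1 (Tf s Hs i))).
    - now apply smooth_ex_derive_n, Sf.
    - apply (jet_int_0 t1 t2 _ _ _ 0); [exact H2| |now apply IN].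
      intros s Hs. apply NI in Hs. exact (proj2 (Tf s Hs i)). }
  assert (Bal : forall i t x, Rabs t < T ->
    (f t (nxt i) x * P (nxt (nxt i)) t x + P (nxt i) t x * f t (nxt (nxt i)) x) * C i t x
      + P (nxt i) t x * P (nxt (nxt i)) t x * ct i t x = - Derive (flux (u t) (fun j => C j t) i) x /\
    weightA (u t) i x * qt i t x + variationA (u t) (f t) i x * Q i t x
      = - Derive (flux (u t) (fun j => C j t) i) x).
  { intros i t x Ht.
    assert (Eb : forall j, Derive (u t j) x / u t j x = D (fpi j) 0%nat 1%nat t x).
    { intros j. change (Derive (P j t) x / P j t x = D (fpi j) 0%nat 1%nat t x).
      rewrite (is_derive_unique _ _ _ (Dpx j t x Ht)).
      field. apply Rgt_not_eq, exp_pos. }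
    apply (momentum_balance (u t) (fun j => C j t) (fun j => D (fvel j) 0%nat 1%nat t x)
             (ct i t x) (f t)).
    - now apply Su.
    - apply Hpos.
    - intros j. now apply Dcx.
    - intros j. rewrite Eb, Dpt by easy. reflexivity.
    - unfold ct. rewrite DE by easy. simpl. rewrite !Eb, One by easy. reflexivity. }
  assert (Sflux : forall i t, Rabs t < T -> smooth (flux (u t) (fun j => C j t) i)).
  { intros i t Ht.
    assert (Suj : forall j, smooth (u t j)) by (intros j; now apply smooth3_smooth, Su).
    assert (Scj : forall j, smooth (C j t)) by (intros j; now apply Sc).
    unfold flux, sum3. apply smooth_mult.
    - apply smooth_div; [apply Hpos|now apply smooth_prod3, Su|apply Suj].
    - apply smooth_minus; [apply smooth_mult; [|apply smooth_const]|].
      + apply smooth_plus; [apply smooth_plus|]; apply smooth_pow, Scj.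
      + apply smooth_pow, Scj. }
  assert (Iflux : forall i t, Rabs t < T -> RInt (Derive (flux (u t) (fun j => C j t) i)) 0 1 = 0).
  { intros i t Ht.
    rewrite (int_Derive (flux (u t) (fun j => C j t) i) (Derive (flux (u t) (fun j => C j t) i))).
    - assert (E : forall j, P j t 1 = P j t 0)
        by (intros j; rewrite <- (Pper j t 0); now rewrite Rplus_0_l).
      assert (E' : forall j, C j t 1 = C j t 0)
        by (intros j; rewrite <- (Cper j t 0); now rewrite Rplus_0_l).
      unfold flux, prod3, sum3, u. rewrite !E, !E'. real_eq. ring.
    - intros x. now apply smooth_is_derive, Sflux.
    - now apply smooth_cts, smooth_Derive, Sflux. }
  assert (Mom : forall i t, Rabs t < T -> RInt (fun x => weightA (u t) i x * Q i t x) 0 1 = 0).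
  { intros i t Ht. destruct (smooth2_jet _ _ _ (SM i)) as [E [E0 JE]].
    rewrite (RInt_ext _ (M i t)).
    2:{ intros x _. unfold weightA, prod3, Q, M, u.
        pose proof (exp_pos (D (fpi i1) 0%nat 0%nat t x)).
        pose proof (exp_pos (D (fpi i2) 0%nat 0%nat t x)).
        pose proof (exp_pos (D (fpi i3) 0%nat 0%nat t x)).
        real_eq. unfold P. destruct i; simpl; field; lra. }
    rewrite (constant_on_interval (fun s => RInt (M i s) 0 1) T t).
    - refine (eq_trans _ (Hmom i)). apply RInt_ext. intros x _. unfold M, P, C. now rewrite !D0.
    - intros s Hs. evar_last.
      + rewrite <- E0. apply (jet_int_derive t1 t2); [exact JE|now apply IN].
      + rewrite (RInt_ext _ (fun x => - Derive (flux (u s) (fun j => C j s) i) x)).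
        * rewrite int_opp, Iflux by (try easy; now apply smooth_cts, smooth_Derive, Sflux).
          apply Ropp_0.
        * intros x _. rewrite <- (proj1 (Bal i s x Hs)).
          apply (derive_locally_unique (fun r => M i r x) (fun r => M i r x) s).
          -- now apply filter_forall.
          -- rewrite <- E0. now apply JE, IN.
          -- apply (is_derive_mult (fun r => P (nxt i) r x * P (nxt (nxt i)) r x) (fun r => C i r x));
               [|now apply Dct|exact Rmult_comm].
             apply (is_derive_mult (fun r => P (nxt i) r x) (fun r => P (nxt (nxt i)) r x));
               [now apply Dput|now apply Dput|exact Rmult_comm].
    - easy. }
  assert (Vel : forall t, Rabs t < T -> velocity u t = f t).
  { intros t Ht. apply (velocity_jet t1 t2 u DPi); [|apply HP|now apply IN].
    intros s _. unfold u. apply functional_extensionality. intros i.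
    now rewrite (proj1 (HP i)). }
  assert (Acc : forall t, Rabs t < T -> acceleration u t = g t).
  { intros t Ht. apply (acceleration_jet t1 t2 u DPi); [|apply HP|now apply IN].
    intros s _. unfold u. apply functional_extensionality. intros i.
    now rewrite (proj1 (HP i)). }
  assert (OpQ : forall i t x, Rabs t < T -> opQ (u t) i (f t i) x = Q i t x).
  { intros i t x Ht. rewrite (opQ_primitive (u t) i (Q i t)).
    - rewrite Mom by easy. unfold Rdiv. ring.
    - now apply Su.
    - apply Hpos.
    - intros y. now apply Dqx.
    - now apply smooth_cts, Sf. }
  exists T, u. split; [easy|]. split; [|split; [|split]].
  - split; [|split].
    + intros t Ht i. apply NI in Ht. split; [now apply Su|split; [apply Hpos|now apply Mean]].
    + intros i. destruct (HP i) as [H1 H2]. exists (DPi i). split; [|exact H2].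
      intros t x _. now rewrite H1.
    + intros t Ht k Tk. apply NI in Ht. rewrite Vel, Acc by easy.
      apply geodesic_operator_0; [now apply Su|apply Hpos|now apply Tf|now apply Tg|easy|].
      intros i x.
      assert (CA : cts (weightA (u t) i)) by (apply smooth_cts, smooth_weightA; [now apply Su|apply Hpos]).
      assert (CV : cts (variationA (u t) (f t) i))
        by (apply smooth_cts, smooth_variationA; [now apply Su|apply tangent_smooth3; now apply Tf|apply Hpos]).
      assert (CQ : cts (Q i t)) by (apply cts_of_derive with (f t i); intros y; now apply Dqx).
      assert (Cqt : cts (qt i t)) by (apply cts_of_derive with (g t i); intros y; now apply Dqtx).
      assert (PA : 0 < RInt (weightA (u t) i) 0 1) by (apply int_weightA_pos; [now apply Su|apply Hpos]).
      assert (Est : stress (u t) (f t) = flux (u t) (fun j => C j t)).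
      { unfold stress. f_equal. apply functional_extensionality. intros j.
        apply functional_extensionality. intros y. rewrite OpQ by easy.
        unfold Q, u. field. apply Rgt_not_eq, exp_pos. }
      (* The balance integrated over the circle. It makes the constant subtracted in Q_i(g_i) cancel
         against [kappa], so that the defect reduces to the pointwise balance. *)
      assert (IK : RInt (fun y => variationA (u t) (f t) i y * Q i t y) 0 1
                   = - RInt (fun y => weightA (u t) i y * qt i t y) 0 1).
      { apply Rplus_eq_reg_l with (RInt (fun y => weightA (u t) i y * qt i t y) 0 1).
        rewrite <- int_plus by (cts_rules; easy). rewrite Rplus_opp_r.
        rewrite (RInt_ext _ (fun y => - Derive (flux (u t) (fun j => C j t) i) y)).
        - rewrite int_opp, Iflux by (try easy; now apply smooth_cts, smooth_Derive, Sflux).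
          apply Ropp_0.
        - intros y _. now apply (proj2 (Bal i t y Ht)). }
      unfold defect, kappa. rewrite Est, OpQ by easy.
      rewrite (RInt_ext (fun y => variationA (u t) (f t) i y * opQ (u t) i (f t i) y)
                 (fun y => variationA (u t) (f t) i y * Q i t y)) by (intros y _; now rewrite OpQ).
      rewrite IK, (opQ_primitive (u t) i (qt i t) (g t i));
        [|now apply Su|apply Hpos|intros y; now apply Dqtx|now apply smooth_cts, Sf].
      pose proof (proj2 (Bal i t x Ht)) as B.
      replace (Derive (flux (u t) (fun j => C j t) i) x)
        with (- (weightA (u t) i x * qt i t x + variationA (u t) (f t) i x * Q i t x))
        by (rewrite B; ring).
      field. lra.
  - intros i x. unfold u, P. now rewrite D0.
  - intros i x. rewrite Vel, OpQ by easy. unfold Q, u, C. now rewrite D0.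
  - intros i x. rewrite Vel, Dpt by easy. unfold u, C. rewrite D0. simpl initial_data.
    do 2 f_equal.
    + apply (derive_locally_unique (C i 0) (teval (c i)) x).
      * apply filter_forall. intros y. apply D0.
      * now apply Dcx.
      * apply teval_tder.
    + f_equal. apply (derive_locally_unique (D (fpi i) 0%nat 0%nat 0) (teval (p i)) x).
      * apply filter_forall. intros y. apply D0.
      * now apply J, IN.
      * apply teval_tder.
Qed.

(** * Volume weights *)

(** Concavity bounds the difference quotients at x along the segment towards y from below by chi y -
    chi x, and their limit is the directional derivative. *)
Lemma weight_tangent chi x y : volume_weight chi -> 0 < x -> 0 < y ->
  chi y <= chi x + Derive chi x * (y - x).
Proof.
  intros Hchi Hx Hy. apply Rnot_lt_le. intros Hlt.
  set (eps := chi y - chi x - Derive chi x * (y - x)) in *.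
  assert (Heps : 0 < eps) by (unfold eps; lra).
  assert (Hd : is_derive (fun l => chi (x + l * (y - x))) 0 (Derive chi x * (y - x))).
  { rewrite Rmult_comm. apply (is_derive_comp chi (fun l => x + l * (y - x))).
    - rewrite Rmult_0_l, Rplus_0_r. now apply weight_derive.
    - auto_derive; [easy|ring]. }
  apply is_derive_Reals in Hd. destruct (Hd eps Heps) as [d H].
  set (l := Rmin (d / 2) 1).
  assert (Hl : 0 < l) by (apply Rmin_pos; [pose proof (cond_pos d)|]; lra).
  assert (Hl1 : l <= 1) by apply Rmin_r.
  assert (Hl2 : l <= d / 2) by apply Rmin_l.
  specialize (H l). rewrite Rplus_0_l, Rmult_0_l, Rplus_0_r in H.
  assert (H' : Rabs ((chi (x + l * (y - x)) - chi x) / l - Derive chi x * (y - x)) < eps).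
  { apply H; [lra|]. rewrite Rabs_pos_eq by lra. pose proof (cond_pos d). lra. }
  apply Rabs_def2 in H'. destruct H' as [H' _].
  pose proof (proj1 (proj2 Hchi) y x l Hy Hx) as Hc.
  replace (l * y + (1 - l) * x) with (x + l * (y - x)) in Hc by ring.
  assert (Hq : chi y - chi x <= (chi (x + l * (y - x)) - chi x) / l).
  { apply (Rmult_le_reg_r l); [easy|]. unfold Rdiv. rewrite Rmult_assoc, Rinv_l by lra. lra. }
  unfold eps in H'. lra.
Qed.

(** A tangent line of negative slope reaches the value -1 at distance h from x, which contradicts
    chi >= 0. *)
Lemma weight_derive_nonneg chi x : volume_weight chi -> 0 < x -> 0 <= Derive chi x.
Proof.
  intros Hchi Hx. apply Rnot_lt_le. intros Hlt.
  pose proof (proj1 Hchi x Hx) as H0.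
  set (h := (chi x + 1) / (- Derive chi x)).
  assert (Hh : 0 < h) by (apply Rdiv_lt_0_compat; lra).
  pose proof (weight_tangent chi x (x + h) Hchi Hx) as H.
  pose proof (proj1 Hchi (x + h)) as H1.
  replace (Derive chi x * (x + h - x)) with (- (chi x + 1)) in H by (unfold h; field; lra).
  lra.
Qed.

(** The mean value theorem gives a point c with nonzero, hence positive, derivative. Adding the
    tangent inequalities at x and at c shows that the derivative at x <= c is at least as large. *)
Lemma nonconstant_weight_derive_pos chi : volume_weight chi -> nonconstant_weight chi ->
  exists v0, 0 < v0 /\ forall v, 0 < v <= v0 -> 0 < Derive chi v.
Proof.
  intros Hchi [v [w [Hv [Hw Hne]]]].
  destruct (MVT_gen chi v w (Derive chi)) as [c [Hc E]].
  - intros x Hx. apply weight_derive; [easy|].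
    unfold Rmin in Hx. destruct (Rle_dec v w); lra.
  - intros x Hx. apply continuity_pt_filterlim, weight_continuous; [easy|].
    unfold Rmin in Hx. destruct (Rle_dec v w); lra.
  - assert (Hc0 : 0 < c) by (unfold Rmin in Hc; destruct (Rle_dec v w); lra).
    pose proof (weight_derive_nonneg chi c Hchi Hc0) as Hn.
    assert (Hp : 0 < Derive chi c).
    { destruct (Req_dec (Derive chi c) 0) as [E0|]; [|lra]. rewrite E0 in E. lra. }
    exists c. split; [easy|]. intros x [Hx Hxc].
    destruct (Req_dec x c) as [->|]; [easy|].
    pose proof (weight_tangent chi x c Hchi Hx Hc0) as T1.
    pose proof (weight_tangent chi c x Hchi Hc0 Hx) as T2.
    nra.
Qed.

Lemma Rpower_third_cube v : 0 < v -> Rpower v (/ 3) ^ 3 = v.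
Proof.
  intros Hv. rewrite <- Rpower_pow by apply exp_pos.
  rewrite Rpower_mult. replace (/ 3 * INR 3) with 1 by (simpl; field). now apply Rpower_1.
Qed.

Lemma is_derive_Rpower a v : 0 < v -> is_derive (fun v => Rpower v a) v (a * Rpower v (a - 1)).
Proof. intros Hv. apply is_derive_Reals. now apply derivable_pt_lim_power. Qed.

Lemma volume_weight_third : volume_weight (fun v => Rpower v (/ 3)).
Proof.
  split; [|split].
  - intros v Hv. apply Rlt_le, exp_pos.
  - intros v w l Hv Hw Hl. set (m := l * v + (1 - l) * w).
    assert (Hm : 0 < m) by (unfold m; nra).
    pose proof (Rpower_third_cube v Hv) as Ev. pose proof (Rpower_third_cube w Hw) as Ew.
    pose proof (Rpower_third_cube m Hm) as Em.
    assert (Pv : 0 < Rpower v (/ 3)) by apply exp_pos.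
    assert (Pw : 0 < Rpower w (/ 3)) by apply exp_pos.
    assert (Pm : 0 < Rpower m (/ 3)) by apply exp_pos.
    set (a := Rpower v (/ 3)) in *. set (b := Rpower w (/ 3)) in *. set (c := Rpower m (/ 3)) in *.
    apply Rnot_lt_le. intros Hlt.
    (* Concavity of the cube root is convexity of the cube; the identity [H2] exhibits the convexity
       gap as a product of nonnegative factors. *)
    assert (H1 : c ^ 3 < (l * a + (1 - l) * b) ^ 3).
    { assert (c * c < (l * a + (1 - l) * b) * (l * a + (1 - l) * b))
        by (apply Rmult_le_0_lt_compat; lra).
      simpl. rewrite !Rmult_1_r. apply Rmult_le_0_lt_compat; nra. }
    assert (H2 : l * a ^ 3 + (1 - l) * b ^ 3 - (l * a + (1 - l) * b) ^ 3
                 = l * (1 - l) * ((a - b) ^ 2 * ((1 + l) * a + (2 - l) * b))) by ring.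
    assert (H3 : 0 <= l * (1 - l) * ((a - b) ^ 2 * ((1 + l) * a + (2 - l) * b))).
    { apply Rmult_le_pos; [apply Rmult_le_pos; lra|].
      apply Rmult_le_pos; [apply pow2_ge_0|].
      apply Rplus_le_le_0_compat; apply Rmult_le_pos; lra. }
    rewrite Em, <- H2 in *. rewrite Ev, Ew in H3. fold m in H3. lra.
  - intros v Hv.
    assert (L : locally v (fun x => 0 < x)) by now apply (open_gt 0 v).
    assert (D1 : forall x, 0 < x -> Derive (fun v => Rpower v (/ 3)) x = / 3 * Rpower x (/ 3 - 1))
      by (intros x Hx; now apply is_derive_unique, is_derive_Rpower).
    assert (D2 : forall x, 0 < x -> is_derive (Derive (fun v => Rpower v (/ 3))) x
                                  (/ 3 * ((/ 3 - 1) * Rpower x (/ 3 - 1 - 1)))).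
    { intros x Hx. apply (is_derive_ext_loc (fun x => / 3 * Rpower x (/ 3 - 1))).
      - assert (Lx : locally x (fun y => 0 < y)) by now apply (open_gt 0 x).
        revert Lx. apply filter_imp. intros y Hy. symmetry. now apply D1.
      - apply (is_derive_scal (fun x => Rpower x (/ 3 - 1))). now apply is_derive_Rpower. }
    split; [eexists; now apply is_derive_Rpower|split; [eexists; now apply D2|]].
    apply (continuous_ext_loc _ (fun x => / 3 * ((/ 3 - 1) * Rpower x (/ 3 - 1 - 1)))).
    + revert L. apply filter_imp. intros x Hx. symmetry.
      change (Derive (Derive (fun v => Rpower v (/ 3))) x = / 3 * ((/ 3 - 1) * Rpower x (/ 3 - 1 - 1))).
      now apply is_derive_unique, D2.
    + apply @ex_derive_continuous. eexists.
      apply (is_derive_scal (fun x => (/ 3 - 1) * Rpower x (/ 3 - 1 - 1))).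
      apply (is_derive_scal (fun x => Rpower x (/ 3 - 1 - 1))). now apply is_derive_Rpower.
Qed.

(** * Indefiniteness of the matrix and the second-derivative test *)

Lemma formQ_indefinite r s : r <> s -> ~ negative_semidefinite (matrix_of (formQ r s)).
Proof.
  intros Hrs H.
  (* On the variables b_12, b_22 the form is (r - s) (b_22 ^ 2 - b_12 b_22). *)
  assert (E : forall y, (r - s) * (1 - y) <= 0).
  { intros y.
    specialize (H (fun k => match k with vb i1 i2 => y | vb i2 i2 => 1 | _ => 0 end)).
    unfold sum_var, sum3 in H. cbv beta iota in H.
    rewrite ?Rmult_0_l, ?Rmult_0_r, ?Rplus_0_l, ?Rplus_0_r in H.
    unfold matrix_of, basis_vec in H.
    repeat match type of H with context [var_eq_dec ?a ?b] =>
      let e := eval vm_compute in (if var_eq_dec a b then true else false) in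
      destruct (var_eq_dec a b); try congruence end.
    unfold formQ in H. simpl in H. lra. }
  (* The values y = 0 and y = 2 bound r - s and its negative by 0, forcing r = s. *)
  pose proof (E 0). pose proof (E 2). lra.
Qed.

(** If d > 0, then f'(c) > f'(-c) for small c > 0, and the mean value theorem for f(t) + f(-t)
    contradicts midpoint concavity at 0. *)
Lemma concave_second_derivative (f : R -> R) T d : 0 < T ->
  (forall t, Rabs t < T -> ex_derive f t) -> is_derive (Derive f) 0 d ->
  (forall h, Rabs h < T -> f h + f (- h) <= 2 * f 0) -> d <= 0.
Proof.
  intros HT Hf Hd Hc. apply Rnot_lt_le. intros Hpos.
  apply is_derive_Reals in Hd.
  destruct (Hd (d / 2)) as [dl H]; [lra|].
  set (h := Rmin (dl / 2) (T / 2)).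
  assert (Hh : 0 < h) by (apply Rmin_pos; [pose proof (cond_pos dl)|]; lra).
  assert (Hh1 : h <= dl / 2) by apply Rmin_l.
  assert (Hh2 : h <= T / 2) by apply Rmin_r.
  destruct (MVT_cor2 (fun t => f t + f (- t)) (fun t => Derive f t - Derive f (- t)) 0 h Hh)
    as [c [Ec [Hc1 Hc2]]].
  - intros t Ht. apply is_derive_Reals.
    assert (HO : is_derive Ropp t (-1))
      by (change (is_derive (fun t => - t) t (-1)); auto_derive; [easy|ring]).
    evar_last.
    + apply (is_derive_plus f (fun t => f (- t))).
      * apply Derive_correct, Hf. rewrite Rabs_pos_eq; lra.
      * apply (is_derive_comp f Ropp).
        -- apply Derive_correct, Hf. rewrite Rabs_Ropp, Rabs_pos_eq; lra.
        -- exact HO.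
    + unfold plus, opp, one, scal; simpl. unfold mult; simpl. ring.
  - pose proof (cond_pos dl) as Hdl.
    assert (A1 : 0 < Derive f c - Derive f 0).
    { specialize (H c). rewrite Rplus_0_l in H.
      assert (H' : Rabs ((Derive f c - Derive f 0) / c - d) < d / 2)
        by (apply H; [lra|rewrite Rabs_pos_eq; lra]).
      apply Rabs_def2 in H'.
      replace (Derive f c - Derive f 0) with ((Derive f c - Derive f 0) / c * c) by (field; lra).
      apply Rmult_lt_0_compat; lra. }
    assert (A2 : 0 < Derive f 0 - Derive f (- c)).
    { specialize (H (- c)). rewrite Rplus_0_l in H.
      assert (H' : Rabs ((Derive f (- c) - Derive f 0) / - c - d) < d / 2)
        by (apply H; [lra|rewrite Rabs_Ropp, Rabs_pos_eq; lra]).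
      apply Rabs_def2 in H'.
      replace (Derive f 0 - Derive f (- c)) with ((Derive f (- c) - Derive f 0) / - c * c) by (field; lra).
      apply Rmult_lt_0_compat; lra. }
    specialize (Hc h). rewrite Ropp_0 in Ec.
    assert (f h + f (- h) <= 2 * f 0) by (apply Hc; rewrite Rabs_pos_eq; lra).
    assert (0 < (Derive f c - Derive f (- c)) * (h - 0)) by (apply Rmult_lt_0_compat; lra).
    lra.
Qed.

(** * Integrals of oscillating functions *)

Lemma int_periodic_INR (h : R -> R) n : cts h -> periodic h ->
  RInt h 0 (INR n) = INR n * RInt h 0 1.
Proof.
  intros Ch Ph. induction n as [|n IH].
  - simpl. rewrite RInt_point. real_eq. unfold zero; simpl. ring.
  - rewrite <- (RInt_Chasles h 0 (INR n) (INR (S n))) by now apply cts_ex_RInt.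
    rewrite IH, S_INR.
    replace (RInt h (INR n) (INR n + 1)) with (RInt h 0 1).
    + unfold plus; simpl. real_eq. ring.
    + pose proof (RInt_comp_lin h 1 (INR n) 0 1) as H.
      replace (1 * 0 + INR n) with (INR n) in H by ring.
      replace (1 * 1 + INR n) with (INR n + 1) in H by ring.
      rewrite <- H by now apply cts_ex_RInt.
      apply RInt_ext. intros x _. unfold scal; simpl; unfold mult; simpl.
      rewrite !Rmult_1_l. symmetry. now apply periodic_INR.
Qed.

(** The substitution stretches [0,1] over n full periods, and the factor n cancels. *)
Lemma int_periodic_scale (h : R -> R) n : (0 < n)%nat -> cts h -> periodic h ->
  RInt (fun x => h (INR n * x)) 0 1 = RInt h 0 1.
Proof.
  intros Hn Ch Ph. apply lt_0_INR in Hn.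
  pose proof (RInt_comp_lin h (INR n) 0 0 1) as H.
  rewrite Rmult_0_r, !Rplus_0_r, Rmult_1_r, int_periodic_INR in H by easy.
  specialize (H (cts_ex_RInt _ _ _ Ch)).
  apply (Rmult_eq_reg_l (INR n)); [|lra]. rewrite <- H.
  rewrite (RInt_ext (fun y => scal (INR n) (h (INR n * y + 0))) (fun y => INR n * h (INR n * y))).
  - symmetry. apply int_scal.
    apply continuous_cts. intros x. apply (continuous_comp (fun x => INR n * x) h);
      [|now apply cts_continuous].
    apply @ex_derive_continuous. auto_derive. easy.
  - intros y _. now rewrite Rplus_0_r.
Qed.

Lemma sin_2PI_IZR n : sin (2 * PI * IZR n) = 0.
Proof.
  apply sin_eq_0_1. exists (2 * n)%Z. rewrite mult_IZR. ring.
Qed.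

Lemma cts_cos w : cts (fun x => cos (w * x)).
Proof.
  apply continuous_cts. intros x. apply @ex_derive_continuous. auto_derive. easy.
Qed.

Lemma cts_sin w : cts (fun x => sin (w * x)).
Proof.
  apply continuous_cts. intros x. apply @ex_derive_continuous. auto_derive. easy.
Qed.

Lemma int_cos_IZR n : (n <> 0)%Z -> RInt (fun x => cos (2 * PI * IZR n * x)) 0 1 = 0.
Proof.
  intros Hn. pose proof PI_RGT_0. apply not_0_IZR in Hn.
  rewrite (int_Derive (fun x => sin (2 * PI * IZR n * x) / (2 * PI * IZR n))).
  - rewrite Rmult_1_r, Rmult_0_r, sin_2PI_IZR, sin_0. real_eq. field. lra.
  - intros x. auto_derive; [easy|]. field. lra.
  - apply cts_cos.
Qed.

(** For n > 1 the frequency 2 n - 2 is nonzero, so every cosine of the expansion integrates to 0 and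
    the constant 1/4 remains; at n = 1 a resonance would lower the value. *)
Lemma int_sin_sqr_cos_sqr n : (1 < n)%Z ->
  RInt (fun x => sin (2 * PI * IZR n * x) ^ 2 * cos (2 * PI * IZR 1 * x) ^ 2) 0 1 = / 4.
Proof.
  intros Hn.
  rewrite (RInt_ext _ (fun x => / 4 * (1 - cos (2 * PI * IZR (2 * n) * x) + cos (2 * PI * IZR 2 * x)
     - / 2 * cos (2 * PI * IZR (2 * n + 2) * x) - / 2 * cos (2 * PI * IZR (2 * n - 2) * x)))).
  - pose proof (fun m => cts_cos (2 * PI * IZR m)) as C.
    rewrite int_scal by (cts_rules; apply C).
    rewrite !int_minus, int_plus, int_minus, !int_scal by (cts_rules; apply C).
    rewrite int_const, !int_cos_IZR by lia. real_eq. field.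
  - intros x _. real_eq.
    set (a := 2 * PI * IZR n * x). set (b := 2 * PI * IZR 1 * x).
    replace (2 * PI * IZR (2 * n) * x) with (2 * a) by (unfold a; rewrite mult_IZR; ring).
    replace (2 * PI * 2 * x) with (2 * b) by (unfold b; ring).
    replace (2 * PI * IZR (2 * n + 2) * x) with (2 * a + 2 * b)
      by (unfold a, b; rewrite plus_IZR, mult_IZR; ring).
    replace (2 * PI * IZR (2 * n - 2) * x) with (2 * a - 2 * b)
      by (unfold a, b; rewrite minus_IZR, mult_IZR; ring).
    rewrite cos_plus, cos_minus, (cos_2a_sin a), (cos_2a_cos b). field.
Qed.

Lemma int_sin_sqr n : (n <> 0)%Z -> RInt (fun x => sin (2 * PI * IZR n * x) ^ 2) 0 1 = / 2.
Proof.
  intros Hn.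
  rewrite (RInt_ext _ (fun x => / 2 * (1 - cos (2 * PI * IZR (2 * n) * x)))).
  - pose proof (fun m => cts_cos (2 * PI * IZR m)) as C.
    rewrite int_scal, int_minus by (cts_rules; apply C).
    rewrite int_const, int_cos_IZR by lia. real_eq. field.
  - intros x _. real_eq. set (a := 2 * PI * IZR n * x).
    replace (2 * PI * IZR (2 * n) * x) with (2 * a) by (unfold a; rewrite mult_IZR; ring).
    rewrite (cos_2a_sin a). field.
Qed.

(** * Non-concavity *)

Lemma cts_exp_comp g : cts g -> cts (fun x => exp (g x)).
Proof.
  intros Cg. apply continuous_cts. intros x.
  apply (continuous_comp g exp); [now apply cts_continuous|].
  apply continuity_pt_filterlim, derivable_continuous_pt, derivable_pt_exp.
Qed.

(** Jensen's inequality, here from exp y >= 1 + y. *)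
Lemma int_exp_ge_1 (g : R -> R) : cts g -> RInt g 0 1 = 0 -> 1 <= RInt (fun x => exp (g x)) 0 1.
Proof.
  intros Cg H.
  replace 1 with (RInt (fun x => 1 + g x) 0 1) at 1.
  - apply RInt_le; [lra|apply cts_ex_RInt; cts_rules; easy|now apply cts_ex_RInt, cts_exp_comp|].
    intros x _. apply exp_ineq1_le.
  - rewrite int_plus, int_const, H by (cts_rules; easy). apply Rplus_0_r.
Qed.

(** One of the exponentials is at least 1 + |A y|, the other is positive, and |y| >= y^2 on
    [-1,1]. *)
Lemma exp_sum_ge A y : 0 <= A -> -1 <= y <= 1 -> 1 + A * y ^ 2 <= exp (A * y) + exp (- A * y).
Proof.
  intros HA Hy. pose proof (exp_ineq1_le (A * y)). pose proof (exp_ineq1_le (- A * y)).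
  pose proof (exp_pos (A * y)). pose proof (exp_pos (- A * y)).
  assert (A * y ^ 2 <= Rabs (A * y)).
  { rewrite Rabs_mult, (Rabs_pos_eq A) by easy. apply Rmult_le_compat_l; [easy|].
    rewrite <- pow2_abs. pose proof (Rabs_le y 1 Hy). pose proof (Rabs_pos y). simpl. nra. }
  unfold Rabs in H3. destruct (Rcase_abs (A * y)); lra.
Qed.

(* The product of the two integrals is 1/u for the initial data below. *)
Lemma int_exp_cos_product A n : 0 <= A -> (n <> 0)%Z ->
  A / 2 <= RInt (fun x => exp (A * cos (2 * PI * IZR n * x))) 0 1
           * RInt (fun x => exp (- A * cos (2 * PI * IZR n * x))) 0 1.
Proof.
  intros HA Hn. pose proof (cts_cos (2 * PI * IZR n)) as C.
  assert (H : forall B, 1 <= RInt (fun x => exp (B * cos (2 * PI * IZR n * x))) 0 1).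
  { intros B. apply (int_exp_ge_1 (fun x => B * cos (2 * PI * IZR n * x))).
    - cts_rules. easy.
    - rewrite int_scal, int_cos_IZR by easy. real_eq. ring. }
  assert (S : 1 + A / 2 <= RInt (fun x => exp (A * cos (2 * PI * IZR n * x))) 0 1
           + RInt (fun x => exp (- A * cos (2 * PI * IZR n * x))) 0 1).
  { assert (CE : forall B, cts (fun x => exp (B * cos (2 * PI * IZR n * x))))
      by (intros B; apply (cts_exp_comp (fun x => B * cos (2 * PI * IZR n * x))); cts_rules; easy).
    rewrite <- int_plus by apply CE.
    apply Rle_trans with (RInt (fun x => 1 + A * cos (2 * PI * IZR n * x) ^ 2) 0 1).
    - rewrite (RInt_ext _ (fun x => 1 + A * (1 - sin (2 * PI * IZR n * x) ^ 2))).
      + pose proof (cts_sin (2 * PI * IZR n)) as Cs.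
        rewrite int_plus, int_scal, int_minus, !int_const, int_sin_sqr by (cts_rules; easy).
        right. field.
      + intros x _. pose proof (sin2_cos2 (2 * PI * IZR n * x)) as E. unfold Rsqr in E.
        real_eq. do 2 f_equal. simpl. lra.
    - apply RInt_le; [lra|apply cts_ex_RInt; cts_rules; easy
                     |apply cts_ex_RInt, cts_plus; apply CE|].
      intros x _. apply exp_sum_ge; [easy|]. apply COS_bound. }
  (* The product of two numbers that are at least 1 is at least their sum minus 1. *)
  pose proof (H A). pose proof (H (- A)). nra.
Qed.

(** The opposite values of b come from u_1 u_3 being constant; they cancel the terms that mix a_2
    with b. *)
Lemma formQ_single r s c c' b :
  formQ r s (fun k => match k with
                      | va i2 => c' | vb i1 i2 => b * c | vb i3 i2 => - (b * c) | _ => 0 end)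
  = r * c' ^ 2 + (s - r) * (b ^ 2 * c ^ 2).
Proof. unfold formQ. simpl. ring. Qed.

(* Initial data with u_1 u_3 constant and u_2 = 1, so that u is constant, and
   velocity concentrated on the second component: then
   Q = r c_2'^2 + (s - r) b_1^2 c_2^2, where b_1 oscillates at frequency n. *)
Lemma geodesic_positive_second_variation chi A n :
  volume_weight chi -> (1 < n)%Z ->
  let k := / (RInt (fun x => exp (A * cos (2 * PI * IZR n * x))) 0 1
              * RInt (fun x => exp (- A * cos (2 * PI * IZR n * x))) 0 1) in
  concave_along_canonical_geodesics chi ->
  weight_r chi k * 2 + (weight_s chi k - weight_r chi k) * (IZR n * A) ^ 2 <= 0.
Proof.
  intros Hchi Hn k Hconc.
  pose proof PI_RGT_0 as HPI.
  pose proof (cts_cos (2 * PI * IZR n)) as C.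
  set (J1 := RInt (fun x => exp (A * cos (2 * PI * IZR n * x))) 0 1) in *.
  set (J3 := RInt (fun x => exp (- A * cos (2 * PI * IZR n * x))) 0 1) in *.
  assert (CE : forall B, cts (fun x => exp (B * cos (2 * PI * IZR n * x))))
    by (intros B; apply (cts_exp_comp (fun x => B * cos (2 * PI * IZR n * x))); cts_rules; easy).
  assert (P1 : 0 < J1) by (apply int_pos; [apply CE|intros; apply exp_pos]).
  assert (P3 : 0 < J3) by (apply int_pos; [apply CE|intros; apply exp_pos]).
  (* The terms of frequency 0 divide the exponentials by J1 and J3, which normalises the means of
     u_1 and u_3 to 1. *)
  pose (p := fun i => match i with
    | i1 => [(A, n, 0); (- ln J1, 0%Z, 0)] | i2 => []
    | i3 => [(- A, n, 0); (- ln J3, 0%Z, 0)] end).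
  pose (c := fun i => match i with i2 => [(1, 1%Z, 0)] | _ => [] end).
  assert (Ec : forall i x, teval (c i) x = match i with i2 => cos (2 * PI * IZR 1 * x) | _ => 0 end).
  { intros [ | | ] x; simpl; [easy| |easy]. rewrite !Rplus_0_r. ring. }
  assert (E1 : forall x, exp (teval (p i1) x) = / J1 * exp (A * cos (2 * PI * IZR n * x))).
  { intros x. simpl. replace (2 * PI * 0 * x + 0) with 0 by ring.
    rewrite cos_0, !Rplus_0_r, Rmult_1_r, exp_plus, exp_Ropp, exp_ln by easy. ring. }
  assert (E3 : forall x, exp (teval (p i3) x) = / J3 * exp (- A * cos (2 * PI * IZR n * x))).
  { intros x. simpl. replace (2 * PI * 0 * x + 0) with 0 by ring.
    rewrite cos_0, !Rplus_0_r, Rmult_1_r, exp_plus, exp_Ropp, exp_ln by easy. ring. }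
  assert (E2 : forall x, exp (teval (p i2) x) = 1) by (intros x; apply exp_0).
  assert (E13 : forall x, exp (teval (p i3) x) * exp (teval (p i1) x) = k).
  { intros x. rewrite E1, E3.
    replace (- A * cos (2 * PI * IZR n * x)) with (- (A * cos (2 * PI * IZR n * x))) by ring.
    rewrite exp_Ropp. unfold k. field.
    repeat split; first [apply Rgt_not_eq, exp_pos|lra]. }
  destruct (geodesic_existence p c) as [T [u [HT [HG [H1 [H2 H3]]]]]].
  { intros [ | | ].
    - rewrite (RInt_ext _ (fun x => / J1 * exp (A * cos (2 * PI * IZR n * x)))) by (intros; apply E1).
      rewrite int_scal by apply CE. fold J1. real_eq. field. lra.
    - rewrite (RInt_ext _ (fun _ => 1)) by (intros; apply E2). apply int_const.
    - rewrite (RInt_ext _ (fun x => / J3 * exp (- A * cos (2 * PI * IZR n * x)))) by (intros; apply E3).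
      rewrite int_scal by apply CE. fold J3. real_eq. field. lra. }
  { assert (Z : forall g : R -> R, RInt (fun x => g x * 0) 0 1 = 0).
    { intros g. rewrite (RInt_ext _ (fun _ => 0)); [apply int_const|].
      intros x _. apply Rmult_0_r. }
    intros [ | | ]; [apply Z| |apply Z].
    rewrite (RInt_ext _ (fun x => k * cos (2 * PI * IZR 1 * x))).
    - rewrite int_scal, int_cos_IZR by (try apply cts_cos; lia). real_eq. ring.
    - intros x _. rewrite Ec. simpl nxt. now rewrite E13. }
  assert (In0 : in_interval (Finite (- T)) (Finite T) 0)
    by (apply in_interval_sym; rewrite Rabs_R0; lra).
  destruct (volume_second_derivative chi _ _ u 0 Hchi HG In0) as [_ V2].
  apply (concave_second_derivative _ T) in V2; [|easy| |].
  2:{ intros t Ht. apply in_interval_sym in Ht.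
      now apply (volume_second_derivative chi _ _ u t Hchi HG). }
  2:{ intros h Hh.
      assert (I1 : in_interval (Finite (- T)) (Finite T) h) by now apply in_interval_sym.
      assert (I2 : in_interval (Finite (- T)) (Finite T) (- h))
        by (apply in_interval_sym; now rewrite Rabs_Ropp).
      pose proof (Hconc _ _ u HG h (- h) (/ 2) I1 I2) as Hc.
      replace (/ 2 * h + (1 - / 2) * - h) with 0 in Hc by field.
      assert (/ 2 * Vol chi (u h) + (1 - / 2) * Vol chi (u (- h)) <= Vol chi (u 0))
        by (apply Hc; lra).
      lra. }
  assert (Eu : forall x, prod3 (u 0) x = k).
  { intros x. unfold prod3. rewrite !H1, E2, <- (E13 x). ring. }
  assert (Du : forall i x, Derive (u 0 i) x = u 0 i x * teval (tder (p i)) x).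
  { intros i x. apply is_derive_unique. rewrite H1, Rmult_comm.
    apply (is_derive_ext (fun x => exp (teval (p i) x))); [intros; now rewrite H1|].
    apply (is_derive_comp exp (teval (p i))); [apply is_derive_exp|apply teval_tder]. }
  assert (Hu : forall i x, u 0 i x <> 0)
    by (intros i x; rewrite H1; apply Rgt_not_eq, exp_pos).
  assert (EQ : forall x, formQ (weight_r chi k) (weight_s chi k) (geodesic_vars (u 0) (velocity u 0) x)
     = weight_r chi k * (2 * PI) ^ 2 * sin (2 * PI * IZR 1 * x) ^ 2
       + (weight_s chi k - weight_r chi k) * (2 * PI * IZR n * A) ^ 2
         * (sin (2 * PI * IZR n * x) ^ 2 * cos (2 * PI * IZR 1 * x) ^ 2)).
  { intros x.
    replace (geodesic_vars (u 0) (velocity u 0) x) with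
      (fun v => match v with
                | va i2 => - (2 * PI) * sin (2 * PI * IZR 1 * x)
                | vb i1 i2 => - (2 * PI * IZR n * A * sin (2 * PI * IZR n * x)) * cos (2 * PI * IZR 1 * x)
                | vb i3 i2 => - (- (2 * PI * IZR n * A * sin (2 * PI * IZR n * x)) * cos (2 * PI * IZR 1 * x))
                | _ => 0 end).
    - rewrite formQ_single. ring.
    - assert (S : forall y, cos (y + (0 + PI / 2)) = - sin y)
        by (intros y; rewrite Rplus_0_l, cos_plus, cos_PI2, sin_PI2; ring).
      apply functional_extensionality. intros [i|i j]; unfold geodesic_vars.
      + rewrite H3, Ec. destruct i; simpl; rewrite ?S; field; apply Hu.
      + rewrite Du, H2, Ec. destruct i, j; simpl; rewrite ?S; field; try split; apply Hu. }
  rewrite (RInt_ext _ (fun x => (k ^ 2 * (weight_r chi k * (2 * PI) ^ 2)) * sin (2 * PI * IZR 1 * x) ^ 2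
       + (k ^ 2 * ((weight_s chi k - weight_r chi k) * (2 * PI * IZR n * A) ^ 2))
         * (sin (2 * PI * IZR n * x) ^ 2 * cos (2 * PI * IZR 1 * x) ^ 2))) in V2.
  2:{ intros x _. rewrite Eu, EQ. real_eq. ring. }
  pose proof (cts_sin (2 * PI * IZR n)) as Cs. pose proof (cts_sin (2 * PI * IZR 1)) as Cs1.
  pose proof (cts_cos (2 * PI * IZR 1)) as Cc1.
  (* The integrals are 1/2 and 1/4; together with (2 PI)^2 they become the coefficients 2 and 1 of
     the claim once k^2 PI^2 is divided out. *)
  rewrite int_plus, !int_scal, int_sin_sqr, int_sin_sqr_cos_sqr in V2 by (try (cts_rules; easy); lia).
  assert (Hk : 0 < k) by (apply Rinv_0_lt_compat; now apply Rmult_lt_0_compat).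
  assert (Hf : 0 < k ^ 2 * PI ^ 2) by (apply Rmult_lt_0_compat; now apply pow_lt).
  apply (Rmult_le_reg_l (k ^ 2 * PI ^ 2)); [exact Hf|].
  rewrite Rmult_0_r. eapply Rle_trans; [|exact V2]. right. field.
Qed.

(** Raising the frequency from 1 to n leaves the two integrals unchanged, hence also the constant
    value k of u. So r and s are frozen while the positive term with (n A)^2 grows without bound. *)
Lemma not_concave_along_geodesics chi v0 : volume_weight chi -> 0 < v0 ->
  (forall v, 0 < v <= v0 -> 0 < Derive chi v) -> ~ concave_along_canonical_geodesics chi.
Proof.
  intros Hchi Hv0 Hpos Hconc.
  (* The product of the two integrals is at least A / 2 = 1 / v0, which places k in the interval (0,
     v0] where chi has positive derivative. *)
  pose (A := 2 / v0).
  assert (HA : 0 < A) by (apply Rdiv_lt_0_compat; lra).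
  pose (J := fun B n => RInt (fun x => exp (B * cos (2 * PI * IZR n * x))) 0 1).
  assert (EJ : forall B n, (0 < n)%nat -> J B (Z.of_nat n) = J B 1%Z).
  { intros B n Hn. unfold J.
    refine (eq_trans _ (int_periodic_scale (fun x => exp (B * cos (2 * PI * IZR 1 * x))) n Hn _ _)).
    - apply RInt_ext. intros x _. real_eq. rewrite INR_IZR_INZ. do 3 f_equal. ring.
    - apply (cts_exp_comp (fun x => B * cos (2 * PI * IZR 1 * x))).
      pose proof (cts_cos (2 * PI * IZR 1)). cts_rules. easy.
    - intros x. do 2 f_equal. rewrite Rmult_plus_distr_l.
      replace (2 * PI * IZR 1 * x + 2 * PI * IZR 1 * 1) with (2 * PI * IZR 1 * x + 2 * INR 1 * PI)
        by (simpl; ring).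
      apply cos_period. }
  pose (k := / (J A 1%Z * J (- A) 1%Z)).
  assert (HJ : A / 2 <= J A 1%Z * J (- A) 1%Z) by (apply int_exp_cos_product; [lra|lia]).
  assert (Hk : 0 < k <= v0).
  { assert (E : A / 2 = / v0) by (unfold A; field; lra).
    assert (0 < / v0) by now apply Rinv_0_lt_compat.
    split; [apply Rinv_0_lt_compat; lra|].
    unfold k. rewrite <- (Rinv_inv v0). apply Rinv_le_contravar; lra. }
  assert (Hs : 0 < weight_s chi k - weight_r chi k).
  { unfold weight_s, weight_r. specialize (Hpos k Hk).
    assert (0 < / k) by (apply Rinv_0_lt_compat; lra).
    assert (0 < Derive chi k * / k) by now apply Rmult_lt_0_compat. lra. }
  set (s := weight_s chi k - weight_r chi k) in *.
  destruct (INR_unbounded (Rabs (weight_r chi k) * 2 / (s * A ^ 2))) as [m Hm].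
  (* Adding 2 secures n > 1, and n >= 1 gives n <= n^2, so a bound linear in n suffices. *)
  set (n := (m + 2)%nat).
  pose proof (geodesic_positive_second_variation chi A (Z.of_nat n) Hchi) as H.
  cbv zeta in H. change (RInt (fun x => exp (A * cos (2 * PI * IZR (Z.of_nat n) * x))) 0 1)
    with (J A (Z.of_nat n)) in H.
  change (RInt (fun x => exp (- A * cos (2 * PI * IZR (Z.of_nat n) * x))) 0 1)
    with (J (- A) (Z.of_nat n)) in H.
  rewrite !EJ in H by (unfold n; lia). fold k in H.
  specialize (H ltac:(unfold n; lia) Hconc). fold s in H.
  rewrite <- INR_IZR_INZ in H.
  assert (HsA : 0 < s * A ^ 2) by (apply Rmult_lt_0_compat; [easy|now apply pow_lt]).
  assert (Hmn : INR m < INR n) by (apply lt_INR; unfold n; lia).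
  assert (Hn1 : 1 <= INR n) by (change 1 with (INR 1); apply le_INR; unfold n; lia).
  assert (B1 : Rabs (weight_r chi k) * 2 < INR m * (s * A ^ 2)).
  { apply (Rmult_lt_compat_r (s * A ^ 2)) in Hm; [|easy].
    unfold Rdiv in Hm. rewrite Rmult_assoc, Rinv_l in Hm by lra. lra. }
  assert (B2 : INR m * (s * A ^ 2) <= INR n ^ 2 * (s * A ^ 2)).
  { apply Rmult_le_compat_r; [lra|]. nra. }
  pose proof (Rle_abs (- weight_r chi k)) as Ha. rewrite Rabs_Ropp in Ha.
  replace (s * (INR n * A) ^ 2) with (INR n ^ 2 * (s * A ^ 2)) in H by ring. lra.
Qed.

Theorem theorem1p4 :
  (forall chi : R -> R, volume_weight chi ->
     (forall (t1 t2 : Rbar) (u : path), canonical_geodesic t1 t2 u ->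
        forall t : R, in_interval t1 t2 t ->
          ex_derive (fun tau => Vol chi (u tau)) t /\
          is_derive (Derive (fun tau => Vol chi (u tau))) t
            (RInt (fun x =>
                     prod3 (u t) x ^ 2
                     * formQ (weight_r chi (prod3 (u t) x)) (weight_s chi (prod3 (u t) x))
                             (geodesic_vars (u t) (velocity u t) x)) 0 1))
     /\
     (forall v : R, 0 < v -> Derive chi v <> 0 ->
        ~ negative_semidefinite (matrix_of (formQ (weight_r chi v) (weight_s chi v))))
     /\
     (nonconstant_weight chi -> ~ concave_along_canonical_geodesics chi))
  /\
  ~ concave_along_canonical_geodesics (fun v => Rpower v (/ 3)).
Proof.
  split.
  - intros chi Hchi. split; [|split].
    + intros t1 t2 u HG t Ht. now apply (volume_second_derivative chi t1 t2).
    (* Equality of r and s would force chi_u / u = s - r to vanish. *)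
    + intros v Hv Hd. apply formQ_indefinite. unfold weight_s, weight_r. intros E.
      apply Hd. apply (Rmult_eq_reg_r (/ v)); [lra|].
      apply Rinv_neq_0_compat. lra.
    + intros Hnc. destruct (nonconstant_weight_derive_pos chi Hchi Hnc) as [v0 [H0 H]].
      now apply (not_concave_along_geodesics chi v0).
  (* The derivative of the cube root is positive on the whole half-line, so the bound 1 is an
     arbitrary choice. *)
  - apply (not_concave_along_geodesics _ 1); [exact volume_weight_third|lra|].
    intros v [Hv _]. apply Rlt_le_trans with (/ 3 * Rpower v (/ 3 - 1)).
    2:{ right. symmetry. now apply is_derive_unique, is_derive_Rpower. }
    apply Rmult_lt_0_compat; [lra|apply exp_pos].
Qed.
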